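(* Let $H$ be a Hilbert space and let $A:D(A)\to H$ be a positive self-adjoint operator with compact inverse, with eigenvalues $0<\lambda_1\le\lambda_2\le\cdots$ and orthonormal basis of eigenvectors $\{e_n\}$. Assume $L_0:=\sup_{n\in\mathbb N}(\lambda_{n+1}-\lambda_n)<\infty$. Then for every $L>\frac12L_0$ such that in addition $L>\lambda_2$, there exists a smooth nonlinearity $F:H\to H$ satisfying $\|F(u)-F(v)\|_H\le L\|u-v\|_H$ for all $u,v\in H$, such that the equation $\partial_t u+Au=F(u)$ possesses a global attractor $\mathcal A$ which contains at least two (distinct) trajectories $u(t)$ and $v(t)$ satisfying $$\|u(t)-v(t)\|_H\le Ce^{-\kappa t^2},\qquad t\ge0,$$ for some positive constants $C$ and $\kappa$.
   Context: A global attractor of the semigroup $S(t)$ generated by $\partial_t u+Au=F(u)$ in $H$ is a compact, strictly invariant set $\mathcal A\subset H$ attracting the images of all bounded subsets of $H$ as $t\to\infty$. A trajectory on the attractor is a solution $u(t)$, $t\in\mathbb R$, of the equation with $u(t)\in\mathcal A$ for all $t$. *)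

(* Defs.v *)
From HB Require Import structures.
From mathcomp Require Import all_boot all_order all_algebra.
From mathcomp Require Import all_classical all_reals all_analysis.
Set Implicit Arguments. Unset Strict Implicit. Unset Printing Implicit Defensive.
Import Order.TTheory GRing.Theory Num.Theory.
Import numFieldNormedType.Exports.
Local Open Scope classical_set_scope.
Local Open Scope ring_scope.

Section HilbertDefs.
Context {R : realType} {V : normedModType R}.

(* ip is an inner product inducing the norm of V (with completeness of V,
   V is a real Hilbert space). *)
Definition inner_product (ip : V -> V -> R) : Prop :=
  (forall u v, ip u v = ip v u) /\
  (forall (a : R) u v w, ip (a *: u + v) w = a * ip u w + ip v w) /\
  (forall u, ip u u = `|u| ^+ 2).

Definition bounded_set (S : set V) : Prop :=
  exists M : R, forall x, S x -> `|x| <= M.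

Definition linear_on (A : V -> V) (DA : set V) : Prop :=
  DA 0 /\ (forall (a : R) u v, DA u -> DA v -> DA (a *: u + v)) /\
  (forall (a : R) u v, DA u -> DA v -> A (a *: u + v) = a *: A u + A v).

(* densely defined self-adjoint operator: symmetric, and dom(adjoint) is contained in D(A), adjoint = A *)
Definition self_adjoint (ip : V -> V -> R) (A : V -> V) (DA : set V) : Prop :=
  linear_on A DA /\ closure DA = setT /\
  (forall u v, DA u -> DA v -> ip (A u) v = ip u (A v)) /\
  (forall v w, (forall u, DA u -> ip (A u) v = ip u w) -> DA v /\ A v = w).

Definition positive_op (ip : V -> V -> R) (A : V -> V) (DA : set V) : Prop :=
  forall u, DA u -> u <> 0 -> 0 < ip (A u) u.

Definition compact_inverse (A : V -> V) (DA : set V) : Prop :=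
  exists B : V -> V,
    (forall (a : R) f g, B (a *: f + g) = a *: B f + B g) /\
    continuous B /\
    (forall f, DA (B f) /\ A (B f) = f) /\
    (forall u, DA u -> B (A u) = u) /\
    (forall S, bounded_set S -> compact (closure (B @` S))).

Definition orthonormal_basis (ip : V -> V -> R) (e : nat -> V) : Prop :=
  (forall i j, ip (e i) (e j) = (i == j)%:R) /\
  (forall u, (forall n, ip u (e n) = 0) -> u = 0).

Fixpoint iter_dd (F : V -> V) (k : nat) (vs : nat -> V) : V -> V :=
  match k with
  | 0 => F
  | k'.+1 => fun x => 'D_(vs k') (iter_dd F k' vs) x
  end.

(* C^infinity: all iterated directional derivatives exist and are jointly
   continuous in (x, v_0, ..., v_{k-1}); on Banach spaces this coincides with
   Frechet C^infinity. *)
Definition smooth (F : V -> V) : Prop :=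
  (forall k vs x, derivable (iter_dd F k vs) x (vs k)) /\
  (forall k vs x (eps : R), 0 < eps -> exists delta : R, 0 < delta /\
     forall y ws, `|y - x| < delta -> (forall i, (i < k)%N -> `|ws i - vs i| < delta) ->
       `|iter_dd F k ws y - iter_dd F k vs x| < eps).

Definition solution_at (A : V -> V) (DA : set V) (F : V -> V) (u : R -> V) (t : R) : Prop :=
  derivable u t 1 /\ DA (u t) /\ 'D_1 u t + A (u t) = F (u t).

Definition generates_semigroup (A : V -> V) (DA : set V) (F : V -> V) (S : R -> V -> V) : Prop :=
  forall u0,
    S 0 u0 = u0 /\ S x u0 @[x --> 0^'+] --> u0 /\
    (forall t, 0 < t -> solution_at A DA F (fun s => S s u0) t) /\
    (forall w : R -> V, w 0 = u0 -> w x @[x --> 0^'+] --> u0 ->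
       (forall t, 0 < t -> solution_at A DA F w t) ->
       forall t, 0 <= t -> w t = S t u0).

Definition global_attractor (S : R -> V -> V) (Att : set V) : Prop :=
  compact Att /\
  (forall t, 0 <= t -> S t @` Att = Att) /\
  (forall B, bounded_set B -> forall eps : R, 0 < eps -> exists T : R,
     forall t, T <= t -> forall b, B b -> exists a, Att a /\ `|S t b - a| < eps).

Definition trajectory_on (A : V -> V) (DA : set V) (F : V -> V) (Att : set V) (u : R -> V) : Prop :=
  (forall t, solution_at A DA F u t) /\ (forall t, Att (u t)).

End HilbertDefs.

(* Main.v *)
(* The orbit [v] moves in the plane of [e 0] and [e 1]: it leaves the equilibrium [3 *: e 0] along the axis and
   ends up turning with constant angular speed on a circle.  The second trajectory is [v + w], with [w] small and
   carried by a chain [f 0 = e 1, f 1, f 2, ..] of eigenvectors whose consecutive eigenvalues differ by at least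
   [eps] and at most [G < 2 L].  Moving both eigenvalues of a pair [f k], [f k.+1] to their mean costs a
   perturbation of norm at most [G / 2 < L], after which an arbitrarily small term can rotate [w] from [f k] to
   [f k.+1].  The nonlinearity does this for the pairs of one parity or of the other according to the angle of
   the planar component, so that [w] climbs one step of the chain at each quarter turn of [v].  At time [t] its
   decay rate is then at least proportional to [t], whence the bound [exp (- kappa t^2)].  The first step, from
   [f 0], which lies in the plane, is performed while [v] is still on the axis; before it [w] is constant, so
   both trajectories are bounded for all times.

   The nonlinearity is bounded, so mild solutions, built mode by mode, are absorbed by a bounded set, and time
   differences show that they are strong and that the flow maps bounded sets into bounded sets of the domain.
   The attractor is the omega-limit set of the absorbing ball and contains every bounded full trajectory. *)
Require Import Defs.
From HB Require Import structures.
From mathcomp Require Import all_boot all_order all_algebra.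
From mathcomp Require Import all_classical all_reals all_analysis.
From mathcomp Require Import ring lra.
Set Implicit Arguments. Unset Strict Implicit. Unset Printing Implicit Defensive.
Import Order.TTheory GRing.Theory Num.Theory.
Import numFieldNormedType.Exports.
Local Open Scope classical_set_scope.
Local Open Scope ring_scope.

(** * Derivatives and Gronwall's inequality *)

(** Backwards in time [w] must stay bounded, and a perturbation of norm [G / 2] cannot stop the
    decay of a mode with a large eigenvalue. So [w] must come from a direction in which [F] cancels
    [A]; [e 0] being taken by the motion of [v] along the axis, it comes from [e 1], and cancelling
    there costs [lam 1 < L]. Once the two decay rates of a pair are equal, nothing opposes a
    rotation between them, which is why an arbitrarily slow one suffices. Two parities are needed
    because [f k] must be slowed down when it is reached from [f k.-1] and sped up when it is left
    for [f k.+1]. The coupling coefficients depend on the planar position, so the variation of [F]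
    contains terms proportional to [w]. These are made harmless by truncating [w] at radius [del].
    The factor [om] slows down the planar motion and the rotations of [w] together, so they stay
    synchronised; it only affects the constants [C] and [kappa]. The Gaussian rate results from two
    linear bounds: the [k]-th stage starts at a time at most proportional to [k], and decays at a
    rate at least proportional to [k]. *)

Definition deriv_at {R : realType} {V : normedModType R} (f : R -> V) (x : R) (d : V) : Prop :=
  is_derive x 1 f d.

Section Derivatives.
Context {R : realType} {V : normedModType R}.
Implicit Types (f g : R -> R) (x : R).

Lemma deriv_at_eq (f : R -> V) x a b : deriv_at f x a -> a = b -> deriv_at f x b.
Proof. by move=> ? <-. Qed.

Lemma deriv_atP (f : R -> V) x a : derivable f x 1 -> 'D_1 f x = a -> deriv_at f x a.
Proof. exact: DeriveDef. Qed.

Lemma deriv_at_cst (c : V) x : deriv_at (fun _ : R => c) x 0.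
Proof. exact: is_derive_cst. Qed.

Lemma deriv_at_add (f g : R -> V) x a b : deriv_at f x a ->
  deriv_at g x b -> deriv_at (fun t => f t + g t) x (a + b).
Proof. by move=> ? ?; apply: is_deriveD. Qed.

Lemma deriv_at_opp (f : R -> V) x a : deriv_at f x a ->
  deriv_at (fun t => - f t) x (- a).
Proof. by move=> ?; apply: is_deriveN. Qed.

Lemma deriv_at_scale f (v : V) x a : deriv_at f x a ->
  deriv_at (fun t => f t *: v) x (a *: v).
Proof.
case=> df dfE.
have cv : (fun h : R => h^-1 *: (((fun t => f t *: v) \o shift x) (h *: (1:R)) - f x *: v)) @ 0^' --> a *: v.
  rewrite [X in X @ _](_ : _ =
     (fun h : R => (h^-1 *: ((f \o shift x) (h *: (1:R)) - f x)) *: v)); last first.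
    by apply/funext => h /=; rewrite -scalerBl scalerA.
  by apply: cvgZr_tmp; move: df; rewrite /derivable -dfE.
apply: deriv_atP; first by apply/cvg_ex; exists (a *: v).
exact: cvg_lim cv.
Qed.

Lemma deriv_at_sum (I : Type) (r : seq I) (P : pred I) (h : I -> R -> V) (dh : I -> V) x :
  (forall i, deriv_at (h i) x (dh i)) ->
  deriv_at (fun t => \sum_(i <- r | P i) h i t) x (\sum_(i <- r | P i) dh i).
Proof.
move=> H; elim: r => [|i r IH].
  under eq_fun do rewrite big_nil.
  rewrite big_nil; exact: deriv_at_cst.
under eq_fun do rewrite big_cons.
rewrite big_cons; case: (P i) => //.
exact: deriv_at_add.
Qed.

Lemma deriv_at_near (f g : R -> V) x a : (\near x, f x = g x) ->
  deriv_at f x a -> deriv_at g x a.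
Proof. exact: near_eq_is_derive. Qed.

Lemma deriv_at_continuous (f : R -> V) x a : deriv_at f x a -> {for x, continuous f}.
Proof. by case=> df _; apply/differentiable_continuous/derivable1_diffP. Qed.

End Derivatives.

Section RealDerivatives.
Context {R : realType}.
Implicit Types (f g : R -> R) (x : R).

Lemma deriv_at_id x : deriv_at (fun t : R => t) x 1.
Proof. exact: is_derive_id. Qed.

Lemma deriv_at_mul f g x a b : deriv_at f x a -> deriv_at g x b ->
  deriv_at (fun t => f t * g t) x (a * g x + f x * b).
Proof.
move=> df dg; have h : deriv_at (f * g : R -> R) x (f x *: b + g x *: a) by exact: is_deriveM.
have <- : f x *: b + g x *: a = a * g x + f x * b.
  by rewrite addrC /GRing.scale /= (mulrC (g x)).
exact: h.
Qed.

Lemma deriv_at_exp f x n a : deriv_at f x a ->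
  deriv_at (fun t => f t ^+ n) x (n%:R * f x ^+ n.-1 * a).
Proof.
move=> df; have h : deriv_at (f ^+ n : R -> R) x ((n%:R * f x ^+ n.-1) *: a).
  exact: is_deriveX.
by rewrite exprfctE in h.
Qed.

Lemma deriv_at_comp f g x a b : deriv_at f x a ->
  deriv_at g (f x) b -> deriv_at (fun t => g (f t)) x (b * a).
Proof. move=> ? ?; exact: is_derive1_comp. Qed.

Lemma deriv_at_expR f x a : deriv_at f x a ->
  deriv_at (fun t => expR (f t)) x (expR (f x) * a).
Proof. by move=> df; apply: (deriv_at_comp df); apply: is_derive_expR. Qed.

Lemma deriv_at_cos f x a : deriv_at f x a ->
  deriv_at (fun t => cos (f t)) x (- sin (f x) * a).
Proof. by move=> df; apply: (deriv_at_comp df); apply: is_derive_cos. Qed.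

Lemma deriv_at_sin f x a : deriv_at f x a ->
  deriv_at (fun t => sin (f t)) x (cos (f x) * a).
Proof. by move=> df; apply: (deriv_at_comp df); apply: is_derive_sin. Qed.

Lemma deriv_at_inv f x a : deriv_at f x a -> f x != 0 ->
  deriv_at (fun t => (f t)^-1) x (- (f x) ^- 2 * a).
Proof.
move=> [df dfE] f0; apply: deriv_atP; first exact: derivableV.
by rewrite deriveV // dfE.
Qed.

End RealDerivatives.

Ltac dstep := first
  [ eassumption
  | apply: deriv_at_cst | apply: deriv_at_id
  | apply: deriv_at_add | apply: deriv_at_opp | apply: deriv_at_mul
  | apply: deriv_at_exp | apply: deriv_at_scale
  | apply: deriv_at_expR | apply: deriv_at_cos | apply: deriv_at_sin ].
Ltac dauto := repeat dstep.

Section MonotoneGronwall.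
Context {R : realType}.
Implicit Types (f : R -> R) (a b : R).

Lemma cvg_right_of_derive (V : normedModType R) (f : R -> V) a d :
  deriv_at f a d -> f x @[x --> a^'+] --> f a.
Proof. by move=> /deriv_at_continuous /cvg_at_right_filter. Qed.

(** Solutions of the evolution equation are differentiable only after their initial time; at [a]
    right continuity has to suffice. *)
Lemma derive_le f (f' : R -> R) a b : a <= b -> f x @[x --> a^'+] --> f a ->
  (forall x, a < x <= b -> deriv_at f x (f' x)) ->
  (forall x, a < x <= b -> f' x <= 0) -> f b <= f a.
Proof.
rewrite le_eqVlt => /predU1P[->//|ab] fa df f0.
have h := @ler0_derive1_le R f a b _ _ true false.
apply: h => //.
- move=> x; rewrite in_itv/= => /andP[ax xb].
  by have [] := df x; rewrite ?ax ?(ltW xb).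
- move=> x; rewrite in_itv/= => /andP[ax xb].
  by rewrite derive1E (@derive_val _ _ _ _ _ _ _ (df x _)) ?f0 ?ax ?(ltW xb).
- apply/continuous_within_itvP => //; split => //.
  + move=> x; rewrite in_itv/= => /andP[ax xb].
    apply: (deriv_at_continuous (df x _)); by rewrite ax ltW.
  + apply: cvg_at_left_filter.
    by apply: (deriv_at_continuous (df b _)); rewrite ab lexx.
- by rewrite in_itv/= lexx ltW.
- by rewrite in_itv/= lexx ltW.
- exact: ltW.
Qed.

Lemma derive_ge f (f' : R -> R) a b : a <= b -> f x @[x --> a^'+] --> f a ->
  (forall x, a < x <= b -> deriv_at f x (f' x)) ->
  (forall x, a < x <= b -> 0 <= f' x) -> f a <= f b.
Proof.
move=> ab fa df f0; rewrite -lerN2.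
apply: (@derive_le (fun t => - f t) (fun t => - f' t)) => //.
- exact: cvgN.
- by move=> x xab; apply: deriv_at_opp; apply: df.
- by move=> x xab; rewrite oppr_le0 f0.
Qed.

Lemma derive0_eq f a b : a <= b ->
  (forall x, a <= x <= b -> deriv_at f x 0) -> f a = f b.
Proof.
move=> ab df.
have fa : f x @[x --> a^'+] --> f a.
  by apply: (@cvg_right_of_derive _ f a 0); apply: df; rewrite lexx.
have dfx x : a < x <= b -> deriv_at f x (cst 0 x).
  by move=> /andP[ax xb]; apply: df; rewrite ltW.
by apply/eqP; rewrite eq_le (derive_ge ab fa dfx) // (derive_le ab fa dfx).
Qed.

(** The sign of [k] is free: [k = - lam m] gives the exponential decay of modes, [k = 2 * L] the
    growth of squared differences of solutions. *)
Lemma gronwall f (f' : R -> R) k a b : a <= b -> f x @[x --> a^'+] --> f a ->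
  (forall x, a < x <= b -> deriv_at f x (f' x)) ->
  (forall x, a < x <= b -> f' x <= k * f x) -> f b <= f a * expR (k * (b - a)).
Proof.
move=> ab fa df fk.
have H : f b * expR (- (k * (b - a))) <= f a * expR (- (k * (a - a))).
  have de (x : R) : deriv_at (fun t => expR (- (k * (t - a)))) x (expR (- (k * (x - a))) * - k).
    by apply: deriv_at_eq; [dauto | cbv beta; ring].
  apply: (@derive_le (fun t => f t * expR (- (k * (t - a))))
     (fun t => f' t * expR (- (k * (t - a))) + f t * (expR (- (k * (t - a))) * - k))) => //.
  - apply: cvgM => //; exact: (cvg_right_of_derive (de a)).
  - move=> x /df dfx; exact: deriv_at_mul.
  - move=> x /fk fkx.
    rewrite (_ : _ + _ = (f' x - k * f x) * expR (- (k * (x - a)))); last ring.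
    by rewrite mulr_le0_ge0 ?expR_ge0 // subr_le0.
move: H; rewrite subrr mulr0 oppr0 expR0 mulr1 expRN => H.
by rewrite -ler_pdivrMr ?expR_gt0.
Qed.

End MonotoneGronwall.

Section Primitive.
Context {R : realType}.

Lemma primitive_above (f : R -> R) (a : R) : continuous f ->
  exists G : R -> R, forall x, a < x -> deriv_at G x (f x).
Proof.
move=> cf.
exists (fun x => (\int[@lebesgue_measure R]_(t in [set` `[a, x]]) f t)%R) => x ax.
have [d1 d2] : derivable (fun x => (\int[@lebesgue_measure R]_(t in [set` `[a, x]]) f t)%R) x 1 /\
  derive1 (fun x => (\int[@lebesgue_measure R]_(t in [set` `[a, x]]) f t)%R) x = f x.
  apply: (@continuous_FTC1_closed _ f a x (x + 1)) => //.
  - by rewrite ltrDl.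
  - apply: continuous_compact_integrable; first exact: segment_compact.
    exact: continuous_subspaceT.
  - exact: cf.
exact: (deriv_atP d1 (etrans (esym (derive1E _ _)) d2)).
Qed.

(** Integration from [a] yields a primitive to the right of [a] only. The primitives started at
    [- n.+1] and normalised at 0 agree wherever both are valid, so at [x] one may take the one
    indexed by the integer part of [|x|]. *)
Lemma primitive_exists (f : R -> R) : continuous f ->
  exists F : R -> R, F 0 = 0 /\ forall x, deriv_at F x (f x).
Proof.
move=> cf.
have /choice[G dG] : forall n : nat, exists G : R -> R,
    G 0 = 0 /\ forall x, - n.+1%:R < x -> deriv_at G x (f x).
  move=> n; have [G dG] := primitive_above (- n.+1%:R) cf.
  exists (fun x => G x - G 0); split; first by rewrite subrr.
  move=> x /dG dx; apply: deriv_at_eq; first exact: (deriv_at_add dx (deriv_at_cst (- G 0) x)).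
  by rewrite addr0.
have GE n m y : - n.+1%:R < y -> - m.+1%:R < y -> G n y = G m y.
  move=> ny my; have [Gn0 Gn] := dG n; have [Gm0 Gm] := dG m.
  have dd x : - n.+1%:R < x -> - m.+1%:R < x -> deriv_at (fun t => G n t - G m t) x 0.
    move=> /Gn dn /Gm dm; apply: deriv_at_eq.
      exact: (deriv_at_add dn (deriv_at_opp dm)).
    by rewrite subrr.
  apply/eqP; rewrite -subr_eq0; apply/eqP.
  have <- : G n 0 - G m 0 = 0 by rewrite Gn0 Gm0 subr0.
  have n0 k : - k.+1%:R < 0 :> R by rewrite oppr_lt0.
  have [y0|y0] := leP y 0.
    apply: (@derive0_eq _ (fun t => G n t - G m t)) => // x /andP[yx _].
    by apply: dd; apply: lt_le_trans yx.
  apply/esym/(@derive0_eq _ (fun t => G n t - G m t)); first exact: ltW.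
  by move=> x /andP[yx _]; apply: dd; apply: lt_le_trans yx.
have lbn (x : R) n : `|x| < n.+1%:R -> - n.+1%:R < x.
  by move=> xn; rewrite ltrNl (le_lt_trans _ xn) // -normrN ler_norm.
have nx (x : R) : `|x| < (Num.truncn `|x|).+1%:R by rewrite truncnS_gt.
exists (fun x => G (Num.truncn `|x|) x); split; first by have [] := dG (Num.truncn `|0 : R|).
move=> x; set N := (Num.truncn `|x|); have [_ /(_ x (lbn _ _ (nx x))) dN] := dG N.
apply: deriv_at_near dN.
apply: filterS (lt_nbhsr (lbn _ _ (nx x))) => y Ny.
by apply: GE => //; exact: lbn.
Qed.

End Primitive.

(** * Inner products and orthonormal bases *)

Section InnerProduct.
Context {R : realType} {V : completeNormedModType R} (ip : V -> V -> R).
Hypothesis ipP : inner_product ip.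

Lemma ipC u v : ip u v = ip v u. Proof. exact: ipP.1. Qed.
Lemma ipDZl a u v w : ip (a *: u + v) w = a * ip u w + ip v w.
Proof. exact: ipP.2.1. Qed.
Lemma ipE u : ip u u = `|u| ^+ 2. Proof. exact: ipP.2.2. Qed.

Lemma ipDl u v w : ip (u + v) w = ip u w + ip v w.
Proof. by rewrite -[u]scale1r ipDZl mul1r scale1r. Qed.
Lemma ip0l w : ip 0 w = 0.
Proof. by have := ipDl 0 0 w; rewrite addr0 => /eqP; rewrite -subr_eq0 opprD addNKr oppr_eq0 => /eqP. Qed.
Lemma ipZl a u w : ip (a *: u) w = a * ip u w.
Proof. by rewrite -[a *: u]addr0 ipDZl ip0l addr0. Qed.
Lemma ipNl u w : ip (- u) w = - ip u w.
Proof. by rewrite -scaleN1r ipZl mulN1r. Qed.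
Lemma ipBl u v w : ip (u - v) w = ip u w - ip v w.
Proof. by rewrite ipDl ipNl. Qed.
Lemma ipDr u v w : ip w (u + v) = ip w u + ip w v.
Proof. by rewrite ipC ipDl !(ipC w). Qed.
Lemma ip0r w : ip w 0 = 0. Proof. by rewrite ipC ip0l. Qed.
Lemma ipZr a u w : ip w (a *: u) = a * ip w u.
Proof. by rewrite ipC ipZl (ipC w). Qed.
Lemma ipNr u w : ip w (- u) = - ip w u.
Proof. by rewrite ipC ipNl (ipC w). Qed.
Lemma ipBr u v w : ip w (u - v) = ip w u - ip w v.
Proof. by rewrite ipDr ipNr. Qed.
Lemma ip_suml (I : Type) (r : seq I) (P : pred I) (F : I -> V) w :
  ip (\sum_(i <- r | P i) F i) w = \sum_(i <- r | P i) ip (F i) w.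
Proof.
elim: r => [|i r IH]; first by rewrite !big_nil ip0l.
by rewrite !big_cons; case: (P i) => //; rewrite ipDl IH.
Qed.
Lemma ip_sumr (I : Type) (r : seq I) (P : pred I) (F : I -> V) w :
  ip w (\sum_(i <- r | P i) F i) = \sum_(i <- r | P i) ip w (F i).
Proof. by rewrite ipC ip_suml; apply: eq_bigr => i _; rewrite ipC. Qed.

Lemma sqr_normD u v : `|u + v| ^+ 2 = `|u| ^+ 2 + 2 * ip u v + `|v| ^+ 2.
Proof. by rewrite -!ipE ipDl !ipDr (ipC v u); ring. Qed.
Lemma sqr_normB u v : `|u - v| ^+ 2 = `|u| ^+ 2 - 2 * ip u v + `|v| ^+ 2.
Proof. by rewrite sqr_normD ipNr normrN; ring. Qed.
Lemma pythagoras u v : ip u v = 0 -> `|u + v| ^+ 2 = `|u| ^+ 2 + `|v| ^+ 2.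
Proof. by move=> uv; rewrite sqr_normD uv mulr0 addr0. Qed.

Lemma ip_le u v : `|ip u v| <= `|u| * `|v|.
Proof.
have [->|v0] := eqVneq v 0; first by rewrite ip0r !normr0 mulr0.
have nv : 0 < `|v| ^+ 2 by rewrite exprn_gt0 // normr_gt0.
rewrite -ler_sqr ?nnegrE // ?mulr_ge0 // real_normK ?num_real // exprMn.
have : 0 <= `|u - (ip u v / `|v| ^+ 2) *: v| ^+ 2 by rewrite sqr_ge0.
rewrite sqr_normB normrZ ipZr exprMn real_normK ?num_real //.
have -> : `|u| ^+ 2 - 2 * (ip u v / `|v| ^+ 2 * ip u v) + (ip u v / `|v| ^+ 2) ^+ 2 * `|v| ^+ 2
  = (`|u| ^+ 2 * `|v| ^+ 2 - ip u v ^+ 2) / `|v| ^+ 2 by field; rewrite normr_eq0.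
by rewrite pmulr_lge0 ?invr_gt0 // subr_ge0.
Qed.

Lemma ip_le_sqr (u v : V) (k : R) : 0 < k -> 2 * ip u v <= k * `|u| ^+ 2 + `|v| ^+ 2 / k.
Proof.
move=> k0; have : 0 <= `|k *: u - v| ^+ 2 by rewrite sqr_ge0.
rewrite sqr_normB normrZ ipZl exprMn real_normK ?num_real // => H.
rewrite -(ler_pM2l k0) mulrDr [k * (_ / k)]mulrC divfK ?gt_eqF //.
by nra.
Qed.

Lemma ip_cvgl {T : Type} {F : set_system T} {FF : Filter F} (f : T -> V) (l w : V) :
  f @ F --> l -> (fun t => ip (f t) w) @ F --> ip l w.
Proof.
move=> fl; apply/cvgrPdist_le => eps eps0.
have w0 : 0 < `|w| + 1 by rewrite ltr_wpDl.
move/cvgrPdist_le : fl => /(_ (eps / (`|w| + 1)) (divr_gt0 eps0 w0)).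
apply: filterS => t ft.
rewrite -ipBl (le_trans (ip_le _ _)) //.
have := ler_pM (normr_ge0 _) (normr_ge0 _) ft (_ : `|w| <= `|w| + 1).
by rewrite divfK ?gt_eqF //; apply; rewrite lerDl.
Qed.

Lemma sqr_norm_sum_orthonormal (f : nat -> V) (a : nat -> R) m n :
  (forall i j, ip (f i) (f j) = (i == j)%:R) ->
  `|\sum_(m <= k < n) a k *: f k| ^+ 2 = \sum_(m <= k < n) a k ^+ 2.
Proof.
move=> fP; rewrite -ipE ip_suml big_seq [RHS]big_seq.
apply: eq_bigr => i im; rewrite ip_sumr (bigD1_seq i) //= ?iota_uniq //.
rewrite ipZl ipZr fP eqxx mulr1 big1 ?addr0 ?expr2 // => j ji.
by rewrite ipZl ipZr fP eq_sym (negbTE ji) !mulr0.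
Qed.

Lemma ip_sum_orthonormal (f : nat -> V) (a : nat -> R) n j :
  (forall i j, ip (f i) (f j) = (i == j)%:R) ->
  ip (\sum_(0 <= k < n) a k *: f k) (f j) = a j *+ (j < n)%N.
Proof.
move=> fP; rewrite ip_suml; have [jn|nj] := ltnP j n.
  rewrite (bigD1_seq j) //= ?iota_uniq ?mem_index_iota ?jn //.
  rewrite ipZl fP eqxx mulr1 big1 ?addr0 // => k kj.
  by rewrite ipZl fP (negbTE kj) mulr0.
rewrite big_seq big1 // => k; rewrite mem_index_iota => /andP[_ kn].
by rewrite ipZl fP ltn_eqF ?mulr0 // (leq_trans kn).
Qed.

Lemma bessel (f : nat -> V) u n : (forall i j, ip (f i) (f j) = (i == j)%:R) ->
  \sum_(0 <= k < n) ip u (f k) ^+ 2 <= `|u| ^+ 2.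
Proof.
move=> fP; set s := \sum_(0 <= k < n) ip u (f k) *: f k.
have us : ip u s = \sum_(0 <= k < n) ip u (f k) ^+ 2.
  by rewrite ip_sumr; apply: eq_bigr => k _; rewrite ipZr expr2.
have : 0 <= `|u - s| ^+ 2 by rewrite sqr_ge0.
rewrite sqr_normB us sqr_norm_sum_orthonormal // -/s.
set S := \sum_(0 <= k < n) _; lra.
Qed.

(** Partial sums of the vector series are Cauchy because those of the squares are. The last
    conclusion places [v] in the closed span of [f]: the family need not be complete, so the
    coefficients alone do not determine [v]. *)
Lemma riesz_fischer (f : nat -> V) (a : nat -> R) M :
  (forall i j, ip (f i) (f j) = (i == j)%:R) ->
  (forall n, \sum_(0 <= k < n) a k ^+ 2 <= M) ->
  exists v : V, [/\ series (fun k => a k *: f k) @ \oo --> v,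
    forall k, ip v (f k) = a k, `|v| ^+ 2 <= M &
    forall w, (forall k, ip w (f k) = 0) -> ip v w = 0].
Proof.
move=> fP aM.
have cva : cvg (series (fun k => a k ^+ 2) @ \oo).
  apply: nondecreasing_is_cvgn.
    apply: nondecreasing_series => n _ _; exact: sqr_ge0.
  by exists M => _ [n _ <-]; apply: aM.
have cvf : cvg (series (fun k => a k *: f k) @ \oo).
  apply/cauchy_cvgP/cauchy_seriesP => eps eps0.
  move/cauchy_cvgP/cauchy_seriesP : cva => /(_ (eps ^+ 2) (exprn_gt0 _ eps0)).
  apply: filterS => -[m n] /=; rewrite ger0_norm; last by apply: sumr_ge0 => *; apply: sqr_ge0.
  by rewrite -(sqr_norm_sum_orthonormal _ _ _ fP) ltr_sqr ?nnegrE ?(ltW eps0).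
pose v := lim (series (fun k => a k *: f k) @ \oo).
have vl : series (fun k => a k *: f k) @ \oo --> v := cvf.
exists v; split => //.
- move=> k; have h := cvg_lim (@Rhausdorff R) (ip_cvgl (w:=f k) vl).
  rewrite -h; apply: lim_near_cst => //; exists k.+1 => // n /= kn.
  by rewrite /series /= ip_sum_orthonormal // kn.
- have M0 : 0 <= M by have := aM 0%N; rewrite big_geq.
  have nl : (fun n => `|series (fun k => a k *: f k) n|) @ \oo --> `|v| by apply: cvg_norm.
  rewrite -(sqr_sqrtr M0) ler_sqr ?nnegrE ?sqrtr_ge0 //.
  rewrite -(cvg_lim _ nl) //; apply: limr_le; first exact: cvgP nl.
  apply: nearW => n; rewrite -ler_sqr ?nnegrE ?sqrtr_ge0 // sqr_sqrtr //.
  by rewrite /series /= sqr_norm_sum_orthonormal.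
- move=> w wf; have h := cvg_lim (@Rhausdorff R) (ip_cvgl (w:=w) vl).
  rewrite -h; apply: lim_near_cst => //; apply: nearW => n.
  rewrite /series /= ip_suml big1 // => k _; by rewrite ipZl ipC wf mulr0.
Qed.

Section Basis.
Context (e : nat -> V).
Hypothesis eP : orthonormal_basis ip e.

Lemma basis_ortho i j : ip (e i) (e j) = (i == j)%:R. Proof. exact: eP.1. Qed.

Lemma coord_inj u v : (forall n, ip u (e n) = ip v (e n)) -> u = v.
Proof.
move=> uv; apply/eqP; rewrite -subr_eq0; apply/eqP; apply: eP.2 => n.
by rewrite ipBl uv subrr.
Qed.

Lemma expansion u : series (fun k => ip u (e k) *: e k) @ \oo --> u.
Proof.
have [v [vl vc _ _]] := riesz_fischer basis_ortho (fun n => bessel u n basis_ortho).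
by rewrite (coord_inj vc) in vl.
Qed.

Lemma norm_le_coords u M : (forall n, \sum_(0 <= k < n) ip u (e k) ^+ 2 <= M) -> `|u| ^+ 2 <= M.
Proof.
move=> uM; have [v [_ vc vM _]] := riesz_fischer basis_ortho uM.
by rewrite (coord_inj (fun n => esym (vc n))).
Qed.

Lemma coords_exist (a : nat -> R) M : (forall n, \sum_(0 <= k < n) a k ^+ 2 <= M) ->
  exists v : V, (forall k, ip v (e k) = a k) /\ `|v| ^+ 2 <= M.
Proof. by move=> /(riesz_fischer basis_ortho)[v [_ ? ? _]]; exists v. Qed.

(* The squared tail is the part of [u] left by the partial sums. *)
Lemma tail_le u eps : 0 < eps -> exists N, forall n,
  \sum_(N <= k < n) ip u (e k) ^+ 2 <= eps.
Proof.
move=> eps0; have := @expansion u => /cvgP /cauchy_cvgP /cauchy_seriesP.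
move=> /(_ (Num.sqrt eps)); rewrite sqrtr_gt0 => /(_ eps0)[[A B] [[N _ NA] [N' _ NB]] AB].
exists (maxn N N') => n.
have [nN|Nn] := leqP n (maxn N N'); first by rewrite big_geq // ltW.
have /= := AB (maxn N N', n) (conj (NA _ (leq_maxl _ _)) (NB _ (leq_trans (leq_maxr _ _) (ltnW Nn)))).
move=> H; rewrite -(sqr_norm_sum_orthonormal (fun k => ip u (e k)) _ _ basis_ortho).
by rewrite -(sqr_sqrtr (ltW eps0)) ler_sqr ?nnegrE ?sqrtr_ge0 // ltW.
Qed.

End Basis.
End InnerProduct.

(** * Energy estimates on Fourier modes *)

Section ModeEstimates.
Context {R : realType} (lam : nat -> R).
Hypothesis lam0 : 0 < lam 0.
Hypothesis lam_mono : forall n, lam n <= lam n.+1.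

Lemma lam_le m n : (m <= n)%N -> lam m <= lam n.
Proof. by move=> mn; apply: (homo_leq lexx le_trans lam_mono). Qed.

Lemma lam_gt0 n : 0 < lam n.
Proof. exact: lt_le_trans (lam_le (leq0n n)). Qed.

Lemma young (l y g : R) : 0 < l -> 2 * y * g <= l * y ^+ 2 + g ^+ 2 / l.
Proof.
move=> l0; have : 0 <= (l * y - g) ^+ 2 / l by rewrite divr_ge0 ?sqr_ge0 ?ltW.
rewrite (_ : _ / l = l * y ^+ 2 - 2 * y * g + g ^+ 2 / l); last by field; rewrite gt_eqF.
by lra.
Qed.

Lemma cvg_sum_sqr (y : nat -> R -> R) m n (a : R) :
  (forall k, y k x @[x --> a^'+] --> y k a) ->
  \sum_(m <= k < n) y k x ^+ 2 @[x --> a^'+] --> \sum_(m <= k < n) y k a ^+ 2.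
Proof.
move=> ya; elim: (index_iota m n) => [|i s IH].
  under eq_fun do rewrite big_nil.
  by rewrite big_nil; apply: cvg_cst.
under eq_fun do rewrite big_cons.
rewrite big_cons; apply: cvgD => //; under eq_fun do rewrite expr2.
by rewrite expr2; apply: cvgM.
Qed.

Section Solution.
Context (y g : nat -> R -> R) (a b : R).
Hypothesis ab : a <= b.
Hypothesis ya : forall k, y k x @[x --> a^'+] --> y k a.
Hypothesis dy : forall k t, a < t <= b -> deriv_at (y k) t (- (lam k * y k t) + g k t).

Lemma deriv_sum_sqr m n t : a < t <= b ->
  deriv_at (fun s => \sum_(m <= k < n) y k s ^+ 2) t
    (\sum_(m <= k < n) (2 * y k t * (- (lam k * y k t) + g k t))).
Proof.
move=> tab; have D k := deriv_at_exp 2 (dy k tab).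
have := deriv_at_sum (index_iota m n) (fun _ => true) D; rewrite /=.
by under [X in deriv_at _ _ X]eq_bigr do rewrite expr1.
Qed.

(** Young's inequality with weight [lam m] pays for the forcing with half of the dissipation, and
    Gronwall applies to the energy minus its equilibrium value [B2 / lam m ^+ 2]. Large [m] gives
    tails that are small uniformly in time. *)
Lemma mode_energy m n B2 : 0 <= B2 ->
  (forall t, a < t <= b -> \sum_(m <= k < n) g k t ^+ 2 <= B2) ->
  \sum_(m <= k < n) y k b ^+ 2 <=
  \sum_(m <= k < n) y k a ^+ 2 * expR (- (lam m * (b - a))) + B2 / lam m ^+ 2.
Proof.
move=> B20 gB.
pose h t := \sum_(m <= k < n) y k t ^+ 2 - B2 / lam m ^+ 2.
have l0 := lam_gt0 m.
have : h b <= h a * expR (- lam m * (b - a)).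
  apply: (@gronwall _ h (fun t => \sum_(m <= k < n) (2 * y k t * (- (lam k * y k t) + g k t)))) => //.
  - by apply: cvgB; [exact: cvg_sum_sqr|exact: cvg_cst].
  - move=> t tab; apply: deriv_at_eq.
      exact: (deriv_at_add (deriv_sum_sqr m n tab) (deriv_at_cst _ _)).
    by rewrite addr0.
  - move=> t tab; apply: (@le_trans _ _ (\sum_(m <= k < n) (- lam m * y k t ^+ 2 + g k t ^+ 2 / lam m))).
      rewrite big_nat_cond [leRHS]big_nat_cond; apply: ler_sum => k; rewrite andbT => /andP[mk _].
      have := young (y k t) (g k t) l0; have := lam_le mk; have := sqr_ge0 (y k t).
      by nra.
    rewrite big_split /= -mulr_sumr -mulr_suml.
    have -> : - lam m * h t = - lam m * \sum_(m <= k < n) y k t ^+ 2 + B2 / lam m.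
      by rewrite /h; field; rewrite gt_eqF.
    by rewrite lerD2l ler_pM2r ?invr_gt0 // gB.
rewrite /h -mulr_suml mulNr => H.
have /andP[e0 e1] : 0 <= expR (- (lam m * (b - a))) <= 1.
  by rewrite expR_ge0 expR_le1 oppr_le0 mulr_ge0 ?subr_ge0 // ltW.
have q0 : 0 <= B2 / lam m ^+ 2 by rewrite divr_ge0 // exprn_ge0 // ltW.
by nra.
Qed.

(** In the norm weighted by [expR (2 * c * t)], solving the linear problem gains a factor [c ^- 2].
    With [c] twice the Lipschitz constant, Picard iteration contracts on the whole half-line at
    once. *)
Lemma mode_weighted n K c : 0 < c -> 0 <= K -> (forall k, y k a = 0) ->
  (forall t, a < t <= b -> \sum_(0 <= k < n) g k t ^+ 2 <= K * expR (2 * c * t)) ->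
  \sum_(0 <= k < n) y k b ^+ 2 <= K / c ^+ 2 * expR (2 * c * b).
Proof.
move=> c0 K0 y0 gK.
pose q t := K / c ^+ 2 * expR (2 * c * t).
pose h t := \sum_(0 <= k < n) y k t ^+ 2 - q t.
have dq (t : R) : deriv_at q t (2 * K / c * expR (2 * c * t)).
  by apply: deriv_at_eq; [rewrite /q; dauto|cbv beta; field; rewrite gt_eqF].
have : h b <= h a * expR (c * (b - a)).
  apply: (@gronwall _ h (fun t => \sum_(0 <= k < n) (2 * y k t * (- (lam k * y k t) + g k t))
      - 2 * K / c * expR (2 * c * t))) => //.
  - apply: cvgB; first exact: cvg_sum_sqr.
    exact: (cvg_right_of_derive (dq a)).
  - move=> t tab; exact: (deriv_at_add (deriv_sum_sqr 0 n tab) (deriv_at_opp (dq t))).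
  - move=> t tab; rewrite lerBlDr.
    apply: (@le_trans _ _ (\sum_(0 <= k < n) (c * y k t ^+ 2 + g k t ^+ 2 / c))).
      apply: ler_sum => k _.
      have := young (y k t) (g k t) c0; have := lam_gt0 k; have := sqr_ge0 (y k t).
      by nra.
    rewrite big_split /= -mulr_sumr -mulr_suml.
    have -> : c * h t + 2 * K / c * expR (2 * c * t) =
       c * \sum_(0 <= k < n) y k t ^+ 2 + K * expR (2 * c * t) / c.
      by rewrite /h /q; field; rewrite gt_eqF.
    by rewrite lerD2l ler_pM2r ?invr_gt0 // gK.
rewrite {2}/h big1 => [|k _]; last by rewrite y0 expr0n.
rewrite sub0r mulNr => H; rewrite -subr_le0; apply: le_trans H _.
by rewrite oppr_le0 mulr_ge0 ?expR_ge0 // /q mulr_ge0 ?expR_ge0 // divr_ge0 // exprn_ge0 // ltW.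
Qed.

(* Smoothing: the derivative of [(t - a) * sum lam y^2 + sum y^2] does not involve [sum lam y^2]. *)
Lemma mode_smoothing n K2 B2 : a < b ->
  (forall t, a <= t <= b -> \sum_(0 <= k < n) y k t ^+ 2 <= K2) ->
  (forall t, a < t <= b -> \sum_(0 <= k < n) g k t ^+ 2 <= B2) ->
  \sum_(0 <= k < n) lam k * y k b ^+ 2 <= K2 / (b - a) + (b - a) * B2 + K2 + B2.
Proof.
move=> ab' yK gB.
have ba : 0 < b - a by rewrite subr_gt0.
pose X t := \sum_(0 <= k < n) lam k * y k t ^+ 2.
pose Y t := \sum_(0 <= k < n) y k t ^+ 2.
pose D := (b - a) * B2 + K2 + B2.
pose h t := (t - a) * X t + Y t - D * t.
have B20 : 0 <= B2.
  by apply: le_trans (gB b _); [apply: sumr_ge0 => *; apply: sqr_ge0|rewrite ab' lexx].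
have Xa : X x @[x --> a^'+] --> X a.
  rewrite /X; elim: (index_iota 0 n) => [|i s IH].
    under eq_fun do rewrite big_nil.
    by rewrite big_nil; apply: cvg_cst.
  under eq_fun do rewrite big_cons.
  rewrite big_cons; apply: cvgD => //; apply: cvgM; first exact: cvg_cst.
  under eq_fun do rewrite expr2.
  by rewrite expr2; apply: cvgM.
pose X' t := \sum_(0 <= k < n) (lam k * (2 * y k t * (- (lam k * y k t) + g k t))).
pose Y' t := \sum_(0 <= k < n) (2 * y k t * (- (lam k * y k t) + g k t)).
have dX t : a < t <= b -> deriv_at X t (X' t).
  move=> tab; have dk k : deriv_at (fun s => lam k * y k s ^+ 2) t (lam k * (2 * y k t * (- (lam k * y k t) + g k t))).
    apply: deriv_at_eq; first exact: (deriv_at_mul (deriv_at_cst _ _) (deriv_at_exp 2 (dy k tab))).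
    by rewrite mul0r add0r /= expr1.
  exact: (deriv_at_sum _ _ dk).
have dY t : a < t <= b -> deriv_at Y t (Y' t) by move=> tab; exact: deriv_sum_sqr.
have tma t : deriv_at (fun s : R => s - a) t 1.
  by apply: deriv_at_eq; [dauto|rewrite addr0].
have dD (t : R) : deriv_at (fun s => D * s) t D.
  by apply: deriv_at_eq; [dauto|cbv beta; ring].
have : h b <= h a.
  apply: (@derive_le _ h (fun t => 1 * X t + (t - a) * X' t + Y' t - D)) => //.
  - apply: cvgB; last exact: (cvg_right_of_derive (dD a)).
    apply: cvgD; last exact: cvg_sum_sqr.
    by apply: cvgM => //; exact: (cvg_right_of_derive (tma a)).
  - move=> t tab.
    exact: (deriv_at_add (deriv_at_add (deriv_at_mul (tma t) (dX t tab)) (dY t tab)) (deriv_at_opp (dD t))).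
  - move=> t tab; have /andP[at_ tb] := tab.
    have hX' : X' t <= B2.
      apply: le_trans (gB t tab); apply: ler_sum => k _.
      have := sqr_ge0 (lam k * y k t - g k t); have := sqr_ge0 (lam k * y k t); nra.
    have hY' : X t + Y' t <= K2 + B2.
      apply: (@le_trans _ _ (\sum_(0 <= k < n) (y k t ^+ 2 + g k t ^+ 2))).
        rewrite /X /Y' -big_split /=; apply: ler_sum => k _.
        have := sqr_ge0 (y k t - g k t); have := sqr_ge0 (y k t); have := lam_gt0 k; nra.
      rewrite big_split /= lerD ?gB //; apply: yK; by rewrite tb ltW.
    have : (t - a) * X' t <= (b - a) * B2.
      by apply: le_trans (_ : (t - a) * B2 <= _); [rewrite ler_wpM2l // subr_ge0 ltW|rewrite ler_wpM2r // lerD2r].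
    rewrite /D; lra.
rewrite /h subrr mul0r add0r => H.
have Y1 : Y a <= K2 by apply: yK; rewrite lexx.
have Y0 : 0 <= Y b by apply: sumr_ge0 => *; apply: sqr_ge0.
rewrite -/(X b) -(ler_pM2l ba).
have -> : (b - a) * (K2 / (b - a) + (b - a) * B2 + K2 + B2) = K2 + (b - a) * D.
  by rewrite /D; field; rewrite gt_eqF.
lra.
Qed.

End Solution.

(* Comparing a solution with its time dilation [t |-> y (mu t)]: the unbounded
   term [(mu - 1) lam y (mu t)] is absorbed by the dissipation of [(mu - 1)^2 |y (mu t)|^2]. *)
Lemma mode_dilation (y g : nat -> R -> R) n T mu K M2 B2 kappa :
  0 < T -> 1 / 2 <= mu <= 2 -> 0 < K -> 0 <= B2 -> 0 <= M2 -> 0 <= kappa ->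
  (forall k, y k x @[x --> 0^'+] --> y k 0) ->
  (forall k t, 0 < t -> deriv_at (y k) t (- (lam k * y k t) + g k t)) ->
  (forall t, 0 < t -> \sum_(0 <= k < n) g k t ^+ 2 <= B2) ->
  \sum_(0 <= k < n) y k 0 ^+ 2 <= M2 ->
  (forall t, 0 < t <= T -> \sum_(0 <= k < n) (g k (mu * t) - g k t) ^+ 2 <=
     kappa * K * expR (2 * (1 + K) * t)) ->
  \sum_(0 <= k < n) (y k (mu * T) - y k T) ^+ 2 <=
    (kappa / 2 + (mu - 1) ^+ 2 * (M2 + (1 + 2 / lam 0) * B2 / (2 * K))) * expR (2 * (1 + K) * T).
Proof.
move=> T0 /andP[mu1 mu2] K0 B20 M20 kappa0 y0 dy gB yM gK.
set D := M2 + _; set alpha := kappa / 2 + _; set c := 1 + K.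
have mu0 : 0 < mu by lra.
have D0 : 0 <= (1 + 2 / lam 0) * B2 / (2 * K).
  by rewrite divr_ge0 ?mulr_ge0 ?addr_ge0 ?divr_ge0 // ?ltW.
have alpha0 : 0 <= alpha.
  by rewrite /alpha addr_ge0 ?divr_ge0 // mulr_ge0 ?sqr_ge0 // /D addr_ge0.
pose E k t := y k (mu * t) - y k t.
pose Y t := \sum_(0 <= k < n) E k t ^+ 2.
pose U k t := y k (mu * t).
pose N t := \sum_(0 <= k < n) U k t ^+ 2.
pose q t := alpha * expR (2 * c * t).
pose h t := Y t + (mu - 1) ^+ 2 * N t - q t.
pose U' k t := (- (lam k * U k t) + g k (mu * t)) * mu.
pose E' k t := U' k t - (- (lam k * y k t) + g k t).
have dU k t : 0 < t -> deriv_at (U k) t (U' k t).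
  move=> t0; have dmu : deriv_at (fun s : R => mu * s) t mu.
    by apply: deriv_at_eq; [dauto|cbv beta; ring].
  by apply: (deriv_at_comp dmu); apply: dy; rewrite mulr_gt0.
have dE k t : 0 < t -> deriv_at (E k) t (E' k t).
  by move=> t0; apply: deriv_at_add; [exact: dU|apply: deriv_at_opp; exact: dy].
have U0 k : U k x @[x --> 0^'+] --> U k 0.
  rewrite /U mulr0.
  have mx : (fun x : R => mu * x) @ 0^'+ --> (0:R)^'+.
    move=> A /= [eps /= eps0 epsA]; exists (eps / mu); first by rewrite /= divr_gt0.
    move=> x /=; rewrite sub0r normrN => xe x0; apply: epsA; last by rewrite mulr_gt0.
    by rewrite /= sub0r normrN normrM (gtr0_norm mu0) mulrC -ltr_pdivlMr.
  exact: (cvg_comp _ _ mx (y0 k)).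
have E0 k : E k x @[x --> 0^'+] --> E k 0.
  by apply: cvgB => //; exact: U0.
pose h' t := \sum_(0 <= k < n) (2 * E k t * E' k t) +
   (mu - 1) ^+ 2 * \sum_(0 <= k < n) (2 * U k t * U' k t) - alpha * (2 * c * expR (2 * c * t)).
have dq (t : R) : deriv_at q t (alpha * (2 * c * expR (2 * c * t))).
  by apply: deriv_at_eq; [rewrite /q; dauto|cbv beta; ring].
have dsq (f : nat -> R -> R) f' t : (forall k, deriv_at (f k) t (f' k)) ->
    deriv_at (fun s => \sum_(0 <= k < n) f k s ^+ 2) t (\sum_(0 <= k < n) (2 * f k t * f' k)).
  move=> df; have := deriv_at_sum (index_iota 0 n) (fun _ => true) (fun k => deriv_at_exp 2 (df k)).
  by rewrite /=; under [X in deriv_at _ _ X]eq_bigr do rewrite expr1.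
have : h T <= h 0 * expR (2 * (T - 0)).
  apply: (@gronwall _ h h') => //; first exact: ltW.
  - apply: cvgB; last exact: (cvg_right_of_derive (dq 0)).
    apply: cvgD; first exact: cvg_sum_sqr.
    by apply: cvgM; [exact: cvg_cst|exact: cvg_sum_sqr].
  - move=> t /andP[t0 _]; apply: deriv_at_eq.
      exact: (deriv_at_add (deriv_at_add (dsq E (E'^~ t) t (fun k => dE k t t0))
        (deriv_at_mul (deriv_at_cst ((mu - 1) ^+ 2) t) (dsq U (U'^~ t) t (fun k => dU k t t0)))) (deriv_at_opp (dq t))).
    by rewrite mul0r add0r.
  - move=> t tT; have /andP[t0 _] := tT.
    have term k : 2 * E k t * E' k t + (mu - 1) ^+ 2 * (2 * U k t * U' k t) <=
        2 * E k t ^+ 2 + (mu - 1) ^+ 2 * (1 + 2 / lam 0) * g k (mu * t) ^+ 2 +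
        (g k (mu * t) - g k t) ^+ 2.
      have lk0 := lam_gt0 k; set l := lam k in lk0 *.
      have il : g k (mu * t) ^+ 2 / l <= g k (mu * t) ^+ 2 / lam 0.
        by rewrite ler_wpM2l ?sqr_ge0 // lef_pV2 // ?posrE // lam_le.
      have y1 := young (U k t) (g k (mu * t)) lk0.
      have t1 : 2 * U k t * U' k t <= - (1 / 2) * l * U k t ^+ 2 + 2 * (g k (mu * t) ^+ 2 / lam 0).
        rewrite /U' -/l.
        have : mu * (2 * U k t * g k (mu * t)) <= mu * (l * U k t ^+ 2 + g k (mu * t) ^+ 2 / lam 0).
          by rewrite ler_pM2l //; lra.
        have : 1 / 2 * (l * U k t ^+ 2) <= mu * (l * U k t ^+ 2).
          by rewrite ler_wpM2r // mulr_ge0 ?sqr_ge0 // ltW.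
        have : mu * (g k (mu * t) ^+ 2 / lam 0) <= 2 * (g k (mu * t) ^+ 2 / lam 0).
          by rewrite ler_wpM2r // divr_ge0 ?sqr_ge0 // ltW.
        lra.
      have t2 : 2 * E k t * E' k t <= 2 * E k t ^+ 2 + 1 / 2 * (mu - 1) ^+ 2 * (l * U k t ^+ 2)
          + (mu - 1) ^+ 2 * g k (mu * t) ^+ 2 + (g k (mu * t) - g k t) ^+ 2.
        have -> : E' k t = - (l * E k t) - (mu - 1) * (l * U k t)
            + (mu - 1) * g k (mu * t) + (g k (mu * t) - g k t).
          by rewrite /E' /U' /E /U -/l; ring.
        have : 0 <= l * (2 * E k t + (mu - 1) * U k t) ^+ 2 by rewrite mulr_ge0 ?sqr_ge0 // ltW.
        have := sqr_ge0 (E k t - (mu - 1) * g k (mu * t)).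
        have := sqr_ge0 (E k t - (g k (mu * t) - g k t)).
        lra.
      have : (mu - 1) ^+ 2 * (2 * U k t * U' k t) <= (mu - 1) ^+ 2 *
         (- (1 / 2) * l * U k t ^+ 2 + 2 * (g k (mu * t) ^+ 2 / lam 0)).
        by rewrite ler_wpM2l ?sqr_ge0.
      lra.
    have : \sum_(0 <= k < n) (2 * E k t * E' k t) + (mu - 1) ^+ 2 * \sum_(0 <= k < n) (2 * U k t * U' k t) <=
        2 * Y t + (mu - 1) ^+ 2 * (1 + 2 / lam 0) * B2 + kappa * K * expR (2 * c * t).
      rewrite mulr_sumr -big_split /=.
      apply: le_trans (ler_sum _ (fun k _ => term k)) _.
      rewrite !big_split /= -!mulr_sumr; apply: lerD; last exact: gK.
      rewrite lerD2l ler_wpM2l //; last by apply: gB; rewrite mulr_gt0.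
      by rewrite mulr_ge0 ?sqr_ge0 // addr_ge0 // divr_ge0 // ltW.
    rewrite /h' /h /q.
    have e1 : 1 <= expR (2 * c * t).
      by rewrite -expR0 ler_expR !mulr_ge0 // ?addr_ge0 // ltW.
    have N0 : 0 <= (mu - 1) ^+ 2 * N t.
      by rewrite mulr_ge0 ?sqr_ge0 // sumr_ge0 // => *; rewrite sqr_ge0.
    have : kappa * K + (mu - 1) ^+ 2 * (1 + 2 / lam 0) * B2 <= 2 * K * alpha.
      rewrite -subr_ge0 (_ : _ - _ = 2 * K * (mu - 1) ^+ 2 * M2); first by rewrite mulr_ge0 // mulr_ge0 ?sqr_ge0 // mulr_ge0 // ltW.
      by rewrite /alpha /D; field; rewrite !gt_eqF.
    have : (mu - 1) ^+ 2 * (1 + 2 / lam 0) * B2 <= (mu - 1) ^+ 2 * (1 + 2 / lam 0) * B2 * expR (2 * c * t).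
      by rewrite ler_peMr // mulr_ge0 // mulr_ge0 ?sqr_ge0 // addr_ge0 // divr_ge0 // ltW.
    rewrite /c; move: (expR _) e1 => X X1 h1 h2 h3.
    have : (kappa * K + (mu - 1) ^+ 2 * (1 + 2 / lam 0) * B2) * X <= 2 * K * alpha * X.
      by rewrite ler_wpM2r // (le_trans _ X1).
    lra.
rewrite subr0 => H.
have h0 : h 0 <= 0.
  rewrite /h /Y /N /q /E /U mulr0 mulr0 expR0 mulr1 big1 => [|k _]; last by rewrite subrr expr0n.
  rewrite add0r subr_le0 /alpha /D mulrDr addrA.
  apply: (@le_trans _ _ ((mu - 1) ^+ 2 * M2)); first by rewrite ler_wpM2l ?sqr_ge0.
  by rewrite addrAC lerDr addr_ge0 ?divr_ge0 // mulr_ge0 ?sqr_ge0.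
have hT : h T <= 0 by apply: le_trans H _; rewrite mulr_le0_ge0 ?expR_ge0.
have N0 : 0 <= (mu - 1) ^+ 2 * N T.
  by rewrite mulr_ge0 ?sqr_ge0 // sumr_ge0 // => *; rewrite sqr_ge0.
move: hT; rewrite /h /q /Y /E; lra.
Qed.

End ModeEstimates.

(** * Consequences of the compact inverse *)

Lemma compact_seq_cluster {R : realType} {V : normedModType R} (K : set V) (x : nat -> V) :
  compact K -> (\forall n \near \oo, K (x n)) ->
  exists2 p, K p & forall eps N, 0 < eps -> exists2 n, (N <= n)%N & `|p - x n| < eps.
Proof.
move=> Kc Kx; have [p [Kp cp]] := Kc (x @ \oo) _ Kx.
exists p => // eps N eps0.
have := cp (x @` [set n | (N <= n)%N]) (ball p eps) _ (nbhsx_ballx p _ eps0).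
case; first by exists N => // n Nn; exists n.
by move=> y [[n Nn <-] pn]; exists n => //; move: pn; rewrite -ball_normE.
Qed.

Section Spectral.
Context {R : realType} {V : completeNormedModType R} (ip : V -> V -> R).
Context (A : V -> V) (DA : set V) (lam : nat -> R) (e : nat -> V).
Hypothesis ipP : inner_product ip.
Hypothesis Asa : self_adjoint ip A DA.
Hypothesis Acpt : compact_inverse A DA.
Hypothesis lam0 : 0 < lam 0.
Hypothesis lam_mono : forall n, lam n <= lam n.+1.
Hypothesis eP : orthonormal_basis ip e.
Hypothesis Ae : forall n, DA (e n) /\ A (e n) = lam n *: e n.

Lemma A_coord u n : DA u -> ip (A u) (e n) = lam n * ip u (e n).
Proof.
move=> Du; have [De AeE] := Ae n; have [_ [_ [sym _]]] := Asa.
by rewrite sym // AeE (ipZr ipP).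
Qed.

(** The inverse supplies a preimage of [w] in the domain; as no eigenvalue vanishes, it has the same
    coefficients as [u]. *)
Lemma dom_of_coords u w : (forall n, ip w (e n) = lam n * ip u (e n)) -> DA u /\ A u = w.
Proof.
move=> wu; have [B [_ [_ [AB _]]]] := Acpt; have [DB ABw] := AB w.
suff -> : u = B w by [].
apply: (coord_inj ipP eP) => n; apply: (@mulfI _ (lam n)).
  by rewrite gt_eqF // (lam_gt0 lam0).
by rewrite -wu -A_coord // ABw.
Qed.

(** The source of all compactness below: for the spectrum, and for the absorbing set of the flow. *)
Lemma A_le_compact M : exists K : set V, compact K /\ forall u, DA u -> `|A u| <= M -> K u.
Proof.
have [B [_ [_ [_ [BA Bc]]]]] := Acpt.
exists (closure (B @` [set f | `|f| <= M])); split.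
  by apply: Bc; exists M.
move=> u Du Au; apply: subset_closure; exists (A u) => //; exact: BA.
Qed.

(** If [M] bounded the spectrum, the vectors [(lam n)^-1 *: e n], which [A] maps to unit vectors,
    would lie in a compact set while being at mutual distance at least [M^-1]. *)
Lemma lam_unbounded M : exists n, M < lam n.
Proof.
apply: contrapT => H.
have lM n : lam n <= M by rewrite leNgt; apply/negP => ?; apply: H; exists n.
have lg := lam_gt0 lam0 lam_mono.
have M0 : 0 < M := lt_le_trans lam0 (lM 0).
have [K [Kc KA]] := A_le_compact 1.
pose x n := (lam n)^-1 *: e n.
have e1 n : `|e n| = 1.
  by apply/eqP; rewrite -(@eqrXn2 _ 2) // expr1n -(ipE ipP) (basis_ortho eP) eqxx.
have [_ [Dl [Al _]]] : linear_on A DA /\ linear_on A DA by case: Asa => ?.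
have Kx n : K (x n).
  have [Dx Ax] : DA (x n) /\ A (x n) = e n.
    apply: dom_of_coords => m; rewrite /x (ipZl ipP) (basis_ortho eP).
    by have [->|_] := eqVneq n m; [rewrite mulVKf ?gt_eqF|rewrite !mulr0].
  by apply: KA => //; rewrite Ax e1.
have [p _ pick] := compact_seq_cluster Kc (filterS (fun n _ => Kx n) filterT : \forall n \near \oo, K (x n)).
have r0 : 0 < (2 * M)^-1 by rewrite invr_gt0 mulr_gt0.
have [n _ pn] := pick _ 0%N r0; have [m nm pm] := pick _ n.+1 r0.
have : `|x n - x m| < M^-1.
  rewrite (_ : x n - x m = (p - x m) - (p - x n)); last by rewrite opprB [RHS]addrC subrKA.
  apply: le_lt_trans (ler_normB _ _) _; apply: lt_le_trans (ltrD pm pn) _.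
  rewrite invfM -mulrDl; by rewrite (_ : 2^-1 + 2^-1 = 1) ?mul1r //; field.
apply/negP; rewrite -leNgt -ler_sqr ?nnegrE ?invr_ge0 // ?(ltW M0) //.
rewrite (sqr_normB ipP) /x (ipZl ipP) (ipZr ipP) (basis_ortho eP) ltn_eqF // !mulr0 subr0.
rewrite !normrZ !e1 !mulr1 -[leLHS]addr0 lerD ?sqr_ge0 //.
rewrite ler_sqr ?nnegrE // ?invr_ge0 ?(ltW M0) //.
by rewrite ger0_norm ?invr_ge0 ?(ltW (lg n)) // lef_pV2 ?posrE.
Qed.

Lemma cvg_of_modes {T : Type} {F : set_system T} {FF : Filter F} (f : T -> V) (l : V) :
  (forall n, (fun t => ip (f t) (e n)) @ F --> ip l (e n)) ->
  (forall eps, 0 < eps -> exists N, \forall t \near F, forall n,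
     \sum_(N <= k < n) ip (f t) (e k) ^+ 2 <= eps) ->
  f @ F --> l.
Proof.
move=> fl ft; apply/cvgrPdist_le => eps eps0.
(* One share [d] for the first [N] coefficients; the tail of a difference costs twice each of the
   two tails. *)
pose d := eps ^+ 2 / 5; have d0 : 0 < d by rewrite divr_gt0 // exprn_gt0.
have [N1 FN1] := ft d d0; have [N2 lN2] := tail_le ipP eP l d0.
pose N := maxn N1 N2.
have head : \forall t \near F, \sum_(0 <= k < N) (ip l (e k) - ip (f t) (e k)) ^+ 2 <= d.
  have c1 i : (fun t => (ip l (e i) - ip (f t) (e i)) ^+ 2) @ F --> (0 : R).
    have h : (fun t => ip l (e i) - ip (f t) (e i)) @ F --> ip l (e i) - ip l (e i).
      by apply: cvgB => //; exact: cvg_cst.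
    rewrite subrr in h; have := cvgM h h; rewrite mulr0 => h2; exact: h2.
  have : (fun t => \sum_(0 <= k < N) (ip l (e k) - ip (f t) (e k)) ^+ 2) @ F --> (0 : R).
    elim: (index_iota 0 N) => [|i s IH].
      by apply: cvg_near_cst; apply: nearW => t; rewrite big_nil.
    under eq_fun do rewrite big_cons.
    have := cvgD (c1 i) IH; rewrite addr0 => h; exact: h.
  move/cvgrPdist_le => /(_ d d0); apply: filterS => t.
  by rewrite sub0r normrN; apply: le_trans; exact: ler_norm.
near=> t.
rewrite -ler_sqr ?nnegrE // ?(ltW eps0) //; apply: (norm_le_coords ipP eP) => n.
have tN : forall n, \sum_(N1 <= k < n) ip (f t) (e k) ^+ 2 <= d by near: t.
have tH : \sum_(0 <= k < N) (ip l (e k) - ip (f t) (e k)) ^+ 2 <= d by near: t.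
have mono (a : nat -> R) M M' n' : (M <= M')%N -> (forall k, 0 <= a k) ->
    \sum_(M' <= k < n') a k <= \sum_(M <= k < n') a k.
  move=> MM a0; have [Mn|nM] := leqP M' n'; last by rewrite big_geq ?sumr_ge0 // ltnW.
  by rewrite (big_cat_nat MM Mn) /= lerDr sumr_ge0.
under eq_bigr do rewrite (ipBl ipP).
have [nN|Nn] := leqP n N.
  apply: le_trans (_ : \sum_(0 <= k < N) (ip l (e k) - ip (f t) (e k)) ^+ 2 <= _).
    by rewrite [leRHS](big_cat_nat (leq0n n) nN) /= lerDl sumr_ge0 // => *; rewrite sqr_ge0.
  by apply: le_trans tH _; rewrite /d ler_pdivrMr // ler_peMr ?sqr_ge0 //; lra.
rewrite (big_cat_nat (leq0n N) (ltnW Nn)) /=.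
have : \sum_(N <= k < n) (ip l (e k) - ip (f t) (e k)) ^+ 2 <=
    2 * \sum_(N <= k < n) ip l (e k) ^+ 2 + 2 * \sum_(N <= k < n) ip (f t) (e k) ^+ 2.
  rewrite !mulr_sumr -big_split /=; apply: ler_sum => k _.
  by have := sqr_ge0 (ip l (e k) + ip (f t) (e k)); lra.
have h1 : \sum_(N <= k < n) ip l (e k) ^+ 2 <= d.
  by apply: le_trans (lN2 n); apply: mono; [exact: leq_maxr|move=> k; exact: sqr_ge0].
have h2 : \sum_(N <= k < n) ip (f t) (e k) ^+ 2 <= d.
  by apply: le_trans (tN n); apply: mono; [exact: leq_maxl|move=> k; exact: sqr_ge0].
have : 5 * d = eps ^+ 2 by rewrite /d; field.
by move: tH; lra.
Unshelve. all: by end_near. Qed.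

End Spectral.

(** * Mild solutions and their regularity *)

Section Mild.
Context {R : realType} {V : completeNormedModType R} (ip : V -> V -> R).
Context (lam : nat -> R) (e : nat -> V) (F : V -> V) (L BF : R).
Hypothesis ipP : inner_product ip.
Hypothesis lam0 : 0 < lam 0.
Hypothesis lam_mono : forall n, lam n <= lam n.+1.
Hypothesis lam_unb : forall M, exists n, M < lam n.
Hypothesis eP : orthonormal_basis ip e.
Hypothesis L0 : 0 < L.
Hypothesis FL : forall u v, `|F u - F v| <= L * `|u - v|.
Hypothesis FB : forall u, `|F u| <= BF.

Let BF0 : 0 <= BF := le_trans (normr_ge0 _) (FB 0).

Lemma F_continuous : continuous F.
Proof.
move=> u; apply/cvgrPdist_le => eps eps0.
have : \forall v \near u, `|u - v| <= eps / L.
  by move/cvgrPdist_le: (@cvg_id _ (nbhs u)) => /(_ (eps / L) (divr_gt0 eps0 L0)).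
by apply: filterS => v uv; rewrite (le_trans (FL _ _)) // mulrC -ler_pdivlMr.
Qed.

(** The mild solution with forcing [F (u t)], imposed coefficient by coefficient. Freezing [z] at
    [u0] for negative times makes it continuous on the whole line, so that the Picard map acts on
    continuous functions. A mild solution of the equation itself is the case [z = u]. *)
Definition duhamel (u0 : V) (u z : R -> V) : Prop :=
  [/\ continuous z, forall t : R, t <= 0 -> z t = u0 &
     forall n (t : R), 0 < t -> deriv_at (fun s => ip (z s) (e n)) t
       (- (lam n * ip (z t) (e n)) + ip (F (u t)) (e n))].

Lemma sum_F_le u m n : \sum_(m <= k < n) ip (F u) (e k) ^+ 2 <= BF ^+ 2.
Proof.
apply: (@le_trans _ _ (`|F u| ^+ 2)); last by rewrite ler_sqr ?nnegrE.
apply: le_trans (bessel ipP (F u) n (basis_ortho eP)).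
have [mn|nm] := leqP m n; last by rewrite big_geq ?sumr_ge0 // => *; rewrite ?sqr_ge0 // ltnW.
by rewrite [leRHS](big_cat_nat (leq0n m) mn) /= lerDr sumr_ge0 // => *; rewrite sqr_ge0.
Qed.

Lemma duhamel_cvg0 u0 u z n : duhamel u0 u z ->
  (fun t => ip (z t) (e n)) x @[x --> 0^'+] --> ip (z 0) (e n).
Proof.
case=> cz _ _; apply: cvg_at_right_filter; apply: (ip_cvgl ipP); exact: cz.
Qed.

Lemma duhamel_norm u0 u z (t : R) : duhamel u0 u z -> 0 <= t ->
  `|z t| ^+ 2 <= `|u0| ^+ 2 * expR (- (lam 0 * t)) + BF ^+ 2 / lam 0 ^+ 2.
Proof.
move=> zP t0; apply: (norm_le_coords ipP eP) => n; have [cz z0 dz] := zP.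
have := @mode_energy R lam lam0 lam_mono (fun k s => ip (z s) (e k)) (fun k s => ip (F (u s)) (e k)) 0 t
  t0 (fun k => duhamel_cvg0 (n:=k) zP) _ 0 n (BF ^+ 2) (sqr_ge0 _) _.
move=> H; apply: le_trans (H _ _) _.
- by move=> k s /andP[s0 _]; exact: dz.
- by move=> s _; exact: sum_F_le.
rewrite subr0 lerD2r -mulr_suml ler_wpM2r ?expR_ge0 // z0 //.
by apply: (bessel ipP); exact: (basis_ortho eP).
Qed.

(** Each coefficient is given by variation of constants. The energy estimate sums them to a vector,
    and since [BF ^+ 2 / lam m ^+ 2] tends to 0 the tails are small uniformly in time, whence
    continuity. *)
Lemma duhamel_exists u0 u : continuous u -> exists z, duhamel u0 u z.
Proof.
move=> cu.
have /choice[P PP] : forall n, exists P : R -> R, P 0 = 0 /\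
    forall x, deriv_at P x (expR (lam n * x) * ip (F (u x)) (e n)).
  move=> n; apply: primitive_exists => x; apply: cvgM.
    have dl : deriv_at (fun s : R => expR (lam n * s)) x (expR (lam n * x) * (0 * x + lam n * 1)) by dauto.
    exact: (deriv_at_continuous dl).
  by apply: (ip_cvgl ipP); apply: continuous_comp; [exact: cu|exact: F_continuous].
pose y n (t : R) : R := expR (- (lam n * t)) * (ip u0 (e n) + P n t).
have y0 n : y n 0 = ip u0 (e n) by rewrite /y mulr0 oppr0 expR0 mul1r (PP n).1 addr0.
have dy n t : deriv_at (y n) t (- (lam n * y n t) + ip (F (u t)) (e n)).
  have dP := (PP n).2 t.
  apply: deriv_at_eq; first by rewrite /y; dauto.
  cbv beta; rewrite /y.
  have eE : expR (- (lam n * t)) * expR (lam n * t) = 1 by rewrite -expRD addNr expR0.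
  rewrite [RHS](_ : _ = - (lam n * (expR (- (lam n * t)) * (ip u0 (e n) + P n t))) +
     expR (- (lam n * t)) * expR (lam n * t) * ip (F (u t)) (e n)); first ring.
  by rewrite eE mul1r.
have yc k : y k x @[x --> 0^'+] --> y k 0 by exact: (cvg_right_of_derive (dy k 0)).
have energy t m n : 0 <= t -> \sum_(m <= k < n) y k t ^+ 2 <=
    \sum_(m <= k < n) ip u0 (e k) ^+ 2 + BF ^+ 2 / lam m ^+ 2.
  move=> t0; apply: le_trans (@mode_energy R lam lam0 lam_mono y (fun k s => ip (F (u s)) (e k)) 0 t
    t0 yc _ m n (BF ^+ 2) (sqr_ge0 _) _) _.
  - by move=> k s _; exact: dy.
  - by move=> s _; exact: sum_F_le.
  rewrite lerD2r; apply: ler_sum => k _; rewrite y0 ler_piMr ?sqr_ge0 //.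
  by rewrite expR_le1 oppr_le0 mulr_ge0 ?subr_ge0 // ltW // (lam_gt0 lam0).
have /choice[z zP] : forall t, exists z : V, forall k, ip z (e k) = y k (Num.max 0 t).
  move=> t; have := @coords_exist R V ip ipP e eP (fun k => y k (Num.max 0 t)) (`|u0| ^+ 2 + BF ^+ 2 / lam 0 ^+ 2).
  case=> [n|v [vP _]]; last by exists v.
  apply: le_trans (energy _ _ _ _) _; first by rewrite le_max lexx.
  by rewrite lerD2r; apply: (bessel ipP); exact: (basis_ortho eP).
exists z; split.
- move=> t; apply: (cvg_of_modes ipP eP) => [n|eps eps0].
    under eq_fun do rewrite zP; rewrite zP.
    apply: (@continuous_comp _ _ _ (fun s : R => Num.max 0 s) (y n)).
      by apply: continuous_max; [exact: cvg_cst|exact: cvg_id].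
    exact: deriv_at_continuous (dy n _).
  have e20 : 0 < eps / 2 by rewrite divr_gt0.
  have [N1 hN1] := tail_le ipP eP u0 e20.
  have [N2 hN2] := lam_unb (1 + BF ^+ 2 / (eps / 2)).
  exists (maxn N1 N2); apply: nearW => s n; under eq_bigr do rewrite zP.
  apply: le_trans (energy _ _ _ _) _; first by rewrite le_max lexx.
  rewrite (splitr eps); apply: lerD.
    apply: le_trans (hN1 n).
    have [mn|nm] := leqP (maxn N1 N2) n; last by rewrite big_geq ?sumr_ge0 // => *; rewrite ?sqr_ge0 // ltnW.
    by rewrite [leRHS](big_cat_nat (leq_maxl N1 N2) mn) /= lerDr sumr_ge0 // => *; rewrite sqr_ge0.
  set l := lam _; have hl : 1 + BF ^+ 2 / (eps / 2) < l.
    by apply: lt_le_trans hN2 _; apply: (lam_le lam_mono); exact: leq_maxr.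
  have q0 : 0 <= BF ^+ 2 / (eps / 2) by rewrite divr_ge0 ?sqr_ge0 // ltW.
  have l1 : 1 <= l by lra.
  rewrite ler_pdivrMr ?exprn_gt0 ?(lt_le_trans _ l1) // -ler_pdivrMl // mulrC.
  by apply: (@le_trans _ _ l); [lra|rewrite expr2 ler_peMl // (le_trans _ l1)].
- move=> t t0; apply: (coord_inj ipP eP) => k; rewrite zP max_l // y0 //.
- move=> n t t0.
  have -> : ip (z t) (e n) = y n t by rewrite zP max_r // ltW.
  apply: deriv_at_near (dy n t).
  by apply: filterS (lt_nbhsr t0) => s s0; rewrite zP max_r // ltW.
Qed.

Lemma duhamel_contraction u0 u u' z z' K (t : R) : duhamel u0 u z -> duhamel u0 u' z' ->
  0 <= K -> 0 <= t ->
  (forall s : R, 0 < s -> `|u s - u' s| ^+ 2 <= K * expR (2 * (2 * L) * s)) ->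
  `|z t - z' t| ^+ 2 <= K / 4 * expR (2 * (2 * L) * t).
Proof.
move=> zP zP' K0 t0 uK; apply: (norm_le_coords ipP eP) => n.
have [cz z0 dz] := zP; have [cz' z0' dz'] := zP'.
have := @mode_weighted R lam lam0 lam_mono (fun k s => ip (z s) (e k) - ip (z' s) (e k))
  (fun k s => ip (F (u s)) (e k) - ip (F (u' s)) (e k)) 0 t t0 _ _ n (L ^+ 2 * K) (2 * L).
move=> H; under eq_bigr do rewrite (ipBl ipP).
rewrite (_ : K / 4 = L ^+ 2 * K / (2 * L) ^+ 2); last by field; rewrite gt_eqF.
apply: H.
- by move=> k; apply: cvgB; [exact: (duhamel_cvg0 (n:=k) zP)|exact: (duhamel_cvg0 (n:=k) zP')].
- move=> k s /andP[s0 _]; apply: deriv_at_eq.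
    exact: (deriv_at_add (dz k s s0) (deriv_at_opp (dz' k s s0))).
  by ring.
- by rewrite mulr_gt0.
- by rewrite mulr_ge0 ?sqr_ge0.
- by move=> k; rewrite z0 // z0' // subrr.
- move=> s /andP[s0 _]; under eq_bigr do rewrite -(ipBl ipP).
  apply: le_trans (bessel ipP _ n (basis_ortho eP)) _.
  apply: (@le_trans _ _ ((L * `|u s - u' s|) ^+ 2)); first by rewrite ler_sqr ?nnegrE // mulr_ge0 // ltW.
  by rewrite exprMn -[leRHS]mulrA ler_wpM2l ?sqr_ge0 // uK.
Qed.

Lemma natr_lt_pow2 (n : nat) : n%:R < 2 ^+ n :> R.
Proof. by rewrite -natrX ltr_nat ltn_expl. Qed.

Lemma half_pow_small (c eps : R) : 0 < eps -> exists n : nat, c / 2 ^+ n < eps.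
Proof.
move=> eps0; exists (Num.truncn (`|c| / eps)).+1; set n := (Num.truncn _).+1.
rewrite ltr_pdivrMr ?exprn_gt0 // mulrC -ltr_pdivrMr //.
apply: (@lt_trans _ _ n%:R); last exact: natr_lt_pow2.
apply: le_lt_trans (truncnS_gt _); by rewrite ler_pM2r ?invr_gt0 // ler_norm.
Qed.

Lemma geometric_cvg (x : nat -> V) C : (forall k, `|x k.+1 - x k| <= C / 2 ^+ k) ->
  exists l, forall k, `|l - x k| <= 2 * C / 2 ^+ k.
Proof.
move=> xC.
have C0 : 0 <= C by have := xC 0%N; rewrite expr0 divr1; apply: le_trans.
have p2 k : 0 < 2 ^+ k :> R by rewrite exprn_gt0.
have dist n m : `|x (n + m)%N - x n| <= 2 * C / 2 ^+ n - 2 * C / 2 ^+ (n + m).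
  elim: m => [|m IH]; first by rewrite addn0 !subrr normr0.
  rewrite addnS -(subrKA (x (n + m)%N)); apply: le_trans (ler_normD _ _) _.
  apply: le_trans (lerD (xC _) IH) _; rewrite exprS le_eqVlt; apply/orP; left.
  by apply/eqP; field; rewrite !gt_eqF.
have dist' n m : (n <= m)%N -> `|x m - x n| <= 2 * C / 2 ^+ n.
  move=> /subnKC <-; apply: le_trans (dist _ _) _.
  by rewrite gerBl divr_ge0 ?mulr_ge0 // ltW.
have cx : cvg (x @ \oo).
  apply/cauchy_cvgP/cauchy_exP => eps eps0; have [n hn] := half_pow_small (2 * C) eps0.
  exists (x n); exists n => // m /= nm; rewrite -ball_normE /ball_ /= distrC.
  exact: le_lt_trans (dist' _ _ nm) hn.
exists (lim (x @ \oo)) => k.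
have nl : (fun m => `|x m - x k|) @ \oo --> `|lim (x @ \oo) - x k|.
  by apply: cvg_norm; apply: cvgB; [exact: cx|exact: cvg_cst].
rewrite -(cvg_lim (@Rhausdorff R) nl); apply: limr_le; first exact: cvgP nl.
by exists k => // m /= km; exact: dist'.
Qed.

Theorem mild_exists u0 : exists u, duhamel u0 u u.
Proof.
have /choice[Ps PsP] : forall w : {u : R -> V | continuous u}, exists z : {u : R -> V | continuous u},
    duhamel u0 (sval w) (sval z).
  move=> [u cu]; have [z zP] := duhamel_exists u0 cu; have [cz _ _] := zP.
  by exists (exist _ z cz).
have cst0 : continuous (fun _ : R => u0) by move=> x; exact: cvg_cst.
(* The iteration is read from its first image on: every [u k] is then the outcome of a Picard step
   and obeys the energy bound. *)
pose w k := iter k.+1 Ps (exist _ _ cst0); pose u k : R -> V := sval (w k).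
have uP k : duhamel u0 (u k) (u k.+1) by exact: (PsP (w k)).
have uP' k : exists v, duhamel u0 v (u k) by case: k => [|k]; [exists (fun=> u0); exact: (PsP (exist _ _ cst0))|exists (u k)].
pose M := `|u0| ^+ 2 + BF ^+ 2 / lam 0 ^+ 2.
have M0 : 0 <= M by rewrite addr_ge0 ?divr_ge0 ?sqr_ge0.
have uM k t : 0 <= t -> `|u k t| ^+ 2 <= M.
  move=> t0; have [v vP] := uP' k; apply: le_trans (duhamel_norm vP t0) _.
  rewrite lerD2r ler_piMr ?sqr_ge0 // expR_le1 oppr_le0 mulr_ge0 // ltW //.
have diff k t : 0 <= t -> `|u k.+1 t - u k t| ^+ 2 <= 4 * M / 4 ^+ k * expR (2 * (2 * L) * t).
  elim: k t => [|k IH] t t0.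
    rewrite expr0 divr1; apply: (@le_trans _ _ (4 * M)); last first.
      by rewrite ler_peMr ?mulr_ge0 // -expR0 ler_expR !mulr_ge0 // ltW.
    have := uM 1%N t t0; have := uM 0%N t t0; rewrite (sqr_normB ipP).
    by have := ip_le_sqr ipP (- u 1%N t) (u 0%N t) ltr01; rewrite (ipNl ipP) normrN divr1 mul1r; lra.
  have := @duhamel_contraction u0 (u k.+1) (u k) (u k.+2) (u k.+1) (4 * M / 4 ^+ k) t (uP _) (uP _) _ t0.
  rewrite (_ : 4 * M / 4 ^+ k.+1 = 4 * M / 4 ^+ k / 4); last first.
    by rewrite exprS; field; rewrite gt_eqF // exprn_gt0.
  by apply; [rewrite divr_ge0 ?mulr_ge0 // ltW ?exprn_gt0|move=> s /ltW; exact: IH].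
pose C t := 2 * Num.sqrt M * expR (2 * L * t).
have diff' k t : `|u k.+1 t - u k t| <= C t / 2 ^+ k.
  have C0 : 0 <= C t / 2 ^+ k.
    by rewrite divr_ge0 ?mulr_ge0 ?sqrtr_ge0 ?expR_ge0 // exprn_ge0.
  have [t0|t0] := leP t 0.
    have [_ -> // _] := uP k; have [v [_ -> // _]] := uP' k.
    by rewrite subrr normr0.
  rewrite -ler_sqr ?nnegrE //; apply: le_trans (diff k t (ltW t0)) _.
  rewrite /C !exprMn sqr_sqrtr // exprVn -exprM mulnC exprM (_ : 2 ^+ 2 = 4); last by ring.
  rewrite le_eqVlt; apply/orP; left; apply/eqP.
  rewrite (_ : 2 * (2 * L) * t = 2 * L * t + 2 * L * t); last ring.
  by rewrite expRD expr2; ring.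
have /choice[v vP] : forall t, exists l, forall k, `|l - u k t| <= 2 * C t / 2 ^+ k.
  by move=> t; apply: geometric_cvg => k; exact: diff'.
have Cp (t : R) : 0 <= C t by rewrite !mulr_ge0 ?sqrtr_ge0 ?expR_ge0.
have cv : continuous v.
  move=> t; apply/cvgrPdist_le => eps eps0.
  have e3 : 0 < eps / 3 by rewrite divr_gt0.
  have [n hn] := half_pow_small (2 * C (t + 1)) e3.
  have uc : {for t, continuous (u n)} by apply: (svalP (w n)).
  have Cmono s : s < t + 1 -> 2 * C s / 2 ^+ n <= eps / 3.
    move=> st; apply: le_trans (ltW hn); rewrite ler_wpM2r ?invr_ge0 ?exprn_ge0 // ler_wpM2l //.
    rewrite ler_wpM2l ?mulr_ge0 ?sqrtr_ge0 // ler_expR ler_wpM2l ?mulr_ge0 // ltW //.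
  near=> s.
  have hs : `|v s - u n s| <= eps / 3.
    by apply: le_trans (vP _ _) _; apply: Cmono; near: s; apply: lt_nbhsl; rewrite ltrDl.
  have ht : `|v t - u n t| <= eps / 3 by apply: le_trans (vP _ _) _; apply: Cmono; rewrite ltrDl.
  have hu : `|u n t - u n s| <= eps / 3 by near: s; move/cvgrPdist_le : uc; apply.
  rewrite (_ : v t - v s = (v t - u n t) + ((u n t - u n s) - (v s - u n s))); last first.
    by rewrite opprB !subrKA.
  apply: le_trans (ler_normD _ _) _; apply: le_trans (lerD (lexx _) (ler_normB _ _)) _; lra.
(* The limit [v] is only known as a limit of the iterates; the solution [z] driven by [v] is shown
   to be the same limit. *)
have [z zP] := duhamel_exists u0 cv.
suff E : v = z by exists v; rewrite {2}E.
apply/funext => t; apply/eqP; rewrite -subr_eq0 -normr_le0; apply/ler_addgt0Pr => eps eps0.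
rewrite add0r; have [k hk] := half_pow_small (2 * C t) eps0.
apply: le_trans (ltW hk).
have vk : `|v t - u k.+1 t| <= C t / 2 ^+ k.
  apply: le_trans (vP t k.+1) _; rewrite exprS le_eqVlt; apply/orP; left.
  by apply/eqP; field; rewrite gt_eqF // exprn_gt0.
have zk : `|z t - u k.+1 t| <= C t / 2 ^+ k.
  have Ck : 0 <= C t / 2 ^+ k by rewrite divr_ge0 // exprn_ge0.
  have [t0|t0] := leP t 0.
    have [_ -> // _] := zP; have [_ -> // _] := uP k.
    by rewrite subrr normr0.
  rewrite -ler_sqr ?nnegrE //.
  have C2 s : (C s / 2 ^+ k) ^+ 2 = 4 * M / (2 ^+ k) ^+ 2 * expR (2 * (2 * L) * s).
    rewrite /C !exprMn sqr_sqrtr // exprVn.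
    rewrite (_ : 2 * (2 * L) * s = 2 * L * s + 2 * L * s); last ring.
    by rewrite expRD; ring.
  have := @duhamel_contraction u0 v (u k) z (u k.+1) (16 * M / (2 ^+ k) ^+ 2) t zP (uP k) _ (ltW t0) _.
  rewrite C2 (_ : 16 * M / (2 ^+ k) ^+ 2 / 4 = 4 * M / (2 ^+ k) ^+ 2); last first.
    by field; rewrite gt_eqF // exprn_gt0.
  apply; first by rewrite divr_ge0 ?mulr_ge0 // exprn_ge0 // exprn_ge0.
  move=> s s0; have := vP s k; rewrite -ler_sqr ?nnegrE // ?divr_ge0 ?mulr_ge0 ?exprn_ge0 //.
  rewrite (_ : (2 * C s / 2 ^+ k) ^+ 2 = 4 * (C s / 2 ^+ k) ^+ 2); last ring.
  by rewrite C2 (_ : 4 * (4 * M / (2 ^+ k) ^+ 2 * _) = 16 * M / (2 ^+ k) ^+ 2 * expR (2 * (2 * L) * s)) //; ring.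
rewrite (_ : v t - z t = (v t - u k.+1 t) - (z t - u k.+1 t)); last by rewrite opprB subrKA.
apply: le_trans (ler_normB _ _) _; apply: le_trans (lerD vk zk) _.
by rewrite (_ : 2 * C t / 2 ^+ k = C t / 2 ^+ k + C t / 2 ^+ k) //; ring.
Unshelve. all: by end_near. Qed.

End Mild.

(** * Mild solutions are strong *)

Section Strong.
Context {R : realType} {V : completeNormedModType R} (ip : V -> V -> R).
Context (A : V -> V) (DA : set V) (lam : nat -> R) (e : nat -> V) (F : V -> V) (L BF : R).
Hypothesis ipP : inner_product ip.
Hypothesis Asa : self_adjoint ip A DA.
Hypothesis Acpt : compact_inverse A DA.
Hypothesis lam0 : 0 < lam 0.
Hypothesis lam_mono : forall n, lam n <= lam n.+1.
Hypothesis eP : orthonormal_basis ip e.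
Hypothesis Ae : forall n, DA (e n) /\ A (e n) = lam n *: e n.
Hypothesis L0 : 0 < L.
Hypothesis FL : forall u v, `|F u - F v| <= L * `|u - v|.
Hypothesis FB : forall u, `|F u| <= BF.

Let D (u0 : V) := `|u0| ^+ 2 + (1 + 2 / lam 0) * BF ^+ 2 / (2 * L ^+ 2).
Let c := 1 + L ^+ 2.
Let c0 : 0 <= c. Proof. by rewrite addr_ge0 ?sqr_ge0. Qed.

Let E0 : 0 <= (1 + 2 / lam 0) * BF ^+ 2 / (2 * L ^+ 2).
Proof.
have l0 : 0 <= 1 + 2 / lam 0 by apply: addr_ge0 => //; apply: divr_ge0 => //; exact: ltW.
by apply: divr_ge0; apply: mulr_ge0 => //; exact: sqr_ge0.
Qed.

Let D0 (u0 : V) : 0 <= D u0.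
Proof. by apply: addr_ge0; [exact: sqr_ge0|exact: E0]. Qed.

Lemma sqr_normB_le (a b : V) M : `|a| ^+ 2 <= M -> `|b| ^+ 2 <= M -> `|a - b| ^+ 2 <= 4 * M.
Proof.
move=> aM bM; rewrite (sqr_normB ipP).
by have := ip_le_sqr ipP (- a) b ltr01; rewrite (ipNl ipP) normrN divr1 mul1r; lra.
Qed.

(** Time shifts are unsuitable here, since [u h - u 0] need not be of order [h] for a rough initial
    value; a dilation fixes time 0. A bound with constant [kappa] is turned by [mode_dilation] into
    one with [kappa / 2 + d], where [d] is of order [(mu - 1) ^+ 2]. Starting from the crude bound
    [4 * M] and iterating leads to the fixed point [2 * d]. *)
Lemma time_dilation u0 u mu T : duhamel ip lam e F u0 u u -> 0 < T -> 1 / 2 <= mu <= 2 ->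
  `|u (mu * T) - u T| ^+ 2 <= 2 * ((mu - 1) ^+ 2 * D u0) * expR (2 * c * T).
Proof.
move=> uP T0 mu12; have [cu u00 du] := uP.
have mu0 : 0 < mu by move: mu12 => /andP[]; lra.
pose M := `|u0| ^+ 2 + BF ^+ 2 / lam 0 ^+ 2.
have uM t : 0 <= t -> `|u t| ^+ 2 <= M.
  move=> t0; apply: le_trans (duhamel_norm ipP lam0 lam_mono eP FB uP t0) _.
  by rewrite lerD2r ler_piMr ?sqr_ge0 // expR_le1 oppr_le0 mulr_ge0 // ltW.
have M0 : 0 <= M by apply: le_trans (uM 0 (lexx _)); rewrite sqr_ge0.
pose d := (mu - 1) ^+ 2 * D u0.
have d0 : 0 <= d by rewrite mulr_ge0 ?sqr_ge0.
have P j s : 0 < s <= T -> `|u (mu * s) - u s| ^+ 2 <= (4 * M / 2 ^+ j + 2 * d) * expR (2 * c * s).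
  elim: j s => [|j IH] s /andP[s0 sT].
    rewrite expr0 divr1; apply: (@le_trans _ _ (4 * M)).
      by apply: sqr_normB_le; apply: uM; rewrite ?mulr_ge0 // ltW.
    apply: (@le_trans _ _ (4 * M * expR (2 * c * s))).
      by rewrite ler_peMr ?mulr_ge0 // -expR0 ler_expR !mulr_ge0 // ltW.
    by rewrite ler_wpM2r ?expR_ge0 // lerDl mulr_ge0.
  apply: (norm_le_coords ipP eP) => n.
  under eq_bigr do rewrite (ipBl ipP).
  have k0 : 0 <= 4 * M / 2 ^+ j + 2 * d.
    by apply: addr_ge0; [apply: divr_ge0; [exact: mulr_ge0|exact: exprn_ge0]|exact: mulr_ge0].
  have := @mode_dilation R lam lam0 lam_mono (fun k t => ip (u t) (e k))
    (fun k t => ip (F (u t)) (e k)) n s mu (L ^+ 2) (`|u0| ^+ 2) (BF ^+ 2)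
    (4 * M / 2 ^+ j + 2 * d) s0 mu12 (exprn_gt0 _ L0) (sqr_ge0 _) (sqr_ge0 _) k0.
  move=> H; apply: le_trans (H _ _ _ _ _) _.
  - by move=> k; exact: (duhamel_cvg0 ipP (n:=k) uP).
  - by move=> k t t0; exact: du.
  - by move=> t _; exact: (sum_F_le ipP eP FB).
  - by rewrite u00 //; apply: (bessel ipP); exact: (basis_ortho eP).
  - move=> t /andP[t0 ts]; under eq_bigr do rewrite -(ipBl ipP).
    apply: le_trans (bessel ipP _ n (basis_ortho eP)) _.
    apply: (@le_trans _ _ ((L * `|u (mu * t) - u t|) ^+ 2)).
      by rewrite ler_sqr ?nnegrE // mulr_ge0 // ltW.
    rewrite exprMn [leRHS](_ : _ = L ^+ 2 * ((4 * M / 2 ^+ j + 2 * d) * expR (2 * c * t))).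
      by rewrite ler_wpM2l ?sqr_ge0 // IH // t0 (le_trans ts).
    by rewrite /c; ring.
  rewrite -/(D u0) -/d -/c ler_wpM2r ?expR_ge0 // exprS le_eqVlt; apply/orP; left; apply/eqP.
  by field; rewrite gt_eqF // exprn_gt0.
have e0 := expR_gt0 (2 * c * T).
apply/ler_addgt0Pr => eps eps0.
have [j hj] := half_pow_small (4 * M) (divr_gt0 eps0 e0).
apply: le_trans (P j T _) _; first by rewrite T0 lexx.
rewrite mulrDl addrC lerD // -ler_pdivlMr //; exact: ltW.
Qed.

(** Bound for the squared time derivative at [t] in terms of the squared initial norm [M]. The 8 is
    the 2 of [time_dilation] over the square of 1/2, since the estimate is used on all of
    [[t / 2, t]]. *)
Definition rate_bound (M t : R) : R :=
  8 / t ^+ 2 * (M + (1 + 2 / lam 0) * BF ^+ 2 / (2 * L ^+ 2)) * expR (2 * c * t).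

(** Going from [s] to [s + h] is the dilation by [1 + h / s]. *)
Lemma time_lipschitz u0 u t s h : duhamel ip lam e F u0 u u -> 0 < t -> t / 2 <= s <= t ->
  `|h| <= t / 4 -> `|u (s + h) - u s| ^+ 2 <= h ^+ 2 * rate_bound (`|u0| ^+ 2) t.
Proof.
move=> uP t0 /andP[s1 s2] ht.
have s0 : 0 < s by lra.
have hs : `|h / s| <= 1 / 2.
  by rewrite normrM normfV (gtr0_norm s0) ler_pdivrMr //; lra.
have hs2 : 1 / 2 <= 1 + h / s <= 2 by move: hs; rewrite ler_norml => /andP[]; lra.
have := time_dilation uP s0 hs2.
have -> : (1 + h / s) * s = s + h by field; rewrite gt_eqF.
move=> H; apply: le_trans H _.
have -> : 1 + h / s - 1 = h / s by ring.
rewrite /rate_bound -/(D u0) exprMn exprVn.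
have -> : 2 * (h ^+ 2 / s ^+ 2 * D u0) * expR (2 * c * s) =
  h ^+ 2 * (2 / s ^+ 2 * D u0 * expR (2 * c * s)) by ring.
rewrite ler_wpM2l ?sqr_ge0 // ler_pM ?expR_ge0 //.
- by rewrite mulr_ge0 // divr_ge0 // sqr_ge0.
- rewrite ler_wpM2r // ler_pdivrMr ?exprn_gt0 // mulrAC ler_pdivlMr ?exprn_gt0 //.
  by nra.
- by rewrite ler_expR ler_wpM2l // mulr_ge0.
Qed.

(** The difference quotients in time are bounded, and their coefficients converge by the modal
    equations. They solve linear problems whose forcing is at most [L] times as large as they are,
    so [mode_smoothing] bounds their [lam]-weighted sums uniformly in the increment. As the
    eigenvalues are unbounded, this makes the tails uniformly small and the convergence strong; the
    modal equations then put [u t] in the domain. *)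
Theorem mild_strong u0 u t : duhamel ip lam e F u0 u u -> 0 < t ->
  solution_at A DA F u t /\ `|A (u t)| <= BF + Num.sqrt (rate_bound (`|u0| ^+ 2) t).
Proof.
move=> uP t0; have [cu u00 du] := uP.
pose K := rate_bound (`|u0| ^+ 2) t.
have K0 : 0 <= K.
  rewrite /K /rate_bound mulr_ge0 ?expR_ge0 // mulr_ge0 ?divr_ge0 ?sqr_ge0 //.
  by rewrite addr_ge0 ?sqr_ge0.
pose d (h s : R) : V := h^-1 *: (u (s + h) - u s).
have dK h s : h != 0 -> `|h| <= t / 4 -> t / 2 <= s <= t -> `|d h s| ^+ 2 <= K.
  move=> h0 ht st; rewrite /d normrZ exprMn normfV exprVn real_normK ?num_real //.
  rewrite ler_pdivrMl ?exprn_even_gt0 //; exact: time_lipschitz.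
pose v k := - (lam k * ip (u t) (e k)) + ip (F (u t)) (e k).
have dv k : (fun h => ip (d h t) (e k)) @ 0^' --> v k.
  have [der derE] := du k t t0.
  have fE : (fun h : R => h^-1 *: (((fun r => ip (u r) (e k)) \o shift t) (h *: (1:R)) - ip (u t) (e k))) =
     (fun h => ip (d h t) (e k)).
    by apply/funext => h; rewrite /d /= (ipZl ipP) (ipBl ipP) /GRing.scale /= mulr1 (addrC h).
  by move: der derE; rewrite /derivable /derive fE => der derE; rewrite /v -derE.
have near0 : \forall h \near (0 : R)^', h != 0 /\ `|h| <= t / 4.
  near=> h; split; first by near: h; exact: nbhs_dnbhs_neq.
  near: h; apply: nbhs_dnbhs; exists (t / 4); first by rewrite /= divr_gt0.
  by move=> y; rewrite /= sub0r normrN => /ltW.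
have vK n : \sum_(0 <= k < n) v k ^+ 2 <= K.
  have sv : (fun h => \sum_(0 <= k < n) ip (d h t) (e k) ^+ 2) @ 0^' --> \sum_(0 <= k < n) v k ^+ 2.
    elim: (index_iota 0 n) => [|i s IH].
      by rewrite big_nil; apply: cvg_near_cst; apply: nearW => h; rewrite big_nil.
    rewrite big_cons; under eq_fun do rewrite big_cons.
    by apply: cvgD => //; exact: (cvgM (dv i) (dv i)).
  rewrite -(cvg_lim (@Rhausdorff R) sv); apply: limr_le; first exact: cvgP sv.
  apply: filterS near0 => h [h0 ht].
  apply: le_trans (bessel ipP _ n (basis_ortho eP)) _; apply: dK => //; lra.
have [w [wv wK]] := coords_exist ipP eP vK.
have dw : (fun h => d h t) @ 0^' --> w.
  apply: (cvg_of_modes ipP eP) => [n|eps eps0]; first by rewrite wv.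
  (* The bound of [mode_smoothing] on [[t / 2, t]], where the quotients obey the bound [K] and their
     forcing the bound [L ^+ 2 * K]. *)
  pose C := K / (t - t / 2) + (t - t / 2) * (L ^+ 2 * K) + K + L ^+ 2 * K.
  have t2 : 0 < t - t / 2 by lra.
  have LK : 0 <= L ^+ 2 * K by rewrite mulr_ge0 ?sqr_ge0.
  have C0 : 0 <= C.
    have := mulr_ge0 (ltW t2) LK; have := divr_ge0 K0 (ltW t2); rewrite /C; lra.
  have [N hN] := lam_unbounded ipP Asa Acpt lam0 lam_mono eP Ae (C / eps).
  exists N; apply: filterS near0 => h [h0 ht] n.
  have lN : 0 < lam N by apply: (lam_gt0 lam0).
  have X : \sum_(0 <= k < n) lam k * ip (d h t) (e k) ^+ 2 <= C.
    have sh s : t / 2 <= s -> 0 < s + h.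
      by move=> s2; move: ht; rewrite ler_norml => /andP[h1 _]; lra.
    have tt : t / 2 < t by lra.
    have dd k s : t / 2 <= s -> deriv_at (fun r => ip (d h r) (e k)) s
       (- (lam k * ip (d h s) (e k)) + h^-1 * (ip (F (u (s + h))) (e k) - ip (F (u s)) (e k))).
      move=> s2; have s0 : 0 < s by lra.
      have dsh : deriv_at (fun r : R => r + h) s 1.
        by apply: deriv_at_eq; [dauto|rewrite addr0].
      have := deriv_at_mul (deriv_at_cst h^-1 s) (deriv_at_add
        (deriv_at_comp dsh (du k _ (sh _ s2))) (deriv_at_opp (du k s s0))).
      under eq_fun do rewrite -(ipBl ipP) -(ipZl ipP).
      move=> H; apply: deriv_at_eq H _.
      by rewrite /d (ipZl ipP) (ipBl ipP); ring.
    apply: (@mode_smoothing R lam lam0 lam_mono (fun k r => ip (d h r) (e k))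
      (fun k s => h^-1 * (ip (F (u (s + h))) (e k) - ip (F (u s)) (e k))) (t / 2) t) => //.
    - exact: ltW.
    - by move=> k; apply: (cvg_right_of_derive (dd k _ (lexx _))).
    - by move=> k s /andP[s1 _]; apply: dd; exact: ltW.
    - move=> s st; apply: le_trans (bessel ipP _ n (basis_ortho eP)) _; exact: dK.
    - move=> s /andP[s1 s2]; under eq_bigr do rewrite -(ipBl ipP) -(ipZl ipP).
      apply: le_trans (bessel ipP _ n (basis_ortho eP)) _.
      apply: (@le_trans _ _ ((L * `|d h s|) ^+ 2)).
        rewrite ler_sqr ?nnegrE // ?mulr_ge0 // ?(ltW L0) // /d !normrZ mulrCA.
        by rewrite ler_wpM2l.
      by rewrite exprMn ler_wpM2l ?sqr_ge0 // dK // (ltW s1).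
  have [Nn|nN] := leqP N n; last by rewrite big_geq ?ltW // ltnW.
  have : lam N * \sum_(N <= k < n) ip (d h t) (e k) ^+ 2 <= C.
    apply: le_trans X; rewrite [leRHS](big_cat_nat (leq0n N) Nn) /= -[leLHS]add0r.
    apply: lerD; first by apply: sumr_ge0 => k _; rewrite mulr_ge0 ?sqr_ge0 // ltW // (lam_gt0 lam0).
    rewrite mulr_sumr [leLHS]big_nat_cond [leRHS]big_nat_cond; apply: ler_sum => k; rewrite andbT => /andP[Nk _].
    by rewrite ler_wpM2r ?sqr_ge0 // (lam_le lam_mono).
  rewrite -ler_pdivlMl // => H; apply: le_trans H _.
  by rewrite ler_pdivrMl // -ler_pdivrMr // ltW.
have [DAu Au] : DA (u t) /\ A (u t) = F (u t) - w.
  apply: (dom_of_coords ipP Asa Acpt lam0 lam_mono eP Ae) => n.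
  by rewrite (ipBl ipP) wv /v opprD opprK addrC subrK.
have du' : deriv_at u t w.
  have fE : (fun h : R => h^-1 *: ((u \o shift t) (h *: (1:R)) - u t)) = (fun h => d h t).
    by apply/funext => h; rewrite /d /= /GRing.scale /= mulr1 (addrC h).
  apply: deriv_atP; first by rewrite /derivable fE; exact: cvgP dw.
  by rewrite /derive fE; exact: cvg_lim dw.
split.
  have [der derE] := du'; split => //; split => //.
  by rewrite derE Au addrC subrK.
rewrite Au; apply: le_trans (ler_normB _ _) _; apply: lerD => //.
by rewrite -ler_sqr ?nnegrE ?sqrtr_ge0 // sqr_sqrtr.
Unshelve. all: by end_near. Qed.

End Strong.

(** * Global attractor *)

Section Attractor.
Context {R : realType} {V : normedModType R} (S : R -> V -> V) (K : set V).
Hypothesis SD : forall (t s : R) u, 0 <= t -> 0 <= s -> S (t + s) u = S t (S s u).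
Hypothesis Scont : forall t : R, 0 <= t -> continuous (S t).
Hypothesis Kc : compact K.
Hypothesis Kabs : forall B, Defs.bounded_set B -> exists2 T : R, 0 <= T &
  forall (t : R) b, T <= t -> B b -> K (S t b).

Definition omega_limit : set V := [set x | forall eps T : R, 0 < eps ->
  exists t, exists b, [/\ T <= t, 0 <= t, K b & `|S t b - x| < eps]].

Let Kbnd : Defs.bounded_set K.
Proof.
have [M [_ MP]] := compact_bounded Kc.
by exists (M + 1) => x Kx; apply: (MP (M + 1)) => //; rewrite ltrDl.
Qed.

Let archi (T : R) : exists N : nat, forall n, (N <= n)%N -> T <= n%:R.
Proof.
exists (Num.truncn T).+1 => n Nn; apply: le_trans (ltW (truncnS_gt T)) _.
by rewrite ler_nat.
Qed.

Let omega_cluster (t : nat -> R) (b : nat -> V) :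
  (forall n, n%:R <= t n) -> (forall n, K (b n)) ->
  exists2 p, omega_limit p & forall (eps : R) N, 0 < eps ->
    exists2 n, (N <= n)%N & `|p - S (t n) (b n)| < eps.
Proof.
move=> tn Kb; have [T T0 TP] := Kabs Kbnd.
have Kx : \forall n \near \oo, K (S (t n) (b n)).
  have [N NP] := archi T; exists N => // n /= Nn.
  by apply: TP => //; apply: le_trans (tn n); exact: NP.
have [p Kp cp] := compact_seq_cluster Kc Kx.
exists p => // eps T' eps0; have [N NP] := archi T'.
have [n Nn pn] := cp _ N eps0; exists (t n), (b n); split => //.
- by apply: le_trans (tn n); exact: NP.
- exact: le_trans (ler0n _ _) (tn n).
- by rewrite distrC.
Qed.

Let omega_closed : closed omega_limit.
Proof.
move=> x clx eps T eps0; have e2 : 0 < eps / 2 by rewrite divr_gt0.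
have [y [oy xy]] := clx _ (nbhsx_ballx x _ e2).
have [t [b [Tt t0 Kb Sy]]] := oy _ T e2; exists t, b; split => //.
rewrite -(subrKA y); apply: le_lt_trans (ler_normD _ _) _.
by rewrite (splitr eps) ltrD //; move: xy; rewrite -ball_normE /ball_ /= distrC.
Qed.

Lemma omega_limit_attractor : global_attractor S omega_limit.
Proof.
have [TK TK0 TKP] := Kabs Kbnd.
split; [|split].
- apply: (subclosed_compact omega_closed Kc) => x ox.
  apply: (compact_closed (@norm_hausdorff _ V) Kc) => U /nbhs_ballP[eps /= eps0 Ux].
  have [t [b [Tt t0 Kb Sx]]] := ox _ TK eps0.
  exists (S t b); split; first exact: TKP.
  by apply: Ux; rewrite -ball_normE /ball_ /= distrC.
- move=> t t0; apply/seteqP; split.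
    move=> _ [x ox <-] eps T eps0.
    have /cvgrPdist_lt/(_ _ eps0)/nbhs_ballP[d /= d0 dP] := @Scont t t0 x.
    have [s [b [Ts s0 Kb Sx]]] := ox _ T d0.
    exists (t + s), b; split => //; [by rewrite ler_wpDl|exact: addr_ge0|].
    rewrite SD // distrC; apply: dP; by rewrite -ball_normE /ball_ /= distrC.
  (* Backward invariance: [x] is a limit of points of [K] transported for times tending to infinity.
     Stopping [t] earlier gives a sequence that clusters, by absorption in the compact [K], at a
     preimage of [x] under [S t]. *)
  move=> x ox.
  have /choice[tb tbP] : forall n : nat, exists tb : R * V,
     [/\ n%:R + t <= tb.1, 0 <= tb.1, K tb.2 & `|S tb.1 tb.2 - x| < n.+1%:R^-1].
    move=> n; have n0 : 0 < n.+1%:R^-1 :> R by rewrite invr_gt0.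
    have [s [b H]] := ox _ (n%:R + t) n0; by exists (s, b).
  have tn n : n%:R <= (tb n).1 - t by rewrite lerBrDr; have [] := tbP n.
  have [y oy cy] := @omega_cluster (fun n => (tb n).1 - t) (fun n => (tb n).2) tn
    (fun n => let: And4 _ _ h _ := tbP n in h).
  exists y => //; apply/eqP; rewrite -subr_eq0 -normr_le0; apply/ler_addgt0Pr => eps eps0.
  have e2 : 0 < eps / 2 by rewrite divr_gt0.
  have /cvgrPdist_lt/(_ _ e2)/nbhs_ballP[d /= d0 dP] := @Scont t t0 y.
  have [N NP] := archi (eps / 2)^-1.
  have [n Nn yn] := cy _ N d0.
  have [h1 h2 h3 h4] := tbP n.
  have s0 : 0 <= (tb n).1 - t by apply: le_trans (tn n); exact: ler0n.
  rewrite add0r -(subrKA (S (tb n).1 (tb n).2)); apply: le_trans (ler_normD _ _) _.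
  rewrite (splitr eps) lerD //.
    have -> : S (tb n).1 (tb n).2 = S t (S ((tb n).1 - t) (tb n).2).
      by rewrite -SD // addrC subrK.
    by rewrite ltW //; apply: dP; rewrite -ball_normE.
  apply: le_trans (ltW h4) _; rewrite -[leRHS]invrK lef_pV2 ?posrE ?invr_gt0 //.
  by apply: le_trans (NP _ Nn) _; rewrite ler_nat.
- move=> B Bb eps eps0.
  (* Attracting [K] is enough, since every bounded set is in [K] after a finite time. *)
  suff [T TP] : exists T, forall t, T <= t -> forall b, K b ->
      exists a, omega_limit a /\ `|S t b - a| < eps.
    have [TB TB0 TBP] := Kabs Bb; exists (Num.max T 0 + TB) => t Tt b Bb'.
    have tT : Num.max T 0 <= t - TB by rewrite lerBrDr.
    have := TP (t - TB) _ (S TB b) (TBP _ _ (lexx _) Bb').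
    rewrite -SD //; last by apply: le_trans tT; rewrite le_max lexx orbT.
    by rewrite subrK; apply; apply: le_trans tT; rewrite le_max lexx.
  apply: contrapT => H.
  have /choice[tb tbP] : forall n : nat, exists tb : R * V, [/\ n%:R <= tb.1, K tb.2 &
      forall a, omega_limit a -> eps <= `|S tb.1 tb.2 - a|].
    move=> n; apply: contrapT => Hn; apply: H; exists n%:R => t nt b Kb.
    apply: contrapT => Ha; apply: Hn; exists (t, b); split => // a oa.
    by rewrite leNgt; apply/negP => Sa; apply: Ha; exists a.
  have [p op cp] := @omega_cluster (fun n => (tb n).1) (fun n => (tb n).2)
    (fun n => let: And3 h _ _ := tbP n in h) (fun n => let: And3 _ h _ := tbP n in h).
  have [n _] := cp _ 0%N eps0; have [_ _ /(_ p op)] := tbP n.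
  by rewrite distrC leNgt => /negP.
Qed.

End Attractor.

(** * The flow, its absorbing set and its bounded full trajectories *)

Section Semigroup.
Context {R : realType} {V : completeNormedModType R} (ip : V -> V -> R).
Context (A : V -> V) (DA : set V) (lam : nat -> R) (e : nat -> V) (F : V -> V) (L BF : R).
Hypothesis ipP : inner_product ip.
Hypothesis Asa : self_adjoint ip A DA.
Hypothesis Apos : positive_op ip A DA.
Hypothesis Acpt : compact_inverse A DA.
Hypothesis lam0 : 0 < lam 0.
Hypothesis lam_mono : forall n, lam n <= lam n.+1.
Hypothesis eP : orthonormal_basis ip e.
Hypothesis Ae : forall n, DA (e n) /\ A (e n) = lam n *: e n.
Hypothesis L0 : 0 < L.
Hypothesis FL : forall u v, `|F u - F v| <= L * `|u - v|.
Hypothesis FB : forall u, `|F u| <= BF.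

Lemma ip_cvg {T : Type} {G : set_system T} {GG : Filter G} (f g : T -> V) (a b : V) :
  f @ G --> a -> g @ G --> b -> (fun t => ip (f t) (g t)) @ G --> ip a b.
Proof.
move=> fa gb.
have pol u v : ip u v = (`|u + v| * `|u + v| - `|u| * `|u| - `|v| * `|v|) / 2.
  by rewrite -!expr2 (sqr_normD ipP); field.
have na : (fun t => `|f t|) @ G --> `|a| by exact: cvg_norm.
have nb : (fun t => `|g t|) @ G --> `|b| by exact: cvg_norm.
have nab : (fun t => `|f t + g t|) @ G --> `|a + b| by apply: cvg_norm; exact: cvgD.
have H := cvgM (cvgB (cvgB (cvgM nab nab) (cvgM na na)) (cvgM nb nb)) (cvg_cst (2^-1 : R)).
rewrite [X in X @ _](_ : _ = (fun t => (`|f t + g t| * `|f t + g t| - `|f t| * `|f t| - `|g t| * `|g t|) / 2)).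
  by rewrite pol; exact: H.
by apply/funext => t; rewrite pol.
Qed.

Lemma deriv_at_ip (f g : R -> V) x a b : deriv_at f x a -> deriv_at g x b ->
  deriv_at (fun t => ip (f t) (g t)) x (ip a (g x) + ip (f x) b).
Proof.
move=> df dg; have gc := deriv_at_continuous dg.
case: df => df fE; case: dg => dg gE.
have lim_ : (fun h : R => h^-1 *: (((fun t => ip (f t) (g t)) \o shift x) (h *: (1 : R)) - ip (f x) (g x))) @ 0^'
    --> ip a (g x) + ip (f x) b.
  rewrite [X in X @ _](_ : _ = (fun h : R =>
     ip (h^-1 *: ((f \o shift x) (h *: (1 : R)) - f x)) ((g \o shift x) (h *: (1 : R))) +
     ip (f x) (h^-1 *: ((g \o shift x) (h *: (1 : R)) - g x)))); last first.
    apply/funext => h /=; rewrite (ipZl ipP) (ipZr ipP) (ipBl ipP) (ipBr ipP) /GRing.scale /=; ring.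
  apply: cvgD; apply: ip_cvg.
  - by move: df; rewrite /derivable -fE.
  - have sx : (fun h : R => h *: (1:R) + x) @ 0^' --> x.
      rewrite -[X in _ --> X](add0r x); apply: cvgD; last exact: cvg_cst.
      rewrite /GRing.scale /=; under eq_fun do rewrite mulr1.
      exact: nbhs_dnbhs.
    exact: (cvg_comp _ _ sx gc).
  - exact: cvg_cst.
  - by move: dg; rewrite /derivable -gE.
apply: deriv_atP; first exact: cvgP lim_.
exact: cvg_lim lim_.
Qed.

Lemma A_lin a u v : DA u -> DA v -> DA (a *: u + v) /\ A (a *: u + v) = a *: A u + A v.
Proof. by move=> Du Dv; have [[_ [D1 D2]] _] := Asa; split; [exact: D1|exact: D2]. Qed.

Lemma A_ge0 u : DA u -> 0 <= ip (A u) u.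
Proof.
move=> Du; have [->|u0] := eqVneq u 0; first by rewrite (ip0r ipP).
by apply/ltW/Apos => //; apply/eqP.
Qed.

(** Positivity of [A] discards the unbounded term of the energy identity. This gives both uniqueness
    among strong solutions and the Lipschitz continuity of the flow. *)
Lemma solution_gronwall (w w' : R -> V) (a b : R) : a <= b ->
  w x @[x --> a^'+] --> w a -> w' x @[x --> a^'+] --> w' a ->
  (forall t, a < t <= b -> solution_at A DA F w t) ->
  (forall t, a < t <= b -> solution_at A DA F w' t) ->
  `|w b - w' b| <= expR (L * (b - a)) * `|w a - w' a|.
Proof.
move=> ab wa wa' sw sw'.
pose z t := w t - w' t.
have dz t : a < t <= b -> deriv_at z t ((F (w t) - F (w' t)) - A (z t)) /\ DA (z t).
  move=> tab; have [d1 [D1 E1]] := sw t tab; have [d2 [D2 E2]] := sw' t tab.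
  have [D12 A12] := A_lin (-1) D2 D1; rewrite !scaleN1r in D12 A12.
  rewrite /z (addrC (w t)); split => //; rewrite A12.
  have -> : F (w t) - F (w' t) - (- A (w' t) + A (w t)) = 'D_1 w t - 'D_1 w' t.
    by rewrite -E1 -E2 (addrC (- A (w' t))) opprD addrACA addrK.
  by apply: deriv_at_add; [|apply: deriv_at_opp]; apply: deriv_atP.
rewrite -ler_sqr ?nnegrE ?mulr_ge0 ?expR_ge0 // exprMn -!(ipE ipP).
have -> : expR (L * (b - a)) ^+ 2 = expR (2 * L * (b - a)).
  by rewrite expr2 -expRD; congr expR; ring.
rewrite mulrC.
have za : z x @[x --> a^'+] --> z a by apply: cvgB.
apply: (@gronwall _ (fun t => ip (z t) (z t))
   (fun t => ip ((F (w t) - F (w' t)) - A (z t)) (z t) + ip (z t) ((F (w t) - F (w' t)) - A (z t)))) => //.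
- exact: ip_cvg.
- by move=> t /dz[d _]; apply: deriv_at_ip.
- move=> t /dz[_ Dz]; rewrite (ipC ipP (z t)) (ipBl ipP) (ipE ipP).
  have := A_ge0 Dz; have : ip (F (w t) - F (w' t)) (z t) <= L * `|z t| ^+ 2.
    apply: le_trans (ler_norm _) _; apply: le_trans (ip_le ipP _ _) _.
    by rewrite expr2 mulrA ler_wpM2r // FL.
  lra.
Qed.

Lemma solution_unique (w w' : R -> V) (a b : R) : a <= b -> w a = w' a ->
  w x @[x --> a^'+] --> w a -> w' x @[x --> a^'+] --> w' a ->
  (forall t, a < t <= b -> solution_at A DA F w t) ->
  (forall t, a < t <= b -> solution_at A DA F w' t) -> w b = w' b.
Proof.
move=> ab wwa wa wa' sw sw'; have := solution_gronwall ab wa wa' sw sw'.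
by rewrite wwa subrr normr0 mulr0 normr_le0 subr_eq0 => /eqP.
Qed.

Lemma solution_shift (w : R -> V) (s t : R) : solution_at A DA F w (t + s) ->
  solution_at A DA F (fun r => w (r + s)) t.
Proof.
case=> dw [Dw Ew].
have fE : (fun h : R => h^-1 *: (((fun r => w (r + s)) \o shift t) (h *: (1:R)) - w (t + s))) =
    (fun h : R => h^-1 *: ((w \o shift (t + s)) (h *: (1:R)) - w (t + s))).
  by apply/funext => h /=; rewrite addrA.
split; first by rewrite /derivable fE.
by split => //; rewrite /derive fE.
Qed.

Lemma solution_right_cvg (w : R -> V) (t : R) : solution_at A DA F w t -> w x @[x --> t^'+] --> w t.
Proof.
by case=> dw _; apply: (cvg_right_of_derive (d := 'D_1 w t)); apply: deriv_atP.
Qed.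

(** For the last conclusion, [u t] is the image under the flow over an arbitrarily long time of
    another point of the bounded range of [u]. Hence it is arbitrarily close to the attractor, which
    is closed. *)
Theorem semigroup_attractor : exists S Att,
  [/\ generates_semigroup A DA F S, global_attractor S Att &
   forall u, (forall t, solution_at A DA F u t) -> Defs.bounded_set (range u) ->
     forall t, Att (u t)].
Proof.
have lunb := lam_unbounded ipP Asa Acpt lam0 lam_mono eP Ae.
have /choice[U UP] : forall u0, exists u, duhamel ip lam e F u0 u u.
  by move=> u0; apply: (mild_exists ipP lam0 lam_mono lunb eP L0 FL FB).
pose S t u0 := U u0 t.
have U0 u0 : U u0 0 = u0 by have [_ -> //] := UP u0.
have Ucvg u0 : S x u0 @[x --> 0^'+] --> u0.
  by rewrite -{2}(U0 u0); have [cU _ _] := UP u0; apply: cvg_at_right_filter; exact: cU.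
have Usol u0 t : 0 < t -> solution_at A DA F (fun s => S s u0) t.
  by move=> t0; have [] := mild_strong ipP Asa Acpt lam0 lam_mono eP Ae L0 FL FB (UP u0) t0.
have gen : generates_semigroup A DA F S.
  move=> u0; split; [exact: U0|split; [exact: Ucvg|split; [exact: Usol|]]].
  move=> w w0 wc ws t t0; apply: (@solution_unique w (fun s => S s u0) 0 t) => //.
  - by rewrite /S U0.
  - by rewrite w0.
  - by rewrite {2}/S U0.
  - by move=> s /andP[s0 _]; exact: ws.
  - by move=> s /andP[s0 _]; exact: Usol.
have SD (t s : R) u0 : 0 <= t -> 0 <= s -> S (t + s) u0 = S t (S s u0).
  move=> t0 s0; have [_ [_ [_ uni]]] := gen (S s u0).
  apply: (uni (fun r => S (r + s) u0)) => //; first by rewrite add0r.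
    have [s00|s_gt] := eqVneq s 0.
      by rewrite s00 {2}/S U0; under eq_fun do rewrite addr0; exact: Ucvg.
    have sp : 0 < s by rewrite lt_neqAle eq_sym s_gt.
    have := solution_right_cvg (@solution_shift (fun r => S r u0) s 0 _).
    by rewrite add0r; apply; exact: Usol.
  by move=> r r0; apply: (@solution_shift (fun r => S r u0)); apply: Usol; apply: ltr_wpDr.
have SLip t u0 v0 : 0 <= t -> `|S t u0 - S t v0| <= expR (L * t) * `|u0 - v0|.
  move=> t0; have := @solution_gronwall (fun s => S s u0) (fun s => S s v0) 0 t t0.
  rewrite subr0 /S !U0; apply; [exact: Ucvg|exact: Ucvg| |].
  - by move=> s /andP[s0 _]; exact: Usol.
  - by move=> s /andP[s0 _]; exact: Usol.
have Scont (t : R) : 0 <= t -> continuous (S t).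
  move=> t0 u0; apply/cvgrPdist_le => eps eps0.
  have eL := expR_gt0 (L * t).
  have : \forall v \near u0, `|u0 - v| <= eps / expR (L * t).
    by move/cvgrPdist_le: (@cvg_id _ (nbhs u0)) => /(_ _ (divr_gt0 eps0 eL)).
  by apply: filterS => v uv; rewrite (le_trans (SLip _ _ _ t0)) // mulrC -ler_pdivlMr.
have norm2 u0 t : 0 <= t -> `|S t u0| ^+ 2 <= `|u0| ^+ 2 * expR (- (lam 0 * t)) + BF ^+ 2 / lam 0 ^+ 2.
  by move=> t0; exact: (duhamel_norm ipP lam0 lam_mono eP FB (UP u0)).
pose M0 := 1 + BF ^+ 2 / lam 0 ^+ 2.
have M00 : 0 <= BF ^+ 2 / lam 0 ^+ 2 by rewrite divr_ge0 ?sqr_ge0.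
(* [K] contains every state reached one unit of time after being in the ball of squared radius
   [M0]. *)
have [K [Kc KA]] := A_le_compact Acpt (BF + Num.sqrt (rate_bound lam L BF M0 1)).
have Kabs B : Defs.bounded_set B -> exists2 T : R, 0 <= T & forall (t : R) b, T <= t -> B b -> K (S t b).
  (* After time [M ^+ 2 / lam 0] the inequality [1 + x <= expR x] brings the contribution of the
     initial value below 1; the additional unit of time is spent on smoothing. *)
  move=> [M MB]; exists ((`|M| ^+ 2) / lam 0 + 1); first by rewrite addr_ge0 ?divr_ge0 ?sqr_ge0 // ltW.
  move=> t b tT Bb.
  have t1 : 0 <= t - 1 by rewrite subr_ge0; apply: le_trans tT; rewrite lerDr divr_ge0 ?sqr_ge0 // ltW.
  have bM : `|b| ^+ 2 <= `|M| ^+ 2 by rewrite ler_sqr ?nnegrE // (le_trans (MB _ Bb)) // ler_norm.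
  have small : `|S (t - 1) b| ^+ 2 <= M0.
    apply: le_trans (norm2 _ _ t1) _; rewrite lerD2r expRN ler_pdivrMr ?expR_gt0 // mul1r.
    apply: le_trans bM _; apply: le_trans (expR_ge1Dx _).
    rewrite ler_wpDl // -ler_pdivrMl // mulrC lerBrDr //.
  have -> : S t b = S 1 (S (t - 1) b) by rewrite -SD // addrC subrK.
  have [[_ [D1 _]] A1] := mild_strong ipP Asa Acpt lam0 lam_mono eP Ae L0 FL FB (UP (S (t - 1) b)) ltr01.
  apply: KA => //; apply: le_trans A1 _; rewrite lerD2l; apply: ler_wsqrtr.
  by rewrite ler_wpM2r ?expR_ge0 // ler_wpM2l ?divr_ge0 ?sqr_ge0 // lerD2r.
exists S, (omega_limit S K).
have att := omega_limit_attractor SD Scont Kc Kabs.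
split => // u us [M uM] t; have [attc [_ attr]] := att.
apply: (compact_closed (@norm_hausdorff _ V) attc) => W /nbhs_ballP[eps /= eps0 Weps].
have [T TP] := attr (range u) (ex_intro _ M uM) eps eps0.
have TT : T <= Num.max T 0 by rewrite le_max lexx.
have [a [oa ua]] : exists a, omega_limit S K a /\ `|S (Num.max T 0) (u (t - Num.max T 0)) - a| < eps.
  by apply: (TP _ TT); exists (t - Num.max T 0).
exists a; split => //; apply: Weps; rewrite -ball_normE /ball_ /=.
have T0 : 0 <= Num.max T 0 by rewrite le_max lexx orbT.
have [_ [_ [_ uni]]] := gen (u (t - Num.max T 0)).
have E : u (Num.max T 0 + (t - Num.max T 0)) = S (Num.max T 0) (u (t - Num.max T 0)).
  apply: (uni (fun r => u (r + (t - Num.max T 0)))) => //.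
  - by rewrite add0r.
  - by have := solution_right_cvg (@solution_shift u (t - Num.max T 0) 0 (us _)); rewrite add0r.
  - by move=> r _; apply: solution_shift.
by rewrite -E (addrC (Num.max T 0)) subrK in ua.
Qed.

End Semigroup.

(** * Smooth cut-off functions *)

Section SmoothReal.
Context {R : realType}.

(* [flat 0] is the classical flat function exp(-1/x); the family is closed under derivation. *)
Definition flat (k : nat) (x : R) : R :=
  if 0 < x then x^-1 ^+ k * expR (- x^-1) else 0.

Lemma flat_ge0 k x : 0 <= flat k x.
Proof.
rewrite /flat; case: ifP => // x0.
by rewrite mulr_ge0 ?expR_ge0 // exprn_ge0 // invr_ge0 ltW.
Qed.

(** The exponential dominates its Taylor term of order [k.+1]. Linear decay suffices: the difference
    quotient of [flat k] at 0 is [flat k.+1], so its convergence to 0 settles differentiability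
    there. *)
Lemma flat_le k x : 0 < x -> flat k x <= k.+1`!%:R * x.
Proof.
move=> x0; have y0 : 0 < x^-1 by rewrite invr_gt0.
rewrite /flat x0; have := expR_ge1Dxn k (ltW y0) => H.
have f0 : 0 < k.+1`!%:R :> R by rewrite ltr0n fact_gt0.
rewrite expRN ler_pdivrMr ?expR_gt0 //.
have -> : x^-1 ^+ k = k.+1`!%:R * x * (x^-1 ^+ k.+1 / k.+1`!%:R).
  by rewrite exprS; field; rewrite !gt_eqF // exprn_gt0.
rewrite ler_wpM2l ?mulr_ge0 // ?(ltW x0) //.
by apply: le_trans H; rewrite lerDr.
Qed.

Lemma flat_eq0 k x : x <= 0 -> flat k x = 0.
Proof. by rewrite /flat ltNge => ->. Qed.

Lemma flat_gt0 k x : 0 < x -> 0 < flat k x.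
Proof. by rewrite /flat => x0; rewrite x0 mulr_gt0 ?expR_gt0 // exprn_gt0 // invr_gt0. Qed.

Lemma deriv_at_flat k x : deriv_at (flat k) x (flat k.+2 x - k%:R * flat k.+1 x).
Proof.
have [x0|x0|->] := ltgtP x 0.
- rewrite !flat_eq0 ?(ltW x0) // mulr0 subr0.
  apply: deriv_at_near (deriv_at_cst 0 x).
  by apply: filterS (lt_nbhsl x0) => y y0; rewrite flat_eq0 ?ltW.
- apply: (@deriv_at_near _ _ (fun y => y^-1 ^+ k * expR (- y^-1))).
    by apply: filterS (lt_nbhsr x0) => y y0; rewrite /flat y0.
  have xn0 : x != 0 by rewrite gt_eqF.
  have di : deriv_at (fun y : R => y^-1) x (- x ^- 2 * 1).
    by apply: deriv_at_inv => //; exact: deriv_at_id.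
  apply: deriv_at_eq; first by dauto.
  rewrite /flat x0; cbv beta; case: k => [|k] /=.
    by rewrite !mul0r !expr0 exprVn; ring.
  by rewrite !exprVn !exprS; field; rewrite xn0 expf_neq0.
- rewrite !flat_eq0 // mulr0 subr0.
  have lim0 : (fun h : R => h^-1 *: ((flat k \o shift 0) (h *: (1:R)) - flat k 0)) @ 0^' --> (0:R).
    rewrite [X in X @ _](_ : _ = (fun h : R => flat k.+1 h)); last first.
      apply/funext => h /=; rewrite /GRing.scale /= mulr1 addr0 [flat k 0]flat_eq0 // subr0.
      rewrite /flat; case: ifP => _; last by rewrite mulr0.
      by rewrite exprS mulrA.
    apply/cvgrPdist_le => eps eps0; apply: nbhs_dnbhs.
    have f0 : 0 < k.+2`!%:R :> R by rewrite ltr0n fact_gt0.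
    exists (eps / k.+2`!%:R); first by rewrite /= divr_gt0.
    move=> h /=; rewrite !sub0r !normrN => hlt; rewrite ger0_norm ?flat_ge0 //.
    have [h0|h0] := ltP 0 h; last by rewrite flat_eq0 // ltW.
    apply: le_trans (flat_le _ h0) _; rewrite mulrC -ler_pdivlMr //.
    by apply: ltW; apply: le_lt_trans (ler_norm _) hlt.
  apply: deriv_atP; first exact: cvgP lim0.
  exact: cvg_lim lim0.
Qed.

(** Smoothness as membership in a class each of whose members has its derivative in the class;
    iterated derivatives then need no bookkeeping. The last constructor lets cut-offs be defined by
    integration. *)
Inductive smooth1 : (R -> R) -> Prop :=
| smooth1_cst c : smooth1 (fun _ => c)
| smooth1_id : smooth1 (fun x => x)
| smooth1_flat k : smooth1 (flat k)
| smooth1_add f g : smooth1 f -> smooth1 g -> smooth1 (fun x => f x + g x)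
| smooth1_mul f g : smooth1 f -> smooth1 g -> smooth1 (fun x => f x * g x)
| smooth1_comp f g : smooth1 f -> smooth1 g -> smooth1 (fun x => f (g x))
| smooth1_inv f : smooth1 f -> (forall x, f x != 0) -> smooth1 (fun x => (f x)^-1)
| smooth1_prim f g : (forall x, deriv_at f x (g x)) -> smooth1 g -> smooth1 f.

Lemma smooth1_derive f : smooth1 f -> exists2 g, smooth1 g & forall x, deriv_at f x (g x).
Proof.
elim => {f}.
- by move=> c; exists (fun _ => 0); [exact: smooth1_cst|move=> x; exact: deriv_at_cst].
- by exists (fun _ => 1); [exact: smooth1_cst|move=> x; exact: deriv_at_id].
- move=> k; exists (fun x => flat k.+2 x + - k%:R * flat k.+1 x).
    apply: smooth1_add; first exact: smooth1_flat.
    by apply: smooth1_mul; [exact: smooth1_cst|exact: smooth1_flat].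
  by move=> x; apply: deriv_at_eq (deriv_at_flat k x) _; rewrite mulNr.
- move=> f g _ [f' sf df] _ [g' sg dg]; exists (fun x => f' x + g' x); first exact: smooth1_add.
  by move=> x; apply: deriv_at_add.
- move=> f g sf0 [f' sf df] sg0 [g' sg dg]; exists (fun x => f' x * g x + f x * g' x).
    by apply: smooth1_add; apply: smooth1_mul.
  by move=> x; apply: deriv_at_mul.
- move=> f g sf0 [f' sf df] sg0 [g' sg dg]; exists (fun x => f' (g x) * g' x).
    by apply: smooth1_mul => //; apply: smooth1_comp.
  by move=> x; apply: deriv_at_comp.
- move=> f sf0 [f' sf df] f0; exists (fun x => (-1 * ((f x)^-1 * (f x)^-1)) * f' x).
    apply: smooth1_mul => //; apply: smooth1_mul; first exact: smooth1_cst.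
    by apply: smooth1_mul; apply: smooth1_inv.
  move=> x; apply: deriv_at_eq; first exact: (deriv_at_inv (df x) (f0 x)).
  by rewrite mulN1r -invfM expr2.
- by move=> f g fg sg _; exists g.
Qed.

Lemma smooth1_continuous f : smooth1 f -> continuous f.
Proof. by move=> /smooth1_derive[g _ dg] x; exact: deriv_at_continuous (dg x). Qed.

Lemma smooth1_affine a b : smooth1 (fun x => a * x + b).
Proof.
apply: smooth1_add; last exact: smooth1_cst.
by apply: smooth1_mul; [exact: smooth1_cst|exact: smooth1_id].
Qed.

Lemma smooth1_primitive g : smooth1 g -> exists f, [/\ f 0 = 0, smooth1 f & forall x, deriv_at f x (g x)].
Proof.
move=> sg; have [f [f0 df]] := primitive_exists (smooth1_continuous sg).
by exists f; split => //; exact: (smooth1_prim df).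
Qed.

Lemma deriv_ge0_homo (f f' : R -> R) : (forall x, deriv_at f x (f' x)) -> (forall x, 0 <= f' x) ->
  {homo f : x y / x <= y}.
Proof.
move=> df f0 x y xy; apply: (@derive_ge _ f f') => //.
exact: (cvg_right_of_derive (df x)).
Qed.

(** The normalised primitive of the bump [exp(-1/x) exp(-1/(1-x))] supported on the unit
    interval. *)
Lemma smooth_step_exists : exists sig dsig : R -> R,
  [/\ smooth1 sig, smooth1 dsig, forall x, deriv_at sig x (dsig x), forall x, 0 <= dsig x &
   [/\ forall x, x <= 0 -> sig x = 0, forall x, 1 <= x -> sig x = 1,
     forall x, x <= 0 -> dsig x = 0 & forall x, 1 <= x -> dsig x = 0]].
Proof.
pose b x : R := flat 0 x * flat 0 (-1 * x + 1).
have sb : smooth1 b.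
  apply: smooth1_mul; first exact: smooth1_flat.
  exact: (smooth1_comp (smooth1_flat 0) (smooth1_affine (-1) 1)).
have b0 x : 0 <= b x by rewrite mulr_ge0 ?flat_ge0.
have bl x : x <= 0 -> b x = 0 by move=> x0; rewrite /b flat_eq0 // mul0r.
have br x : 1 <= x -> b x = 0 by move=> x1; rewrite /b [flat 0 (_ + _)]flat_eq0 ?mulr0 //; lra.
have [B [B0 sB dB]] := smooth1_primitive sb.
have cB : continuous B := smooth1_continuous sB.
have B1 : 0 < B 1.
  have [|||c] := @MVT R B b 0 1 => //.
  - by move=> x _; exact: dB.
  - exact: continuous_subspaceT.
  rewrite in_itv /= => /andP[c0 c1]; rewrite B0 !subr0 mulr1 => ->.
  by rewrite mulr_gt0 // flat_gt0 //; lra.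
exists (fun x => (B 1)^-1 * B x), (fun x => (B 1)^-1 * b x); split.
- by apply: smooth1_mul => //; exact: smooth1_cst.
- by apply: smooth1_mul => //; exact: smooth1_cst.
- move=> x; apply: deriv_at_eq; first exact: (deriv_at_mul (deriv_at_cst _ _) (dB x)).
  by rewrite mul0r add0r.
- by move=> x; rewrite mulr_ge0 // invr_ge0 ltW.
split.
- move=> x x0; have -> : B x = 0; last by rewrite mulr0.
  rewrite -B0; apply: derive0_eq => // y /andP[_ y0].
  by have := dB y; rewrite bl.
- move=> x x1; have <- : B 1 = B x; last by rewrite mulVf // gt_eqF.
  by apply: derive0_eq => // y /andP[y1 _]; have := dB y; rewrite br.
- by move=> x x0; rewrite bl // mulr0.
- by move=> x x0; rewrite br // mulr0.
Qed.

End SmoothReal.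

Section CutOffs.
Context {R : realType} (sig dsig : R -> R).
Hypothesis sigS : smooth1 sig.
Hypothesis dsigP : forall x, deriv_at sig x (dsig x).
Hypothesis dsig_ge0 : forall x, 0 <= dsig x.
Hypothesis sigl : forall x, x <= 0 -> sig x = 0.
Hypothesis sigr : forall x, 1 <= x -> sig x = 1.

Lemma step_homo : {homo sig : x y / x <= y}.
Proof. exact: deriv_ge0_homo dsigP dsig_ge0. Qed.

Lemma step_itv x : 0 <= sig x <= 1.
Proof.
apply/andP; split.
  rewrite -(sigl (_ : Num.min x 0 <= 0)); first by apply: step_homo; rewrite ge_min lexx.
  by rewrite ge_min lexx orbT.
rewrite -(sigr (_ : 1 <= Num.max x 1)); first by apply: step_homo; rewrite le_max lexx.
by rewrite le_max lexx orbT.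
Qed.

Definition plateau (x : R) := sig (-1 * x + 2) * sig (1 * x + 2).

Lemma plateauS : smooth1 plateau.
Proof. by apply: smooth1_mul; apply: (smooth1_comp sigS); exact: smooth1_affine. Qed.

Lemma plateau_itv x : 0 <= plateau x <= 1.
Proof.
have /andP[a0 a1] := step_itv (-1 * x + 2); have /andP[b0 b1] := step_itv (1 * x + 2).
by rewrite /plateau mulr_ge0 //= mulr_ile1.
Qed.

Lemma plateau1 x : `|x| <= 1 -> plateau x = 1.
Proof. by rewrite ler_norml => /andP[x1 x2]; rewrite /plateau !sigr ?mulr1 //; lra. Qed.

Lemma plateau0 x : 2 <= `|x| -> plateau x = 0.
Proof.
rewrite /plateau ler_normr => /orP[] x2; first by rewrite sigl ?mul0r //; lra.
by rewrite [sig (1 * x + 2)]sigl ?mulr0 //; lra.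
Qed.

(** A primitive of [plateau]: the slope lies between 0 and 1 and vanishes beyond 2, so the values
    saturate at most at 2. *)
Lemma truncation_exists : exists tr : R -> R,
  [/\ smooth1 tr, forall x, deriv_at tr x (plateau x), tr 0 = 0,
      forall x, `|x| <= 1 -> tr x = x & forall x, `|tr x| <= 2].
Proof.
have [tr [tr0 str dtr]] := smooth1_primitive plateauS.
have dle x y : x <= y -> 0 <= tr y - tr x <= y - x.
  move=> xy; apply/andP; split.
    rewrite subr_ge0; apply: (deriv_ge0_homo dtr) => // z; by have /andP[] := plateau_itv z.
  have h z : deriv_at (fun z => z - tr z) z (1 - plateau z).
    exact: (deriv_at_add (deriv_at_id z) (deriv_at_opp (dtr z))).
  have : x - tr x <= y - tr y.
    apply: (deriv_ge0_homo h) => // z; rewrite subr_ge0; by have /andP[] := plateau_itv z.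
  by lra.
have sat x y : x <= y -> (forall z, x <= z <= y -> 2 <= `|z|) -> tr x = tr y.
  by move=> xy z2; apply: derive0_eq => // z zxy; have := dtr z; rewrite plateau0 // z2.
exists tr; split => //.
- move=> x; rewrite ler_norml => /andP[x1 x2].
  have h z : `|z| <= 1 -> deriv_at (fun z => z - tr z) z 0.
    move=> z1; apply: deriv_at_eq; first exact: (deriv_at_add (deriv_at_id z) (deriv_at_opp (dtr z))).
    by rewrite plateau1 // subrr.
  apply/eqP; rewrite eq_sym -subr_eq0; apply/eqP; transitivity (0 - tr 0); last by rewrite tr0 subr0.
  have [x0|x0] := leP x 0.
    by apply: (@derive0_eq _ (fun z => z - tr z)) => // z /andP[z1 z2]; apply: h; rewrite ler_norml; lra.
  by apply/esym/(@derive0_eq _ (fun z => z - tr z)) => [|z /andP[z1 z2]]; [exact: ltW|apply: h; rewrite ler_norml; lra].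
- move=> x; rewrite ler_norml.
  have [x2|x2] := leP x 2; last first.
    have <- : tr 2 = tr x by apply: sat => [|z /andP[z1 _]]; [exact: ltW|rewrite ger0_norm //; lra].
    have /andP[a1 a2] := dle 0 2 (ler0n _ _); rewrite tr0 in a1 a2; lra.
  have [x2'|x2'] := leP (-2) x; last first.
    have -> : tr x = tr (-2) by apply: sat => [|z /andP[_ z1]]; [exact: ltW|rewrite ler0_norm //; lra].
    have le20 : -2 <= 0 :> R by lra.
    have /andP[a1 a2] := dle _ _ le20; rewrite tr0 in a1 a2; lra.
  have [x0|x0] := leP x 0.
    have /andP[a1 a2] := dle _ _ x0; rewrite tr0 in a1 a2; lra.
  have /andP[a1 a2] := dle _ _ (ltW x0); rewrite tr0 in a1 a2; lra.
Qed.

(* [r |-> r * chi (r ^+ 2)] is a bounded 1-Lipschitz smoothing of the truncation at height 1. *)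
Lemma radial_cutoff_exists : exists chi : R -> R,
  [/\ smooth1 chi, forall x, x <= 1 -> chi x = 1, forall x, 0 < chi x <= 1,
    forall r, 0 <= r -> r * chi (r ^+ 2) <= 2 &
    forall r r', 0 <= r -> r <= r' -> `|r' * chi (r' ^+ 2) - r * chi (r ^+ 2)| <= r' - r].
Proof.
pose h' x := 1 / 2 * sig (1 * x + -1).
have sh' : smooth1 h'.
  by apply: smooth1_mul; [exact: smooth1_cst|apply: smooth1_comp => //; exact: smooth1_affine].
have [h0 [h00 sh0 dh]] := smooth1_primitive sh'.
have h'_ge0 x : 0 <= h' x by rewrite mulr_ge0 //; have /andP[] := step_itv (1 * x + -1).
have h'_le x : h' x <= 1 / 2 by have /andP[_] := step_itv (1 * x + -1); rewrite /h'; lra.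
have hmono := deriv_ge0_homo dh h'_ge0.
have hz x : x <= 1 -> h0 x = 0.
  have z y : y <= 1 -> h' y = 0 by move=> y1; rewrite /h' sigl ?mulr0 //; lra.
  move=> x1; rewrite -h00; have [x0|x0] := leP x 0.
    by apply: derive0_eq => // y /andP[_ y0]; have := dh y; rewrite z //; lra.
  by apply/esym; apply: derive0_eq; [exact: ltW|move=> y /andP[_ y0]; have := dh y; rewrite z //; lra].
have hge x : 0 <= h0 x.
  by have [x1|x1] := leP x 1; [rewrite hz|rewrite -(hz 1) // hmono // ltW].
have hlin x : 2 <= x -> x / 2 - 1 <= h0 x.
  move=> x2; have d y : deriv_at (fun y => h0 y - 1 / 2 * y) y (h' y - 1 / 2).
    by have dy := dh y; apply: deriv_at_eq; [dauto|cbv beta; ring].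
  have : h0 2 - 1 / 2 * 2 <= h0 x - 1 / 2 * x.
    apply: (@derive_ge _ (fun y => h0 y - 1 / 2 * y) (fun y => h' y - 1 / 2)) => //.
      exact: (cvg_right_of_derive (d 2)).
    by move=> y /andP[y2 _]; rewrite /h' sigr; lra.
  by have := hge 2; lra.
(* This keeps the derivative of [r * chi (r ^+ 2)] above -1; the upper bound 1 only needs [h'] to be
   nonnegative. *)
have h'h x : x * h' x <= h0 x + 1.
  have [x2|x2] := leP 2 x; first by have := hlin x x2; have := h'_le x; nra.
  have [x0|x0] := leP 0 x; first by have := hge x; have := h'_le x; nra.
  by have := hge x; have := h'_ge0 x; nra.
pose chi x := (1 + h0 x)^-1.
have p1 x : 0 < 1 + h0 x by have := hge x; lra.
exists chi; split.
- apply: smooth1_inv => [|x]; last by rewrite gt_eqF.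
  by apply: smooth1_add => //; exact: smooth1_cst.
- by move=> x x1; rewrite /chi hz // addr0 invr1.
- by move=> x; rewrite /chi invr_gt0 p1 invf_le1 //=; have := hge x; lra.
- move=> r r0; rewrite /chi ler_pdivrMr //.
  have [r2|r2] := leP (r ^+ 2) 2; first by have := hge (r ^+ 2); nra.
  by have := hlin (r ^+ 2) (ltW r2); nra.
- pose g r := r * chi (r ^+ 2).
  pose g' (r : R) := (1 + h0 (r ^+ 2) - 2 * (r ^+ 2 * h' (r ^+ 2))) / (1 + h0 (r ^+ 2)) ^+ 2.
  have dg r : deriv_at g r (g' r).
    have d1 : deriv_at (fun r : R => 1 + h0 (r ^+ 2)) r (0 + h' (r ^+ 2) * (2%:R * r ^+ 1 * 1)).
      apply: deriv_at_add; first exact: deriv_at_cst.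
      exact: (deriv_at_comp (deriv_at_exp 2 (deriv_at_id r)) (dh _)).
    have d2 := deriv_at_mul (deriv_at_id r) (deriv_at_inv d1 (lt0r_neq0 (p1 (r ^+ 2)))).
    apply: deriv_at_eq; first exact: d2.
    by rewrite /g' expr1; field; rewrite gt_eqF.
  have g1 r : -1 <= g' r <= 1.
    have P := p1 (r ^+ 2); have H := hge (r ^+ 2); have H1 := h'h (r ^+ 2).
    have H2 : 0 <= r ^+ 2 * h' (r ^+ 2) by rewrite mulr_ge0 ?sqr_ge0.
    rewrite /g' ler_pdivlMr ?exprn_gt0 // ler_pdivrMr ?exprn_gt0 //.
    by apply/andP; split; nra.
  move=> r r' r0 rr'; rewrite -/(g r) -/(g r') ler_norml; apply/andP; split.
    have d x : deriv_at (fun x => g x + x) x (g' x + 1) by apply: deriv_at_add => //; exact: deriv_at_id.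
    have : g r + r <= g r' + r'.
      by apply: (deriv_ge0_homo d) => // x; have /andP[] := g1 x; lra.
    by lra.
  have d x : deriv_at (fun x => x - g x) x (1 - g' x).
    by apply: deriv_at_add; [exact: deriv_at_id|exact: deriv_at_opp].
  have : r - g r <= r' - g r'.
    by apply: (deriv_ge0_homo d) => // x; have /andP[] := g1 x; lra.
  by lra.
Qed.

Lemma smooth_inverse_exists : exists iota : R -> R,
  smooth1 iota /\ forall x, 1 / 2 <= x -> iota x = x^-1.
Proof.
pose s x := sig (4 * x + -1).
have ss : smooth1 s by apply: smooth1_comp => //; exact: smooth1_affine.
pose D x := x * s x + (1 + -1 * s x).
exists (fun x => (D x)^-1); split.
  apply: smooth1_inv.
    apply: smooth1_add; first by apply: smooth1_mul => //; exact: smooth1_id.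
    by apply: smooth1_add; [exact: smooth1_cst|apply: smooth1_mul => //; exact: smooth1_cst].
  move=> x; rewrite gt_eqF // /D.
  have /andP[s0 s1] := step_itv (4 * x + -1); rewrite -/(s x) in s0 s1.
  have [x4|x4] := leP x (1 / 4); last by nra.
  by have -> : s x = 0; [rewrite /s sigl //; lra|lra].
move=> x x2; congr (_^-1); rewrite /D.
by have -> : s x = 1; [rewrite /s sigr //; lra|ring].
Qed.

End CutOffs.

(** * Smooth and Lipschitz maps *)

Section SmoothMaps.
Context {R : realType} {V : completeNormedModType R} (ip : V -> V -> R).
Hypothesis ipP : inner_product ip.

Lemma deriv_at_scalev (f : R -> R) (g : R -> V) x a b : deriv_at f x a -> deriv_at g x b ->
  deriv_at (fun t => f t *: g t) x (a *: g x + f x *: b).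
Proof.
move=> df dg; have gc := deriv_at_continuous dg.
case: df => df fE; case: dg => dg gE.
have lim_ : (fun h : R => h^-1 *: (((fun t => f t *: g t) \o shift x) (h *: (1 : R)) - f x *: g x)) @ 0^'
    --> a *: g x + f x *: b.
  rewrite [X in X @ _](_ : _ = (fun h : R =>
     (h^-1 *: ((f \o shift x) (h *: (1 : R)) - f x)) *: ((g \o shift x) (h *: (1 : R))) +
     f x *: (h^-1 *: ((g \o shift x) (h *: (1 : R)) - g x)))); last first.
    apply/funext => h /=; set y := g _; set z := f (_ + _).
    have -> : h^-1 *: (z - f x) *: y = h^-1 *: ((z - f x) *: y) by rewrite scalerA.
    have -> : f x *: (h^-1 *: (y - g x)) = h^-1 *: (f x *: (y - g x)).
      by rewrite !scalerA mulrC.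
    by rewrite -scalerDr; congr (_ *: _); rewrite scalerBl scalerBr subrKA.
  apply: cvgD; last by apply: cvgZl_tmp; move: dg; rewrite /derivable -gE.
  apply: cvgZ; first by move: df; rewrite /derivable -fE.
  have sx : (fun h : R => h *: (1:R) + x) @ 0^' --> x.
    rewrite -[X in _ --> X](add0r x); apply: cvgD; last exact: cvg_cst.
    rewrite /GRing.scale /=; under eq_fun do rewrite mulr1.
    exact: nbhs_dnbhs.
  exact: (cvg_comp _ _ sx gc).
apply: deriv_atP; first exact: cvgP lim_.
exact: cvg_lim lim_.
Qed.

Definition bounded_linear (T : V -> V) : Prop :=
  (forall (a : R) u v, T (a *: u + v) = a *: T u + T v) /\ exists M : R, forall u, `|T u| <= M * `|u|.

Lemma bounded_linearB T u v : bounded_linear T -> T (u - v) = T u - T v.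
Proof. by case=> Tl _; rewrite addrC -[- v]scaleN1r Tl scaleN1r addrC. Qed.

Lemma bounded_linearZ T a u : bounded_linear T -> T (a *: u) = a *: T u.
Proof.
case=> Tl _; have T0 : T 0 = 0.
  by have := Tl 1 0 0; rewrite !scale1r addr0 -{1}[T 0]addr0 => /addrI.
by rewrite -[a *: u]addr0 Tl T0 addr0.
Qed.

Lemma bounded_linear_continuous T : bounded_linear T -> continuous T.
Proof.
move=> Tb x; apply/cvgrPdist_le => eps eps0; have [_ [M TM]] := Tb.
have M1 : 0 < `|M| + 1 by rewrite ltr_wpDl.
have : \forall y \near x, `|x - y| <= eps / (`|M| + 1).
  by move/cvgrPdist_le: (@cvg_id _ (nbhs x)) => /(_ _ (divr_gt0 eps0 M1)).
apply: filterS => y xy.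
rewrite -(@bounded_linearB T) //; apply: le_trans (TM _) _; rewrite ler_pdivlMr // mulrC in xy.
by apply: le_trans xy; rewrite ler_wpM2r // (le_trans (ler_norm _)) // lerDl.
Qed.

Lemma deriv_at_linear (T : V -> V) (g : R -> V) x a : bounded_linear T -> deriv_at g x a ->
  deriv_at (fun t => T (g t)) x (T a).
Proof.
move=> Tb [dg gE]; have cT := bounded_linear_continuous Tb.
have lim_ : (fun h : R => h^-1 *: (((fun t => T (g t)) \o shift x) (h *: (1 : R)) - T (g x))) @ 0^' --> T a.
  rewrite [X in X @ _](_ : _ = (fun h => T (h^-1 *: ((g \o shift x) (h *: (1 : R)) - g x)))); last first.
    by apply/funext => h /=; rewrite (@bounded_linearZ T) // (@bounded_linearB T).
  have dl : (fun h : R => h^-1 *: ((g \o shift x) (h *: (1 : R)) - g x)) @ 0^' --> a.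
    by rewrite -gE; exact: dg.
  exact: (cvg_comp _ _ dl (@cT a)).
apply: deriv_atP; first exact: cvgP lim_.
exact: cvg_lim lim_.
Qed.

(* Functions of a point and of the directions [vs 0, .., vs (N - 1)], closed under
   derivation of the point in any direction. *)
Inductive smooth_scalar (N : nat) : (V -> (nat -> V) -> R) -> Prop :=
| smooth_scalar_cst c : smooth_scalar N (fun _ _ => c)
| smooth_scalar_pt a : smooth_scalar N (fun x _ => ip x a)
| smooth_scalar_dir a i : (i < N)%N -> smooth_scalar N (fun _ vs => ip (vs i) a)
| smooth_scalar_quad : smooth_scalar N (fun x _ => ip x x)
| smooth_scalar_quadl i : (i < N)%N -> smooth_scalar N (fun x vs => ip x (vs i))
| smooth_scalar_dirs i j : (i < N)%N -> (j < N)%N -> smooth_scalar N (fun _ vs => ip (vs i) (vs j))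
| smooth_scalar_add f g : smooth_scalar N f -> smooth_scalar N g ->
    smooth_scalar N (fun x vs => f x vs + g x vs)
| smooth_scalar_mul f g : smooth_scalar N f -> smooth_scalar N g ->
    smooth_scalar N (fun x vs => f x vs * g x vs)
| smooth_scalar_comp p f : smooth1 p -> smooth_scalar N f ->
    smooth_scalar N (fun x vs => p (f x vs)).

Inductive smooth_vector (N : nat) : (V -> (nat -> V) -> V) -> Prop :=
| smooth_vector_pt : smooth_vector N (fun x _ => x)
| smooth_vector_dir i : (i < N)%N -> smooth_vector N (fun _ vs => vs i)
| smooth_vector_lin T f : bounded_linear T -> smooth_vector N f ->
    smooth_vector N (fun x vs => T (f x vs))
| smooth_vector_cst v : smooth_vector N (fun _ _ => v)
| smooth_vector_add f g : smooth_vector N f -> smooth_vector N g ->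
    smooth_vector N (fun x vs => f x vs + g x vs)
| smooth_vector_scale f g : smooth_scalar N f -> smooth_vector N g ->
    smooth_vector N (fun x vs => f x vs *: g x vs).

Lemma smooth_scalarW M N f : (M <= N)%N -> smooth_scalar M f -> smooth_scalar N f.
Proof.
move=> MN; elim=> {f}; try by constructor.
- by move=> a i iM; constructor; exact: leq_trans MN.
- by move=> i iM; constructor; exact: leq_trans MN.
- by move=> i j iM jM; constructor; apply: leq_trans MN.
Qed.

Lemma smooth_vectorW M N f : (M <= N)%N -> smooth_vector M f -> smooth_vector N f.
Proof.
move=> MN; elim=> {f}; try by constructor.
- by move=> i iM; constructor; exact: leq_trans MN.
- by move=> f g sf _ sg; constructor => //; exact: smooth_scalarW sf.
Qed.

Lemma deriv_at_line (a b v x : V) : deriv_at (fun h : R => ip (h *: v + x) a) 0 (ip v a).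
Proof.
under eq_fun do rewrite (ipDl ipP) (ipZl ipP).
by apply: deriv_at_eq; [dauto|cbv beta; ring].
Qed.

Lemma smooth_scalar_derive N k f : (k < N)%N -> smooth_scalar N f ->
  exists2 g, smooth_scalar N g &
  forall x vs, deriv_at (fun h : R => f (h *: vs k + x) vs) 0 (g x vs).
Proof.
move=> kN; elim=> {f}.
- by move=> c; exists (fun _ _ => 0); [constructor|move=> x vs; exact: deriv_at_cst].
- move=> a; exists (fun _ vs => ip (vs k) a); first by constructor.
  by move=> x vs; exact: deriv_at_line.
- by move=> a i iN; exists (fun _ _ => 0); [constructor|move=> x vs; exact: deriv_at_cst].
- exists (fun x vs => 2 * ip x (vs k)); first by do 2?constructor.
  move=> x vs; have E h : ip (h *: vs k + x) (h *: vs k + x) =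
      h * h * ip (vs k) (vs k) + h * (2 * ip x (vs k)) + ip x x.
    by rewrite !(ipDl ipP) !(ipDr ipP) !(ipZl ipP) !(ipZr ipP) (ipC ipP (vs k) x); ring.
  by under eq_fun do rewrite E; apply: deriv_at_eq; [dauto|cbv beta; ring].
- move=> i iN; exists (fun _ vs => ip (vs k) (vs i)); first by constructor.
  by move=> x vs; exact: deriv_at_line.
- by move=> i j iN jN; exists (fun _ _ => 0); [constructor|move=> x vs; exact: deriv_at_cst].
- move=> f g _ [f' sf df] _ [g' sg dg]; exists (fun x vs => f' x vs + g' x vs); first by constructor.
  by move=> x vs; exact: deriv_at_add.
- move=> f g sf0 [f' sf df] sg0 [g' sg dg].
  exists (fun x vs => f' x vs * g x vs + f x vs * g' x vs); first by do 2!constructor.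
  move=> x vs; apply: deriv_at_eq; first exact: deriv_at_mul.
  by cbv beta; rewrite scale0r add0r.
- move=> p f sp sf0 [f' sf df]; have [p' sp' dp] := smooth1_derive sp.
  exists (fun x vs => p' (f x vs) * f' x vs); first by do 2?constructor.
  move=> x vs; apply: deriv_at_eq; first exact: (deriv_at_comp (df x vs) (dp _)).
  by cbv beta; rewrite scale0r add0r.
Qed.

Lemma smooth_vector_derive N k f : (k < N)%N -> smooth_vector N f ->
  exists2 g, smooth_vector N g &
  forall x vs, deriv_at (fun h : R => f (h *: vs k + x) vs) 0 (g x vs).
Proof.
move=> kN; elim=> {f}.
- exists (fun _ vs => vs k); first by constructor.
  by move=> x vs; apply: deriv_at_eq; [dauto|rewrite scale1r addr0].
- by move=> i iN; exists (fun _ _ => 0); [constructor|move=> x vs; exact: deriv_at_cst].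
- move=> T f Tb _ [f' sf df]; exists (fun x vs => T (f' x vs)); first by constructor.
  by move=> x vs; exact: deriv_at_linear.
- by move=> v; exists (fun _ _ => 0); [constructor|move=> x vs; exact: deriv_at_cst].
- move=> f g _ [f' sf df] _ [g' sg dg]; exists (fun x vs => f' x vs + g' x vs); first by constructor.
  by move=> x vs; exact: deriv_at_add.
- move=> f g sf0 sg0 [g' sg dg]; have [f' sf df] := smooth_scalar_derive kN sf0.
  exists (fun x vs => f' x vs *: g x vs + f x vs *: g' x vs); first by do 2!constructor.
  move=> x vs; apply: deriv_at_eq; first exact: deriv_at_scalev.
  by cbv beta; rewrite scale0r add0r.
Qed.

(** Only the first [N] directions are constrained, in accordance with the continuity clause of
    [smooth]. *)
Definition jet_ball (N : nat) (x : V) (vs : nat -> V) (d : R) : set (V * (nat -> V)) :=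
  [set p | `|p.1 - x| < d /\ forall i, (i < N)%N -> `|p.2 i - vs i| < d].

Definition jet_nbhs N x vs : set_system (V * (nat -> V)) :=
  filter_from [set d : R | 0 < d] (jet_ball N x vs).

Lemma jet_nbhs_filter N x vs : Filter (jet_nbhs N x vs).
Proof.
apply: filter_from_filter; first by exists 1; exact: ltr01.
move=> a b /= a0 b0; exists (Num.min a b); first by rewrite /= lt_min a0.
move=> p [p1 p2]; move: p1; rewrite lt_min => /andP[pa pb].
by split; split => // i iN; have := p2 i iN; rewrite lt_min => /andP[].
Qed.

Lemma jet_nbhs_pt N x vs : (fun p : V * (nat -> V) => p.1) @ jet_nbhs N x vs --> x.
Proof.
have FF := jet_nbhs_filter N x vs.
apply/cvgrPdist_lt => eps eps0; exists eps => // p [p1 _] /=.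
by rewrite distrC.
Qed.

Lemma jet_nbhs_dir N x vs i : (i < N)%N -> (fun p : V * (nat -> V) => p.2 i) @ jet_nbhs N x vs --> vs i.
Proof.
move=> iN; have FF := jet_nbhs_filter N x vs.
apply/cvgrPdist_lt => eps eps0; exists eps => // p [_ p2] /=.
by rewrite distrC p2.
Qed.

Lemma smooth_scalar_cvg N f x vs : smooth_scalar N f ->
  (fun p => f p.1 p.2) @ jet_nbhs N x vs --> f x vs.
Proof.
have FF := jet_nbhs_filter N x vs.
elim=> {f}.
- by move=> c; exact: cvg_cst.
- by move=> a; apply: (ip_cvgl ipP); exact: jet_nbhs_pt.
- by move=> a i iN; apply: (ip_cvgl ipP); exact: jet_nbhs_dir.
- by apply: (ip_cvg ipP); exact: jet_nbhs_pt.
- by move=> i iN; apply: (ip_cvg ipP); [exact: jet_nbhs_pt|exact: jet_nbhs_dir].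
- by move=> i j iN jN; apply: (ip_cvg ipP); exact: jet_nbhs_dir.
- by move=> f g _ fc _ gc; apply: cvgD.
- by move=> f g _ fc _ gc; apply: cvgM.
- move=> p f /smooth1_continuous cp _ fc.
  exact: (cvg_comp _ _ fc (cp _)).
Qed.

Lemma smooth_vector_cvg N f x vs : smooth_vector N f ->
  (fun p => f p.1 p.2) @ jet_nbhs N x vs --> f x vs.
Proof.
have FF := jet_nbhs_filter N x vs.
elim=> {f}.
- exact: (@jet_nbhs_pt N x vs).
- by move=> i iN; exact: (@jet_nbhs_dir N x vs i iN).
- move=> T f Tb _ fc; apply: (cvg_comp _ _ fc); exact: bounded_linear_continuous.
- by move=> v; exact: cvg_cst.
- by move=> f g _ fc _ gc; apply: cvgD.
- by move=> f g sf sg gc; apply: cvgZ => //; exact: smooth_scalar_cvg.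
Qed.

Lemma derive_line (f : V -> V) x v : 'D_v f x = 'D_1 (fun h : R => f (h *: v + x)) 0.
Proof.
have E : (fun h : R => h^-1 *: ((f \o shift x) (h *: v) - f x)) =
    (fun h : R => h^-1 *: (((fun t : R => f (t *: v + x)) \o shift 0) (h *: (1 : R)) - f (0 *: v + x))).
  by apply/funext => h /=; rewrite scale0r add0r addr0 [h *: 1]/GRing.scale /= mulr1.
by rewrite /derive E.
Qed.

(** By induction the [k]-th iterated derivative belongs to the class with [k] directions. Adding one
    direction makes it derivable along that direction, and every member of the class is jointly
    continuous. *)
Theorem smooth_of_vector F : smooth_vector 0 (fun x _ => F x) -> smooth F.
Proof.
move=> sF.
have H k : smooth_vector k (fun x vs => iter_dd F k vs x) /\
    forall vs x, derivable (iter_dd F k vs) x (vs k).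
  elim: k => [|k [IH _]].
    split => // vs x; have [g _ dg] := smooth_vector_derive (ltnSn 0) (smooth_vectorW (leqnSn 0) sF).
    by apply/derivable1P; case: (dg x vs).
  have [g sg dg] := smooth_vector_derive (ltnSn k) (smooth_vectorW (leqnSn k) IH).
  have gE vs x : iter_dd F k.+1 vs x = g x vs.
    by have [_ <-] := dg x vs; rewrite /= derive_line.
  have sk : smooth_vector k.+1 (fun x vs => iter_dd F k.+1 vs x).
    by rewrite (_ : (fun x vs => _) = g) //; apply/funext => x; apply/funext => vs.
  split => // vs x.
  have [g' _ dg'] := smooth_vector_derive (ltnSn k.+1) (smooth_vectorW (leqnSn k.+1) sk).
  by apply/derivable1P; case: (dg' x vs).
split; first by move=> k vs x; exact: (H k).2.
move=> k vs x eps eps0.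
have FF := jet_nbhs_filter k x vs; have := @smooth_vector_cvg _ _ x vs (H k).1.
move=> /cvgrPdist_lt /(_ eps eps0) [d /= d0 dP].
exists d; split => // y ws yx wv; rewrite distrC.
exact: (dP (y, ws)).
Qed.

End SmoothMaps.

(** * Operators given by their coefficients along an orthonormal family *)

Section Operators.
Context {R : realType} {V : completeNormedModType R} (ip : V -> V -> R) (f : nat -> V).
Hypothesis ipP : inner_product ip.
Hypothesis fP : forall i j, ip (f i) (f j) = (i == j)%:R.

(* [span_closed u]: [u] lies in the closed span of [f]. *)
Definition span_closed (u : V) : Prop := forall w, (forall k, ip w (f k) = 0) -> ip u w = 0.

Lemma span_closed_eq u v : span_closed u -> span_closed v ->
  (forall k, ip u (f k) = ip v (f k)) -> u = v.
Proof.
move=> su sv uv; apply/eqP; rewrite -subr_eq0 -normr_le0.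
have w0 k : ip (u - v) (f k) = 0 by rewrite (ipBl ipP) uv subrr.
have : `|u - v| ^+ 2 = 0 by rewrite -(ipE ipP) {1}(ipBl ipP) su // sv // subr0.
by move=> /eqP; rewrite sqrf_eq0 => /eqP ->.
Qed.

Lemma span_closed_f k : span_closed (f k).
Proof. by move=> w w0; rewrite (ipC ipP). Qed.

Lemma span_closed_lin a u v : span_closed u -> span_closed v -> span_closed (a *: u + v).
Proof. by move=> su sv w w0; rewrite (ipDZl ipP) su // sv // mulr0 addr0. Qed.

Lemma span_closedZ a u : span_closed u -> span_closed (a *: u).
Proof. by move=> su w w0; rewrite (ipZl ipP) su // mulr0. Qed.

(** A weighted permutation of modes: the identity [p] gives the diagonal shifts of eigenvalues, an
    involution the rotations inside pairs. The norm bound is Bessel's inequality for the family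
    [f (p k)], and linearity holds because vectors of the closed span are determined by their
    coefficients. *)
Lemma operator_exists (a : nat -> R) (p : nat -> nat) M : (forall k, `|a k| <= M) -> injective p ->
  exists T : V -> V, [/\ bounded_linear T, forall u, `|T u| <= M * `|u|,
    forall u k, ip (T u) (f k) = a k * ip u (f (p k)) & forall u, span_closed (T u)].
Proof.
move=> aM pI.
have M0 : 0 <= M := le_trans (normr_ge0 _) (aM 0%N).
have fpP i j : ip (f (p i)) (f (p j)) = (i == j)%:R.
  by rewrite fP (inj_eq pI).
have /choice[T TP] : forall u, exists v, [/\ forall k, ip v (f k) = a k * ip u (f (p k)),
    `|v| ^+ 2 <= (M * `|u|) ^+ 2 & span_closed v].
  move=> u; have [|v [_ v1 v2 v3]] := @riesz_fischer R V ip ipP f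
      (fun k => a k * ip u (f (p k))) ((M * `|u|) ^+ 2) fP.
    move=> n; apply: (@le_trans _ _ (M ^+ 2 * \sum_(0 <= k < n) ip u (f (p k)) ^+ 2)).
      rewrite mulr_sumr; apply: ler_sum => k _; rewrite exprMn ler_wpM2r ?sqr_ge0 //.
      by rewrite -[leLHS]real_normK ?num_real // ler_sqr ?nnegrE.
    by rewrite exprMn ler_wpM2l ?sqr_ge0 // (bessel ipP u n fpP).
  by exists v.
have Tn u : `|T u| <= M * `|u|.
  by have [_ h _] := TP u; rewrite -ler_sqr ?nnegrE // mulr_ge0.
exists T; split => //; [split; last by exists M| |]; last 2 first.
- by move=> u k; have [h _ _] := TP u.
- by move=> u; have [_ _ h] := TP u.
move=> b u v; have [hu _ su] := TP u; have [hv _ sv] := TP v; have [huv _ suv] := TP (b *: u + v).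
apply: span_closed_eq => //; first exact: span_closed_lin.
by move=> k; rewrite huv !(ipDZl ipP) hu hv; ring.
Qed.

Lemma operator_basis (a : nat -> R) (p : nat -> nat) (T : V -> V) i j :
  injective p -> (forall u k, ip (T u) (f k) = a k * ip u (f (p k))) ->
  (forall u, span_closed (T u)) -> p i = j -> T (f j) = a i *: f i.
Proof.
move=> pI Tf sT <-; apply: span_closed_eq => //.
  by apply: span_closedZ; exact: span_closed_f.
move=> k; rewrite Tf (ipZl ipP) !fP (inj_eq pI).
by have [->|_] := eqVneq i k; rewrite ?mulr1 ?mulr0.
Qed.

Lemma span_closed_norm (a : nat -> R) M u v : (forall k, `|a k| <= M) -> span_closed v ->
  (forall k, ip v (f k) = a k * ip u (f k)) -> `|v| <= M * `|u|.
Proof.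
move=> aM sv vu; have [T [_ Tn Tf sT]] := @operator_exists a id M aM (@inj_id _).
rewrite (_ : v = T u) //; apply: span_closed_eq => // k.
by rewrite vu Tf.
Qed.

End Operators.

Section RadialCutOff.
Context {R : realType} {V : completeNormedModType R} (ip : V -> V -> R).
Hypothesis ipP : inner_product ip.
Context (chi : R -> R).
Hypothesis chi_itv : forall x, 0 < chi x <= 1.
Hypothesis chi_le2 : forall r, 0 <= r -> r * chi (r ^+ 2) <= 2.
Hypothesis chi_lip : forall r r', 0 <= r -> r <= r' ->
  `|r' * chi (r' ^+ 2) - r * chi (r ^+ 2)| <= r' - r.

(** Squared distances split into a radial part, controlled by [chi_lip], and twice the defect
    [|a| |b| - ip a b], which is nonnegative and gets multiplied by the product of two factors at
    most 1. *)
Lemma radial_lip (a b : V) : `|chi (`|a| ^+ 2) *: a - chi (`|b| ^+ 2) *: b| <= `|a - b|.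
Proof.
wlog ab : a b / `|a| <= `|b|.
  by move=> H; have [/H//|/ltW/H] := leP `|a| `|b|; rewrite distrC [leRHS]distrC.
have /andP[ca0 ca1] := chi_itv (`|a| ^+ 2); have /andP[cb0 cb1] := chi_itv (`|b| ^+ 2).
rewrite -ler_sqr ?nnegrE // !(sqr_normB ipP) !normrZ (ipZl ipP) (ipZr ipP) !gtr0_norm //.
have : (`|b| * chi (`|b| ^+ 2) - `|a| * chi (`|a| ^+ 2)) ^+ 2 <= (`|b| - `|a|) ^+ 2.
  by rewrite -[leLHS]real_normK ?num_real // ler_sqr ?nnegrE ?subr_ge0 // chi_lip.
have := ip_le ipP a b; rewrite ler_norml => /andP[_].
move: (normr_ge0 a) (normr_ge0 b); set x := `|a|; set y := `|b|; set p := ip a b.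
set c := chi (x ^+ 2); set d := chi (y ^+ 2) => x0 y0 pxy.
have cd : c * d <= 1 by rewrite mulr_ile1 // ltW.
have : 0 <= (1 - c * d) * (x * y - p) by rewrite mulr_ge0 ?subr_ge0.
by lra.
Qed.

Definition radial (del : R) (w : V) : V := chi (del ^- 2 * `|w| ^+ 2) *: w.

Let radialE del w : 0 < del -> radial del w = del *: (chi (`|del^-1 *: w| ^+ 2) *: (del^-1 *: w)).
Proof.
move=> d0; rewrite /radial normrZ exprMn real_normK ?num_real // exprVn.
by rewrite !scalerA; congr (_ *: _); field; rewrite gt_eqF.
Qed.

Lemma radial_lipschitz del u v : 0 < del -> `|radial del u - radial del v| <= `|u - v|.
Proof.
move=> d0; rewrite !radialE // -scalerBr normrZ gtr0_norm //.
have h := radial_lip (del^-1 *: u) (del^-1 *: v).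
apply: (@le_trans _ _ (del * `|del^-1 *: u - del^-1 *: v|)); first by rewrite ler_pM2l.
by rewrite -scalerBr normrZ gtr0_norm ?invr_gt0 // mulVKf // gt_eqF.
Qed.

Lemma radial_bounded del u : 0 < del -> `|radial del u| <= 2 * del.
Proof.
move=> d0; rewrite radialE // normrZ gtr0_norm // mulrC ler_pM2r //.
have /andP[c0 _] := chi_itv (`|del^-1 *: u| ^+ 2).
by rewrite normrZ gtr0_norm // mulrC; exact: chi_le2.
Qed.

End RadialCutOff.

Section Nice.
Context {R : realType} {V : completeNormedModType R} (ip : V -> V -> R).
Hypothesis ipP : inner_product ip.

(** Boundedness is carried along so that the class is closed under products. *)
Definition bounded_lipschitz {W : normedModType R} (h : V -> W) : Prop :=
  exists M C : R, [/\ 0 <= M, 0 <= C, forall u, `|h u| <= M & forall u v, `|h u - h v| <= C * `|u - v|].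

Definition nice (h : V -> R) : Prop :=
  smooth_scalar ip 0 (fun x _ => h x) /\ bounded_lipschitz (h : V -> R^o).

Definition nicev (h : V -> V) : Prop :=
  smooth_vector ip 0 (fun x _ => h x) /\ bounded_lipschitz h.

Lemma bounded_lipschitzD {W : normedModType R} (h k : V -> W) :
  bounded_lipschitz h -> bounded_lipschitz k -> bounded_lipschitz (fun u => h u + k u).
Proof.
move=> [M [C [M0 C0 hM hC]]] [M' [C' [M0' C0' kM kC]]].
exists (M + M'), (C + C'); split; [exact: addr_ge0|exact: addr_ge0| |].
  by move=> u; apply: le_trans (ler_normD _ _) _; apply: lerD.
move=> u v; rewrite opprD addrACA mulrDl; apply: le_trans (ler_normD _ _) _; exact: lerD.
Qed.

Lemma bounded_lipschitzZ {W : normedModType R} (h : V -> R) (k : V -> W) :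
  bounded_lipschitz (h : V -> R^o) -> bounded_lipschitz k -> bounded_lipschitz (fun u => h u *: k u).
Proof.
move=> [M [C [M0 C0 hM hC]]] [M' [C' [M0' C0' kM kC]]].
exists (M * M'), (M * C' + C * M'); split.
- exact: mulr_ge0.
- by rewrite addr_ge0 // mulr_ge0.
- by move=> u; rewrite normrZ; apply: ler_pM.
move=> u v.
have -> : h u *: k u - h v *: k v = h u *: (k u - k v) + (h u - h v) *: k v.
  by rewrite scalerBr scalerBl subrKA.
rewrite mulrDl; apply: le_trans (ler_normD _ _) _; rewrite !normrZ; apply: lerD.
  by rewrite -mulrA; apply: ler_pM.
rewrite mulrAC; apply: ler_pM => //; exact: hC.
Qed.

Lemma nice_cst c : nice (fun _ => c).
Proof.
split; first exact: smooth_scalar_cst.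
by exists `|c|, 0; split => // u v; rewrite subrr normr0 mul0r.
Qed.

Lemma nice_add h k : nice h -> nice k -> nice (fun u => h u + k u).
Proof.
move=> [sh bh] [sk bk]; split; first exact: (smooth_scalar_add sh sk).
exact: (bounded_lipschitzD bh bk).
Qed.

Lemma nice_mul h k : nice h -> nice k -> nice (fun u => h u * k u).
Proof.
move=> [sh bh] [sk bk]; split; first exact: (smooth_scalar_mul sh sk).
exact: (bounded_lipschitzZ bh bk).
Qed.

Lemma nice_opp h : nice h -> nice (fun u => - h u).
Proof.
move=> nh; rewrite (_ : (fun u => - h u) = (fun u => (-1) * h u)).
  exact: nice_mul (nice_cst _) nh.
by apply/funext => u; rewrite mulN1r.
Qed.

Lemma smooth1_lipschitz_on p M : smooth1 p -> 0 <= M ->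
  exists K C : R, [/\ 0 <= K, 0 <= C, forall x, `|x| <= M -> `|p x| <= K &
    forall x y, `|x| <= M -> `|y| <= M -> `|p x - p y| <= C * `|x - y|].
Proof.
move=> sp M0; have [p' sp' dp] := smooth1_derive sp.
have bnd q : smooth1 q -> exists2 K, 0 <= K & forall x, `|x| <= M -> `|q x| <= K.
  move=> sq; have MM : - M <= M by lra.
  have cq : {within `[- M, M], continuous (fun x => `|q x|)}.
    by apply: continuous_subspaceT => x; apply: continuous_comp; [exact: smooth1_continuous|exact: norm_continuous].
  have [c _ cP] := EVT_max MM cq.
  by exists `|q c| => // x; rewrite ler_norml => xM; apply: cP; rewrite in_itv.
have [K K0 hK] := bnd p sp; have [C C0 hC] := bnd p' sp'.
exists K, C; split => // x y.
wlog xy : x y / x <= y.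
  by move=> H xM yM; have [/H|/ltW/H] := leP x y; [exact|rewrite distrC [`|x - y|]distrC; exact].
move=> xM yM; have inM z : x <= z <= y -> `|z| <= M.
  by move: xM yM; rewrite !ler_norml; lra.
have dC e z : deriv_at (fun z => e * p z - C * z) z (e * p' z - C).
  by have dz := dp z; apply: deriv_at_eq; [dauto|cbv beta; ring].
have mono e : `|e| = 1 -> e * p y - C * y <= e * p x - C * x.
  move=> e1; apply: (@derive_le _ (fun z => e * p z - C * z) (fun z => e * p' z - C)) => //.
    exact: (cvg_right_of_derive (dC e x)).
  move=> z /andP[xz zy]; rewrite subr_le0; apply: le_trans (ler_norm _) _.
  by rewrite normrM e1 mul1r; apply/hC/inM; rewrite ltW.
rewrite [`|x - y|]distrC (@ger0_norm _ (y - x)) ?subr_ge0 // ler_norml.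
by have := mono 1 (normr1 _); have := mono (-1) (normrN1 _); lra.
Qed.

Lemma nice_comp p h : smooth1 p -> nice h -> nice (fun u => p (h u)).
Proof.
move=> sp [sh [M [C [M0 C0 hM hC]]]]; split; first exact: (smooth_scalar_comp sp sh).
have [K [D [K0 D0 pK pD]]] := smooth1_lipschitz_on sp M0.
exists K, (D * C); split; [exact: K0|exact: mulr_ge0| |].
  by move=> u; apply: pK; exact: hM.
move=> u v; apply: le_trans (pD _ _ (hM u) (hM v)) _.
by rewrite -mulrA ler_wpM2l //; exact: hC.
Qed.

Lemma nice_coord p M a : smooth1 p -> (forall x, `|p x| <= M) ->
  (forall x y, `|p x - p y| <= `|x - y|) -> nice (fun u => p (ip u a)).
Proof.
move=> sp pM pL; split; first exact: (smooth_scalar_comp sp (smooth_scalar_pt _ _ a)).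
exists M, `|a|; split => //; first exact: le_trans (normr_ge0 _) (pM 0).
move=> u v; apply: le_trans (pL _ _) _; rewrite -(ipBl ipP) mulrC; exact: ip_le.
Qed.

Lemma nicev_cst c : nicev (fun _ => c).
Proof.
split; first exact: smooth_vector_cst.
by exists `|c|, 0; split => // u v; rewrite subrr normr0 mul0r.
Qed.

Lemma nicev_add h k : nicev h -> nicev k -> nicev (fun u => h u + k u).
Proof.
move=> [sh bh] [sk bk]; split; first exact: (smooth_vector_add sh sk).
exact: bounded_lipschitzD.
Qed.

Lemma nicev_scale h k : nice h -> nicev k -> nicev (fun u => h u *: k u).
Proof.
move=> [sh bh] [sk bk]; split; first exact: (smooth_vector_scale sh sk).
exact: bounded_lipschitzZ.
Qed.

Lemma nicev_lin T k : bounded_linear T -> nicev k -> nicev (fun u => T (k u)).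
Proof.
move=> Tb [sk [M [C [M0 C0 kM kC]]]]; split; first exact: (smooth_vector_lin Tb sk).
have [_ [N NP]] := Tb.
have NP' u : `|T u| <= `|N| * `|u| by apply: le_trans (NP u) _; rewrite ler_wpM2r // ler_norm.
exists (`|N| * M), (`|N| * C); split; [exact: mulr_ge0|exact: mulr_ge0| |].
  by move=> u; apply: le_trans (NP' _) _; rewrite ler_wpM2l.
move=> u v; rewrite -(@bounded_linearB _ _ T) //; apply: le_trans (NP' _) _.
by rewrite -mulrA ler_wpM2l.
Qed.

Lemma nice_ip_of_nicev h a : nicev h -> smooth_scalar ip 0 (fun x _ => ip (h x) a) ->
  nice (fun u => ip (h u) a).
Proof.
move=> [_ [M [C [M0 C0 hM hC]]]] s; split => //.
exists (M * `|a|), (C * `|a|); split; [exact: mulr_ge0|exact: mulr_ge0| |].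
  by move=> u; apply: le_trans (ip_le ipP _ _) _; rewrite ler_wpM2r.
move=> u v; rewrite -(ipBl ipP); apply: le_trans (ip_le ipP _ _) _.
by rewrite mulrAC ler_wpM2r.
Qed.

End Nice.

(** * The nonlinearity *)

Record cutoffs (R : realType) := Cutoffs {
  sig : R -> R; dsig : R -> R; tr : R -> R; dtr : R -> R; chi : R -> R; recip : R -> R;
  sigS : smooth1 sig; dsigS : smooth1 dsig;
  dsigP : forall x, deriv_at sig x (dsig x);
  dsig_ge0 : forall x, 0 <= dsig x;
  sigl : forall x, x <= 0 -> sig x = 0; sigr : forall x, 1 <= x -> sig x = 1;
  dsigl : forall x, x <= 0 -> dsig x = 0; dsigr : forall x, 1 <= x -> dsig x = 0;
  trS : smooth1 tr; dtrP : forall x, deriv_at tr x (dtr x);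
  dtr_itv : forall x, 0 <= dtr x <= 1;
  dtr1 : forall x, `|x| <= 1 -> dtr x = 1; dtr0 : forall x, 2 <= `|x| -> dtr x = 0;
  tr1 : forall x, `|x| <= 1 -> tr x = x; tr_le2 : forall x, `|tr x| <= 2;
  chiS : smooth1 chi; chi1 : forall x, x <= 1 -> chi x = 1;
  chi_itv : forall x, 0 < chi x <= 1;
  chi_le2 : forall r, 0 <= r -> r * chi (r ^+ 2) <= 2;
  chi_lip : forall r r', 0 <= r -> r <= r' -> `|r' * chi (r' ^+ 2) - r * chi (r ^+ 2)| <= r' - r;
  recipS : smooth1 recip; recipE : forall x, 1 / 2 <= x -> recip x = x^-1 }.

Lemma cutoffs_exist (R : realType) : exists K : cutoffs R, True.
Proof.
have [sg [dsg [s1 s2 s3 s4 [s5 s6 s7 s8]]]] := @smooth_step_exists R.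
have [t [t1 t2 t3 t4 t5]] := truncation_exists s1 s3 s4 s5 s6.
have [c [c1 c2 c3 c4 c5]] := radial_cutoff_exists s1 s3 s4 s5 s6.
have [i [i1 i2]] := smooth_inverse_exists s1 s3 s4 s5 s6.
by exists (Cutoffs s1 s2 s3 s4 s5 s6 s7 s8 t1 t2 (plateau_itv s3 s4 s5 s6)
  (plateau1 s6) (plateau0 s5) t4 t5 c1 c2 c3 c4 c5 i1 i2).
Qed.

Section Planar.
Context {R : realType} (K : cutoffs R).
Implicit Types (X Y Z : R) (b : bool).

Definition trunc (r x : R) : R := r * tr K (r^-1 * x).
Definition sq X Y : R := X * X + Y * Y.
Definition sgn b : R := if b then -1 else 1.
(* Cosine and sine of twice the polar angle of [(X, Y)], as long as [1 / 2 <= sq X Y]. *)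
Definition cos2 X Y : R := (X * X - Y * Y) * recip K (sq X Y).
Definition sin2 X Y : R := 2 * (X * Y) * recip K (sq X Y).
(* [window b] is 1 near the directions in which the pairs of parity [b] are being exchanged; there [spin b]
   rotates such a pair by a quarter turn while the planar orbit turns by a quarter turn. *)
Definition window b X Y : R := sig K (2 * sgn b * cos2 X Y).
Definition spin b X Y : R :=
  pi * dsig K (sgn b * sin2 X Y + 1 / 2) * (sgn b * cos2 X Y) * window b X Y.
Definition beta s : R := 1 - sig K (s - 3).
Definition rho s : R := 1 - sig K (s - 4).
(** For [z >= 1 / 2] this is [(9 - z) (z - 1) / (2 z)]: the radial equation [r' = - drift (r^2) r]
    becomes the logistic equation [z' = - (9 - z) (z - 1)] for [z = r^2]. It connects 9, the
    equilibrium [3 *: e0], to 1, the unit circle. *)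
Definition drift z : R := (9 - z) * (z - 1) * recip K z / 2.
(** This is [sq X Y] where [sq X Y <= 4] and [X * X] where [sq X Y >= 5]. In the latter region
    [beta] and [rho] vanish too, so the planar field does not depend on [Y] and has no second
    component: a displacement along [f 0] is carried along unchanged. *)
Definition xi X Y : R := X * X + rho (sq X Y) * (Y * Y).
Definition fieldx X Y : R := - (beta (sq X Y) * Y) - drift (xi X Y) * X.
Definition fieldy X Y : R := beta (sq X Y) * X - drift (xi X Y) * (rho (sq X Y) * Y).
(* [box] and [boxspin] live on [5 <= X^2 <= 8], which the planar orbit crosses while still on the axis [Y = 0]. *)
Definition box X : R := sig K (X * X - 5) * (1 - sig K (X * X - 7)).
Definition boxspin X : R := pi / 2 * dsig K (X * X - 6) * ((9 - X * X) * (X * X - 1)).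

Lemma sig_itv x : 0 <= sig K x <= 1.
Proof. exact: (step_itv (dsigP K) (dsig_ge0 K) (sigl K) (sigr K)). Qed.

Lemma window_itv b X Y : 0 <= window b X Y <= 1. Proof. exact: sig_itv. Qed.

Lemma box_itv X : 0 <= box X <= 1.
Proof.
rewrite /box; have /andP[a0 a1] := sig_itv (X * X - 5); have /andP[b0 b1] := sig_itv (X * X - 7).
by apply/andP; split; nra.
Qed.

Lemma trunc_smooth r : smooth1 (trunc r).
Proof.
apply: smooth1_mul; first exact: smooth1_cst.
apply: (smooth1_comp (trS K)).
by apply: smooth1_mul; [exact: smooth1_cst|exact: smooth1_id].
Qed.

Lemma deriv_at_trunc r x : 0 < r -> deriv_at (trunc r) x (dtr K (r^-1 * x)).
Proof.
move=> r0; have dl : deriv_at (fun x : R => r^-1 * x) x r^-1.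
  by apply: deriv_at_eq; [dauto|cbv beta; ring].
apply: deriv_at_eq; first exact: (deriv_at_mul (deriv_at_cst r x) (deriv_at_comp dl (dtrP K _))).
by cbv beta; rewrite mul0r add0r mulrCA divff ?mulr1 // gt_eqF.
Qed.

Lemma trunc_le r x : 0 < r -> `|trunc r x| <= 2 * r.
Proof. by move=> r0; rewrite /trunc normrM (gtr0_norm r0) mulrC ler_pM2r // tr_le2. Qed.

Lemma trunc_id r x : 0 < r -> `|x| <= r -> trunc r x = x.
Proof.
move=> r0 xr; rewrite /trunc tr1 ?mulVKf ?gt_eqF //.
by rewrite normrM normfV (gtr0_norm r0) mulrC ler_pdivrMr // mul1r.
Qed.

Lemma trunc_incr r x y : 0 < r -> x <= y -> 0 <= trunc r y - trunc r x <= y - x.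
Proof.
move=> r0 xy; apply/andP; split.
  rewrite subr_ge0; apply: (deriv_ge0_homo (fun z => deriv_at_trunc z r0)) => // z.
  by have /andP[] := dtr_itv K (r^-1 * z).
have h z : deriv_at (fun z => z - trunc r z) z (1 - dtr K (r^-1 * z)).
  exact: (deriv_at_add (deriv_at_id z) (deriv_at_opp (deriv_at_trunc z r0))).
have : x - trunc r x <= y - trunc r y.
  by apply: (deriv_ge0_homo h) => // z; rewrite subr_ge0; have /andP[] := dtr_itv K (r^-1 * z).
by lra.
Qed.

Lemma trunc_lip r x y : 0 < r -> `|trunc r x - trunc r y| <= `|x - y|.
Proof.
move=> r0; wlog xy : x y / x <= y.
  by move=> H; have [/H//|/ltW/H] := leP x y; rewrite distrC [leRHS]distrC.
rewrite distrC [leRHS]distrC; have /andP[h1 h2] := trunc_incr r0 xy.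
by rewrite !ger0_norm // subr_ge0.
Qed.

(** Where [trunc r] varies, that is for [|z| <= 2 * r], the function [trunc 3] has slope 1, because
    [2 * r <= 3]. This ordering of increments is what [scalar_le] relies on. *)
Lemma trunc_cmp r x y : 0 < r <= 1 -> x <= y ->
  trunc r y - trunc r x <= trunc 3 y - trunc 3 x.
Proof.
move=> /andP[r0 r1] xy; have h z : deriv_at (fun z => trunc 3 z - trunc r z) z
    (dtr K (3^-1 * z) - dtr K (r^-1 * z)).
  have t3 : 0 < 3 :> R by [].
  exact: (deriv_at_add (deriv_at_trunc z t3) (deriv_at_opp (deriv_at_trunc z r0))).
have : trunc 3 x - trunc r x <= trunc 3 y - trunc r y; last by lra.
apply: (deriv_ge0_homo h) => // z; rewrite subr_ge0.
have /andP[a0 a1] := dtr_itv K (3^-1 * z); have /andP[b0 b1] := dtr_itv K (r^-1 * z).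
have [z2|z2] := leP 2 `|r^-1 * z|; first by rewrite (dtr0 K z2).
rewrite (dtr1 K (x := 3^-1 * z)) //.
move: z2; rewrite !normrM !normfV (gtr0_norm r0) (@ger0_norm _ 3) // mulrC ltr_pdivrMr // => z2.
rewrite mulrC ler_pdivrMr //; lra.
Qed.

End Planar.

Section Nonlinearity.
Context {R : realType} {V : completeNormedModType R} (K : cutoffs R) (ip : V -> V -> R).
Context (e0 : V) (f : nat -> V) (l0 : R) (mu : nat -> R).
Context (E : V -> V) (D J : bool -> V -> V).

(* [f k] and [f k.+1] are coupled by the operators of index [odd k], for [0 < k]; the pair [f 0], [f 1]
   is handled separately, by [E] and the explicit terms carrying [box] and [boxspin]. *)
Definition starts (b : bool) (k : nat) : bool := (0 < k)%N && (odd k == b).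
Definition gap k : R := mu k.+1 - mu k.
(** [F] opposes [A], so the negative coefficient raises the decay rate of the lower mode to the mean
    of the pair, and the positive one lowers that of the upper mode. *)
Definition dcoef b k : R :=
  if starts b k then - (gap k / 2) else if starts b k.-1 then gap k.-1 / 2 else 0.
(** Only [f 1] appears. On [f 0] the term [mu 0 * py u] of [main_part] already cancels [A], so there
    the mean rate is produced by the term carrying [(mu 0 + mu 1) / 2]. *)
Definition ecoef k : R := if k == 1%N then gap 0 / 2 else 0.
Definition jcoef b k : R := if starts b k then -1 else if starts b k.-1 then 1 else 0.
Definition partner b k : nat := if starts b k then k.+1 else if starts b k.-1 then k.-1 else k.

Definition rest (u : V) : V := u + - ip u e0 *: e0 + - ip u (f 0) *: f 0.
Definition cutrest (del : R) (u : V) : V := radial (chi K) del (rest u).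
Definition px (u : V) : R := trunc K 3 (ip u e0).
Definition py (u : V) : R := trunc K 3 (ip u (f 0)).
(** The coordinate along [f 0] is used at two scales: [py] at the size of the planar orbit, [pyc] at
    that of the perturbation. *)
Definition pyc (del : R) (u : V) : R := trunc K del (ip u (f 0)).

(* The norm of [main_part] is governed by [mu 0] and half the largest gap, up to terms vanishing with [del];
   [small_part] is multiplied by [om], which is chosen after [del]. *)
Definition main_part (del : R) (u : V) : V :=
  (l0 * px u) *: e0 +
  (mu 0 * py u + - ((mu 0 + mu 1) / 2 * (box K (px u) * pyc del u))) *: f 0 +
  (box K (px u) *: E (cutrest del u) +
   window K true (px u) (py u) *: D true (cutrest del u) +
   window K false (px u) (py u) *: D false (cutrest del u)).

Definition small_part (del : R) (u : V) : V :=
  fieldx K (px u) (py u) *: e0 +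
  (fieldy K (px u) (py u) + - (boxspin K (px u) * ip (cutrest del u) (f 1))) *: f 0 +
  (boxspin K (px u) * pyc del u) *: f 1 +
  ((beta K (sq (px u) (py u)) * spin K true (px u) (py u)) *: J true (cutrest del u) +
   (beta K (sq (px u) (py u)) * spin K false (px u) (py u)) *: J false (cutrest del u)).

Definition nonlinearity (del om : R) (u : V) : V := main_part del u + om *: small_part del u.

Hypothesis ipP : inner_product ip.
Hypothesis e0e0 : ip e0 e0 = 1.
Hypothesis e0f : forall k, ip e0 (f k) = 0.
Hypothesis fP : forall i j, ip (f i) (f j) = (i == j)%:R.
Hypothesis EP : [/\ bounded_linear E, forall u k, ip (E u) (f k) = ecoef k * ip u (f k) &
  forall u, span_closed ip f (E u)].
Hypothesis DP : forall b, [/\ bounded_linear (D b),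
  forall u k, ip (D b u) (f k) = dcoef b k * ip u (f k) & forall u, span_closed ip f (D b u)].
Hypothesis JP : forall b, [/\ bounded_linear (J b),
  forall u k, ip (J b u) (f k) = jcoef b k * ip u (f (partner b k)) &
  forall u, span_closed ip f (J b u)].

Lemma nice_px : nice ip px.
Proof.
apply: (@nice_coord _ _ _ ipP (trunc K 3) 6 e0); first exact: trunc_smooth.
  by move=> x; apply: le_trans (trunc_le _ _ _) _ => //; lra.
by move=> x y; apply: trunc_lip.
Qed.

Lemma nice_py : nice ip py.
Proof.
apply: (@nice_coord _ _ _ ipP (trunc K 3) 6 (f 0)); first exact: trunc_smooth.
  by move=> x; apply: le_trans (trunc_le _ _ _) _ => //; lra.
by move=> x y; apply: trunc_lip.
Qed.

Lemma nice_pyc del : 0 < del -> nice ip (pyc del).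
Proof.
move=> d0; apply: (@nice_coord _ _ _ ipP (trunc K del) (2 * del) (f 0)); first exact: trunc_smooth.
  by move=> x; apply: trunc_le.
by move=> x y; apply: trunc_lip.
Qed.

Lemma nice_sq : nice ip (fun u => sq (px u) (py u)).
Proof. by apply: nice_add; apply: nice_mul; [exact: nice_px|exact: nice_px|exact: nice_py|exact: nice_py]. Qed.

Lemma nice_cos2 : nice ip (fun u => cos2 K (px u) (py u)).
Proof.
apply: nice_mul; last exact: (nice_comp (recipS K) nice_sq).
apply: nice_add; first by apply: nice_mul; exact: nice_px.
by apply: nice_opp; apply: nice_mul; exact: nice_py.
Qed.

Lemma nice_sin2 : nice ip (fun u => sin2 K (px u) (py u)).
Proof.
apply: nice_mul; last exact: (nice_comp (recipS K) nice_sq).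
apply: nice_mul; first exact: nice_cst.
by apply: nice_mul; [exact: nice_px|exact: nice_py].
Qed.

Lemma nice_window b : nice ip (fun u => window K b (px u) (py u)).
Proof.
apply: (nice_comp (sigS K)); apply: nice_mul; last exact: nice_cos2.
exact: nice_cst.
Qed.

Lemma nice_spin b : nice ip (fun u => spin K b (px u) (py u)).
Proof.
apply: nice_mul; last exact: nice_window.
apply: nice_mul; last by apply: nice_mul; [exact: nice_cst|exact: nice_cos2].
apply: nice_mul; first exact: nice_cst.
apply: (nice_comp (dsigS K)); apply: nice_add; last exact: nice_cst.
by apply: nice_mul; [exact: nice_cst|exact: nice_sin2].
Qed.

Lemma nice_step h c : nice ip h -> nice ip (fun u => sig K (h u - c)).
Proof. by move=> nh; apply: (nice_comp (sigS K)); apply: nice_add => //; exact: nice_cst. Qed.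

Lemma nice_beta : nice ip (fun u => beta K (sq (px u) (py u))).
Proof. by apply: nice_add; [exact: nice_cst|apply: nice_opp; apply: nice_step; exact: nice_sq]. Qed.

Lemma nice_rho : nice ip (fun u => rho K (sq (px u) (py u))).
Proof. by apply: nice_add; [exact: nice_cst|apply: nice_opp; apply: nice_step; exact: nice_sq]. Qed.

Lemma nice_drift : nice ip (fun u => drift K (xi K (px u) (py u))).
Proof.
have nxi : nice ip (fun u => xi K (px u) (py u)).
  apply: nice_add; first by apply: nice_mul; exact: nice_px.
  by apply: nice_mul; [exact: nice_rho|apply: nice_mul; exact: nice_py].
apply: nice_mul; last exact: nice_cst.
apply: nice_mul; last exact: (nice_comp (recipS K) nxi).
apply: nice_mul; first by apply: nice_add; [exact: nice_cst|exact: nice_opp].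
by apply: nice_add => //; exact: nice_cst.
Qed.

Lemma nice_field : nice ip (fun u => fieldx K (px u) (py u)) /\ nice ip (fun u => fieldy K (px u) (py u)).
Proof.
split; apply: nice_add.
- by apply: nice_opp; apply: nice_mul; [exact: nice_beta|exact: nice_py].
- by apply: nice_opp; apply: nice_mul; [exact: nice_drift|exact: nice_px].
- by apply: nice_mul; [exact: nice_beta|exact: nice_px].
- apply: nice_opp; apply: nice_mul; first exact: nice_drift.
  by apply: nice_mul; [exact: nice_rho|exact: nice_py].
Qed.

Lemma nice_px2 : nice ip (fun u => px u * px u).
Proof. by apply: nice_mul; exact: nice_px. Qed.

Lemma nice_box : nice ip (fun u => box K (px u)).
Proof.
apply: nice_mul; first exact: (nice_step _ nice_px2).
by apply: nice_add; [exact: nice_cst|apply: nice_opp; exact: (nice_step _ nice_px2)].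
Qed.

Lemma nice_boxspin : nice ip (fun u => boxspin K (px u)).
Proof.
apply: nice_mul.
  apply: nice_mul; first exact: nice_cst.
  by apply: (nice_comp (dsigS K)); apply: nice_add; [exact: nice_px2|exact: nice_cst].
apply: nice_mul; first by apply: nice_add; [exact: nice_cst|apply: nice_opp; exact: nice_px2].
by apply: nice_add; [exact: nice_px2|exact: nice_cst].
Qed.

Lemma restB u v : rest u - rest v = rest (u - v).
Proof.
rewrite /rest opprD addrACA; congr (_ + _); last first.
  by rewrite -scalerBl (ipBl ipP); congr (_ *: _); ring.
rewrite opprD addrACA; congr (_ + _).
by rewrite -scalerBl (ipBl ipP); congr (_ *: _); ring.
Qed.

Lemma rest_coord u k : ip (rest u) (f k) = if k == 0%N then 0 else ip u (f k).
Proof.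
rewrite /rest !(ipDl ipP) !(ipZl ipP) e0f fP eq_sym.
by case: eqP => [->|_] /=; ring.
Qed.

Lemma rest_e0 u : ip (rest u) e0 = 0.
Proof. by rewrite /rest !(ipDl ipP) !(ipZl ipP) e0e0 (ipC ipP (f 0)) e0f; ring. Qed.

Lemma rest_norm u : `|rest u| ^+ 2 = `|u| ^+ 2 - ip u e0 ^+ 2 - ip u (f 0) ^+ 2.
Proof.
have -> : `|u| ^+ 2 = `|ip u e0 *: e0 + ip u (f 0) *: f 0 + rest u| ^+ 2.
  by rewrite /rest !scaleNr addrC -[u - _ - _]addrA -opprD subrK.
have h0 := rest_coord u 0; rewrite eqxx in h0.
have o1 : ip (ip u e0 *: e0 + ip u (f 0) *: f 0) (rest u) = 0.
  by rewrite (ipDl ipP) !(ipZl ipP) (ipC ipP e0) (ipC ipP (f 0)) rest_e0 h0; ring.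
have o2 : ip (ip u e0 *: e0) (ip u (f 0) *: f 0) = 0.
  by rewrite (ipZl ipP) (ipZr ipP) e0f; ring.
rewrite (pythagoras ipP o1) (pythagoras ipP o2).
have eN a (w : V) : ip w w = 1 -> `|a *: w| ^+ 2 = a ^+ 2.
  by move=> w1; rewrite -(ipE ipP) (ipZl ipP) (ipZr ipP) w1; ring.
by rewrite !eN ?fP ?eqxx //; ring.
Qed.

Lemma rest_le u : `|rest u| <= `|u|.
Proof.
rewrite -ler_sqr ?nnegrE // rest_norm.
have := sqr_ge0 (ip u e0); have := sqr_ge0 (ip u (f 0)); lra.
Qed.

Lemma smooth_cutscalar del : smooth_scalar ip 0 (fun u _ => chi K (del ^- 2 * `|rest u| ^+ 2)).
Proof.
apply: (smooth_scalar_comp (chiS K)).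
apply: smooth_scalar_mul; first exact: smooth_scalar_cst.
rewrite (_ : (fun x _ => _) = (fun u (_ : nat -> V) => ip u u + -1 * (ip u e0 * ip u e0)
   + -1 * (ip u (f 0) * ip u (f 0)))).
  by do ![apply: smooth_scalar_add|apply: smooth_scalar_mul|exact: smooth_scalar_quad
    |exact: smooth_scalar_pt|exact: smooth_scalar_cst].
by apply/funext => u; apply/funext => _; rewrite rest_norm (ipE ipP); ring.
Qed.

Lemma nicev_cutrest del : 0 < del -> nicev ip (cutrest del).
Proof.
move=> d0; split.
  apply: (smooth_vector_scale (smooth_cutscalar del)).
  apply: smooth_vector_add; first apply: smooth_vector_add; first exact: smooth_vector_pt.
    apply: smooth_vector_scale; last exact: smooth_vector_cst.
    rewrite (_ : (fun x _ => _) = (fun u (_ : nat -> V) => -1 * ip u e0)).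
      by apply: smooth_scalar_mul; [exact: smooth_scalar_cst|exact: smooth_scalar_pt].
    by apply/funext => u; apply/funext => _; rewrite mulN1r.
  apply: smooth_vector_scale; last exact: smooth_vector_cst.
  rewrite (_ : (fun x _ => _) = (fun u (_ : nat -> V) => -1 * ip u (f 0))).
    by apply: smooth_scalar_mul; [exact: smooth_scalar_cst|exact: smooth_scalar_pt].
  by apply/funext => u; apply/funext => _; rewrite mulN1r.
exists (2 * del), 1; split => //; first by rewrite mulr_ge0 // ltW.
  by move=> u; exact: (radial_bounded (chi_itv K) (chi_le2 K)).
move=> u v; rewrite mul1r; apply: le_trans (rest_le (u - v)); rewrite -restB.
exact: (radial_lipschitz ipP (chi_itv K) (chi_lip K)).
Qed.

Lemma nice_cutrest1 del : 0 < del -> nice ip (fun u => ip (cutrest del u) (f 1)).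
Proof.
move=> d0; apply: (nice_ip_of_nicev ipP (nicev_cutrest d0)).
rewrite (_ : (fun x _ => _) = (fun u (_ : nat -> V) => chi K (del ^- 2 * `|rest u| ^+ 2) * ip u (f 1))).
  by apply: (smooth_scalar_mul (smooth_cutscalar del)); exact: smooth_scalar_pt.
by apply/funext => u; apply/funext => _; rewrite /cutrest /radial (ipZl ipP) rest_coord.
Qed.

Lemma nicev_main del : 0 < del -> nicev ip (main_part del).
Proof.
move=> d0; have nw := nicev_cutrest d0.
apply: nicev_add; first apply: nicev_add.
- apply: nicev_scale; last exact: nicev_cst.
  by apply: nice_mul; [exact: nice_cst|exact: nice_px].
- apply: nicev_scale; last exact: nicev_cst; apply: nice_add.
    by apply: nice_mul; [exact: nice_cst|exact: nice_py].
  apply: nice_opp; apply: nice_mul; first exact: nice_cst.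
  by apply: nice_mul; [exact: nice_box|exact: nice_pyc].
apply: nicev_add; first apply: nicev_add; apply: nicev_scale.
- exact: nice_box.
- by apply: nicev_lin => //; case: EP.
- exact: nice_window.
- by apply: nicev_lin => //; case: (DP true).
- exact: nice_window.
- by apply: nicev_lin => //; case: (DP false).
Qed.

Lemma nicev_small del : 0 < del -> nicev ip (small_part del).
Proof.
move=> d0; have nw := nicev_cutrest d0; have [nfx nfy] := nice_field.
apply: nicev_add; first apply: nicev_add; first apply: nicev_add; last apply: nicev_add.
- by apply: nicev_scale; [exact: nfx|exact: nicev_cst].
- apply: nicev_scale; last exact: nicev_cst; apply: nice_add; first exact: nfy.
  by apply: nice_opp; apply: nice_mul; [exact: nice_boxspin|exact: nice_cutrest1].
- by apply: nicev_scale; [apply: nice_mul; [exact: nice_boxspin|exact: nice_pyc]|exact: nicev_cst].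
- apply: nicev_scale; first by apply: nice_mul; [exact: nice_beta|exact: nice_spin].
  by apply: nicev_lin => //; case: (JP true).
- apply: nicev_scale; first by apply: nice_mul; [exact: nice_beta|exact: nice_spin].
  by apply: nicev_lin => //; case: (JP false).
Qed.

Lemma nicev_nonlinearity del om : 0 < del -> nicev ip (nonlinearity del om).
Proof.
move=> d0; apply: nicev_add; first exact: nicev_main.
by apply: nicev_scale; [exact: nice_cst|exact: nicev_small].
Qed.

End Nonlinearity.

(** * The Lipschitz constant of the nonlinearity *)

Section Lipschitz.
Context {R : realType} {V : completeNormedModType R} (K : cutoffs R) (ip : V -> V -> R).
Context (e0 : V) (f : nat -> V) (l0 : R) (mu : nat -> R).
Context (E : V -> V) (D J : bool -> V -> V).

Hypothesis ipP : inner_product ip.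
Hypothesis e0e0 : ip e0 e0 = 1.
Hypothesis e0f : forall k, ip e0 (f k) = 0.
Hypothesis fP : forall i j, ip (f i) (f j) = (i == j)%:R.
Context (G : R).
Hypothesis l0_itv : 0 <= l0 <= mu 0.
Hypothesis gap_itv : forall k, 0 <= gap mu k <= G.
Hypothesis EP : [/\ bounded_linear E, forall u k, ip (E u) (f k) = ecoef mu k * ip u (f k) &
  forall u, span_closed ip f (E u)].
Hypothesis DP : forall b, [/\ bounded_linear (D b),
  forall u k, ip (D b u) (f k) = dcoef mu b k * ip u (f k) & forall u, span_closed ip f (D b u)].
Hypothesis JP : forall b, [/\ bounded_linear (J b),
  forall u k, ip (J b u) (f k) = jcoef b k * ip u (f (partner b k)) &
  forall u, span_closed ip f (J b u)].

Let G0 : 0 <= G. Proof. by have /andP[] := gap_itv 0; apply: le_trans. Qed.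
Let m0 := (mu 0 + mu 1) / 2.
Let m0_ge0 : 0 <= m0.
Proof. by have /andP[a _] := gap_itv 0; have /andP[b c] := l0_itv; rewrite /m0; move: a; rewrite /gap; lra. Qed.

(** [main_part] with its three position-dependent coefficients frozen to numbers. Varying the
    arguments with frozen coefficients and varying the coefficients are estimated separately. *)
Definition main_form (s p q x y c : R) (w : V) : V :=
  (l0 * x) *: e0 + (mu 0 * y + - (m0 * (s * c))) *: f 0 + (s *: E w + p *: D true w + q *: D false w).

Lemma ecoef_le k : `|ecoef mu k| <= G / 2.
Proof.
rewrite /ecoef; have /andP[a b] := gap_itv 0.
by case: ifP => _; rewrite ler_norml; lra.
Qed.

Lemma dcoef_le b k : `|dcoef mu b k| <= G / 2.
Proof.
rewrite /dcoef; have /andP[a1 b1] := gap_itv k; have /andP[a2 b2] := gap_itv k.-1.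
by case: ifP => _; [|case: ifP => _]; rewrite ler_norml; lra.
Qed.

Lemma E_le u : `|E u| <= G / 2 * `|u|.
Proof. by case: EP => _ h1 h2; apply: (span_closed_norm ipP fP ecoef_le). Qed.

Lemma D_le b u : `|D b u| <= G / 2 * `|u|.
Proof. by case: (DP b) => _ h1 h2; apply: (span_closed_norm ipP fP (dcoef_le b)). Qed.

(* The two families of couplings act on [f k] with opposite signs, so the sum obeys the bound of a single one. *)
Lemma coupling_le s p q u : 0 <= s <= 1 -> 0 <= p <= 1 -> 0 <= q <= 1 ->
  `|s *: E u + p *: D true u + q *: D false u| <= G / 2 * `|u|.
Proof.
move=> /andP[s0 s1] /andP[p0 p1] /andP[q0 q1].
have [_ E1 E2] := EP; have [_ T1 T2] := DP true; have [_ F1 F2] := DP false.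
apply: (span_closed_norm ipP fP (a := fun k =>
  s * ecoef mu k + p * dcoef mu true k + q * dcoef mu false k)).
- have key (a b g g' : R) : 0 <= a <= 1 -> 0 <= b <= 1 -> 0 <= g <= G -> 0 <= g' <= G ->
      `|a * (g / 2) - b * (g' / 2)| <= G / 2.
    move=> /andP[a0 a1] /andP[b0 b1] /andP[g0 g1] /andP[g0' g1'].
    have h1 : 0 <= a * (g / 2) by rewrite mulr_ge0 //; lra.
    have h2 : 0 <= b * (g' / 2) by rewrite mulr_ge0 //; lra.
    have h3 : a * (g / 2) <= 1 * (g / 2) by rewrite ler_wpM2r //; lra.
    have h4 : b * (g' / 2) <= 1 * (g' / 2) by rewrite ler_wpM2r //; lra.
    by rewrite ler_norml; lra.
  case=> [|[|k]].
  + by rewrite /ecoef /dcoef /starts /=; rewrite !mulr0 !addr0 normr0 divr_ge0.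
  + rewrite /ecoef /dcoef /starts /= mulr0 addr0 mulrN; apply: key; rewrite ?s0 ?p0 //; exact: gap_itv.
  + rewrite /ecoef /dcoef /starts /=; case: (odd k) => /=; rewrite mulr0 add0r mulrN.
      by rewrite addrC; apply: key; rewrite ?q0 ?p0 //; exact: gap_itv.
    by apply: key; rewrite ?q0 ?p0 //; exact: gap_itv.
- rewrite addrC; apply: span_closed_lin => //; rewrite addrC; apply: span_closed_lin => //.
  exact: span_closedZ.
- by move=> k; rewrite !(ipDl ipP) !(ipZl ipP) E1 T1 F1; ring.
Qed.


Let subr3 (a b c a' b' c' : V) : (a + b + c) - (a' + b' + c') = (a - a') + (b - b') + (c - c').
Proof. by rewrite opprD addrACA; congr (_ + _); rewrite opprD addrACA. Qed.

(** The increments [X] and [Y] have the same sign, with [X] the smaller in absolute value. Hence the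
    result lies between [mu 0 * Y] and [(mu 0 - m0) * Y], where [mu 0 - m0] is minus half the first
    gap: the maximum of the two constants is enough, not their sum. *)
Let scalar_le (M s X Y x y : R) : mu 0 <= M -> G / 2 <= M -> 0 <= s <= 1 ->
  (x <= y -> 0 <= X <= Y /\ Y <= y - x) -> (y <= x -> Y <= X <= 0 /\ y - x <= Y) ->
  `|mu 0 * Y - m0 * (s * X)| <= M * `|y - x|.
Proof.
move=> hM hG /andP[s0 s1]; have /andP[g0 g1] := gap_itv 0; have /andP[l0' l1] := l0_itv.
have mE : m0 = mu 0 + gap mu 0 / 2 by rewrite /m0 /gap; field.
have key a b d : 0 <= a <= b -> b <= d -> `|mu 0 * b - m0 * (s * a)| <= M * d.
  move=> /andP[a0 ab] bd.
  have sa0 : 0 <= s * a by exact: mulr_ge0.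
  have sab : s * a <= b by rewrite (le_trans _ ab) // ler_piMl.
  have h1 : 0 <= m0 * (s * a) by exact: mulr_ge0.
  have h2 : m0 * (s * a) <= m0 * b by exact: ler_wpM2l.
  have h3 : mu 0 * b <= M * d by apply: ler_pM => //; lra.
  have h4 : gap mu 0 / 2 * b <= M * d by apply: ler_pM => //; lra.
  have h5 : m0 * b = mu 0 * b + gap mu 0 / 2 * b by rewrite mE; ring.
  by rewrite ler_norml; lra.
have [xy /(_ isT)[XY Yd] _|/ltW xy _ /(_ xy)[/andP[YX X0] Yd]] := leP x y.
  by rewrite [`|y - x|]ger0_norm ?subr_ge0 //; exact: key.
rewrite [`|y - x|]ler0_norm ?subr_le0 //.
rewrite (_ : _ - _ = - (mu 0 * - Y - m0 * (s * - X))); last by ring.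
by rewrite normrN; apply: key; lra.
Qed.

(** The contributions along [e0], along [f 0] and in their orthogonal complement are each at most
    [M] times the corresponding component of [u - v]; by Pythagoras nothing is lost in adding
    them. *)
Lemma main_form_le (del M s p q : R) u v : 0 < del <= 1 -> mu 0 <= M -> G / 2 <= M ->
  0 <= s <= 1 -> 0 <= p <= 1 -> 0 <= q <= 1 ->
  `|main_form s p q (px K ip e0 u) (py K ip f u) (pyc K ip f del u) (cutrest K ip e0 f del u) -
    main_form s p q (px K ip e0 v) (py K ip f v) (pyc K ip f del v) (cutrest K ip e0 f del v)| <=
  M * `|u - v|.
Proof.
move=> del01 hM hG hs hp hq; have [d0 d1] := andP del01; have [l00 l0m] := andP l0_itv.
have M0 : 0 <= M by lra.
rewrite subr3 -!scalerBl; set dw := cutrest K ip e0 f del u - cutrest K ip e0 f del v.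
have [Eb E1 E2] := EP; have [Tb T1 T2] := DP true; have [Fb F1 F2] := DP false.
set W := (X in _ + _ + X).
have WE : W = s *: E dw + p *: D true dw + q *: D false dw.
  rewrite /W subr3 -!scalerBr -(@bounded_linearB _ _ E) // -(@bounded_linearB _ _ (D true)) //.
  by rewrite -(@bounded_linearB _ _ (D false)).
have dwle : `|dw| <= `|rest ip e0 f (u - v)|.
  by rewrite -(restB e0 f ipP); exact: (radial_lipschitz ipP (chi_itv K) (chi_lip K)).
have Wle : `|W| <= M * `|rest ip e0 f (u - v)|.
  rewrite WE; apply: le_trans (coupling_le _ hs hp hq) _.
  by apply: ler_pM => //; exact: divr_ge0.
have We0 : ip e0 W = 0.
  have z k : ip e0 (f k) = 0 by [].
  by rewrite WE !(ipDr ipP) !(ipZr ipP) !(ipC ipP e0) E2 // T2 // F2 //; ring.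
have Wf0 : ip (f 0) W = 0.
  rewrite (ipC ipP) WE !(ipDl ipP) !(ipZl ipP) E1 T1 F1 /ecoef /dcoef /starts /=; ring.
set a := (X in X *: e0 + _ + _); set b := (X in _ + X *: f 0 + _).
have ale : `|a| <= M * `|ip (u - v) e0|.
  rewrite /a -mulrBr normrM (ger0_norm l00) (ipBl ipP); apply: ler_pM => //; first lra.
  exact: trunc_lip.
have ble : `|b| <= M * `|ip (u - v) (f 0)|.
  have -> : b = mu 0 * (py K ip f u - py K ip f v) - m0 * (s * (pyc K ip f del u - pyc K ip f del v)).
    by rewrite /b; ring.
  rewrite (ipBl ipP); apply: scalar_le => // h.
    split; last by have /andP[] := trunc_incr K (ltr0n _ 3) h.
    by rewrite (trunc_cmp K del01 h) andbT; have /andP[] := trunc_incr K d0 h.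
  have := trunc_cmp K del01 h; have := trunc_incr K (ltr0n _ 3) h; have := trunc_incr K d0 h.
  by rewrite /py /pyc => /andP[? ?] /andP[? ?] ?; split; lra.
rewrite -ler_sqr ?nnegrE ?mulr_ge0 // exprMn.
have o1 : ip (a *: e0 + b *: f 0) W = 0.
  by rewrite (ipDl ipP) !(ipZl ipP) We0 Wf0; ring.
have o2 : ip (a *: e0) (b *: f 0) = 0 by rewrite (ipZl ipP) (ipZr ipP) e0f; ring.
rewrite (pythagoras ipP o1) (pythagoras ipP o2).
have eN c (w : V) : ip w w = 1 -> `|c *: w| ^+ 2 = `|c| ^+ 2.
  by move=> w1; rewrite -(ipE ipP) (ipZl ipP) (ipZr ipP) w1 real_normK ?num_real //; ring.
rewrite !eN ?fP ?eqxx //.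
have sq (c d : R) : 0 <= c -> c <= M * d -> c ^+ 2 <= M ^+ 2 * d ^+ 2.
  by move=> c0 cd; rewrite -exprMn ler_sqr ?nnegrE // (le_trans c0).
have := sq _ _ (normr_ge0 _) ale; have := sq _ _ (normr_ge0 _) ble.
have := sq _ _ (normr_ge0 _) Wle; rewrite (rest_norm ipP e0e0 e0f fP).
by rewrite [`|ip _ e0| ^+ 2]real_normK ?num_real // [`|ip _ (f 0)| ^+ 2]real_normK ?num_real //; lra.
Qed.

Lemma main_form_coef_le s p q s' p' q' x y c (w : V) :
  `|main_form s p q x y c w - main_form s' p' q' x y c w| <=
  (m0 * `|c| + G / 2 * `|w|) * (`|s - s'| + `|p - p'| + `|q - q'|).
Proof.
rewrite subr3 subrr add0r subr3 -!scalerBl.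
have f01 : `|f 0| = 1.
  by have := sqrtr_sqr `|f 0|; rewrite -(ipE ipP) fP eqxx sqrtr1 normr_id => <-.
have h (a : R) (z : V) : `|z| <= G / 2 * `|w| -> `|a *: z| <= `|a| * (G / 2 * `|w|).
  by move=> zw; rewrite normrZ ler_wpM2l.
have hE := h (s - s') _ (E_le w); have hT := h (p - p') _ (D_le true w).
have hF := h (q - q') _ (D_le false w).
set a := (X in `|X *: f 0 + _|).
have aE : `|a *: f 0| = m0 * `|c| * `|s - s'|.
  have -> : a = m0 * (c * - (s - s')) by rewrite /a; ring.
  by rewrite normrZ f01 mulr1 (normrM m0) (normrM c) normrN (ger0_norm m0_ge0) mulrA.
apply: le_trans (ler_normD _ _) _; rewrite aE.
apply: le_trans (lerD (lexx _) (ler_normD _ _)) _.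
apply: le_trans (lerD (lexx _) (lerD (ler_normD _ _) (lexx _))) _.
have := mulr_ge0 (mulr_ge0 m0_ge0 (normr_ge0 c)) (normr_ge0 (p - p')).
have := mulr_ge0 (mulr_ge0 m0_ge0 (normr_ge0 c)) (normr_ge0 (q - q')).
lra.
Qed.

Let shrink (a b : R) : 0 < a -> 0 <= b -> exists2 d, 0 < d <= 1 & b * d <= a.
Proof.
move=> a0 b0; have h : 0 < a / (b + 1) by rewrite divr_gt0 // ltr_wpDl.
exists (Num.min 1 (a / (b + 1))); first by rewrite lt_min ltr01 h ge_min lexx.
apply: (@le_trans _ _ (b * (a / (b + 1)))); first by rewrite ler_wpM2l // ge_min lexx orbT.
by rewrite mulrA ler_pdivrMr ?ltr_wpDl //; nra.
Qed.

(** With frozen coefficients the constant is [M]. The variation of the coefficients has Lipschitz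
    constants [Cb], [Ct], [Cf] that do not involve [del] and is multiplied by quantities of size
    [del], so a small [del] keeps it within half of [L - M]. The constant of [small_part] may depend
    on [del]; choosing [om] last fits it in the other half. *)
Theorem nonlinearity_lipschitz L : mu 0 < L -> G / 2 < L ->
  exists del om : R, [/\ 0 < del <= 1, 0 < om <= 1 & forall u v,
   `|nonlinearity K ip e0 f l0 mu E D J del om u - nonlinearity K ip e0 f l0 mu E D J del om v| <=
   L * `|u - v|].
Proof.
move=> hm hG; set M := Num.max (mu 0) (G / 2).
have ML : M < L by rewrite /M gt_max hm hG.
have muM : mu 0 <= M by rewrite /M le_max lexx.
have GM : G / 2 <= M by rewrite /M le_max lexx orbT.
have [_ [_ [Cb [_ Cb0 _ bL]]]] := nice_box K e0 ipP.
have [_ [_ [Ct [_ Ct0 _ tL]]]] := nice_window K e0 f ipP true.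
have [_ [_ [Cf [_ Cf0 _ fL]]]] := nice_window K e0 f ipP false.
have gap2 : 0 < (L - M) / 2 by rewrite divr_gt0 // subr_gt0.
have G2 : 0 <= G / 2 by exact: divr_ge0.
have C0 : 0 <= (m0 + G / 2) * 2 * (Cb + Ct + Cf).
  by rewrite !mulr_ge0 // !addr_ge0.
have [del del01 dC] := shrink gap2 C0; have [d0 d1] := andP del01.
have [_ [_ [Cs [_ Cs0 _ sL]]]] :=
  nicev_small K ipP e0e0 e0f fP JP d0.
have [om om01 oC] := shrink gap2 Cs0; have [om0 _] := andP om01.
exists del, om; split => // u v.
rewrite /nonlinearity opprD addrACA -scalerBr.
have h1 : `|om *: (small_part K ip e0 f J del u - small_part K ip e0 f J del v)| <=
    (L - M) / 2 * `|u - v|.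
  rewrite normrZ gtr0_norm //; apply: le_trans (ler_wpM2l (ltW om0) (sL u v)) _.
  by rewrite mulrA ler_wpM2r // mulrC.
suff h2 : `|main_part K ip e0 f l0 mu E D del u - main_part K ip e0 f l0 mu E D del v| <=
    M * `|u - v| + (L - M) / 2 * `|u - v|.
  by apply: le_trans (ler_normD _ _) _; lra.
pose a w := box K (px K ip e0 w); pose b w := window K true (px K ip e0 w) (py K ip f w).
pose c w := window K false (px K ip e0 w) (py K ip f w).
pose g s w := main_form (a s) (b s) (c s) (px K ip e0 w) (py K ip f w)
  (pyc K ip f del w) (cutrest K ip e0 f del w).
apply: (@le_trans _ _ (`|g u u - g u v| + `|g u v - g v v|)); first exact: ler_distD.
apply: lerD.
  by apply: main_form_le => //; [exact: box_itv|exact: window_itv|exact: window_itv].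
apply: le_trans (main_form_coef_le _ _ _ _ _ _ _ _ _ _) _.
have w1 : m0 * `|pyc K ip f del v| + G / 2 * `|cutrest K ip e0 f del v| <= (m0 + G / 2) * 2 * del.
  have := ler_wpM2l m0_ge0 (trunc_le K (ip v (f 0)) d0).
  have := ler_wpM2l G2 (radial_bounded (chi_itv K) (chi_le2 K) (rest ip e0 f v) d0).
  by rewrite /pyc /cutrest; lra.
have w2 : `|a u - a v| + `|b u - b v| + `|c u - c v| <= (Cb + Ct + Cf) * `|u - v|.
  by have := bL u v; have := tL u v; have := fL u v; rewrite /a /b /c; lra.
apply: le_trans (ler_pM _ _ w1 w2) _; [by apply: addr_ge0; apply: mulr_ge0|by rewrite !addr_ge0|].
by rewrite mulrA ler_wpM2r //; lra.
Qed.

End Lipschitz.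

(** * The planar orbit *)

Section Orbit.
Context {R : realType} (K : cutoffs R).

(** [s] is the squared radius and [phi] the polar angle. The thresholds are those of the cut-offs:
    [beta] vanishes for [s >= 4], and for [s >= 8] the [box] has not been reached yet. *)
Record planar_orbit (om : R) (s phi : R -> R) : Prop := Orbit {
  orbit_itv : forall t, 1 < s t < 9;
  orbit_ds : forall t, deriv_at s t (- (om * ((9 - s t) * (s t - 1))));
  orbit_dphi : forall t, deriv_at phi t (om * beta K (s t));
  orbit_early : forall t, 4 <= s t -> phi t = 0;
  orbit_past : forall t, t <= 0 -> 5 <= s t;
  orbit_remote : exists T, forall t, t <= T -> 8 <= s t;
  orbit_late : exists t1, 0 <= t1 /\ forall t, t1 <= t -> om * (t - t1) <= phi t }.

Lemma beta_itv x : 0 <= beta K x <= 1.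
Proof. by rewrite /beta; have := sig_itv K (x - 3); lra. Qed.

Lemma orbit_homo om s phi : 0 < om -> planar_orbit om s phi -> {homo phi : x y / x <= y}.
Proof.
move=> om0 O; apply: (deriv_ge0_homo (orbit_dphi O)) => t.
by rewrite mulr_ge0 ?(ltW om0) //; have /andP[] := beta_itv (s t).
Qed.

Lemma orbit_ge0 om s phi t : 0 < om -> planar_orbit om s phi -> 0 <= phi t.
Proof.
move=> om0 O; have [T TP] := orbit_remote O.
have h r : r <= T -> phi r = 0 by move=> rT; apply: (orbit_early O); have := TP r rT; lra.
have [/h->//|/ltW Tt] := leP t T; rewrite -(h T) //; exact: (orbit_homo om0 O).
Qed.

Lemma orbit_exists om : 0 < om -> exists s phi, planar_orbit om s phi.
Proof.
(* The explicit solution of the logistic equation; [8 = 9 - 1], and time 0 is placed at the middle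
   value 5. *)
move=> om0; pose E t := expR (8 * om * t); pose s (t : R) := (9 + E t) / (1 + E t).
have E0 t : 0 < E t by exact: expR_gt0.
have E1 t : 0 < 1 + E t by rewrite addr_gt0.
have dE t : deriv_at E t (E t * (8 * om)).
  by apply: deriv_at_expR; apply: deriv_at_eq; [dauto|cbv beta; ring].
have ds t : deriv_at s t (- (om * ((9 - s t) * (s t - 1)))).
  have nz : 1 + E t != 0 by rewrite gt_eqF.
  have di : deriv_at (fun t => (1 + E t)^-1) t (- (1 + E t) ^- 2 * (0 + E t * (8 * om))).
    by apply: (@deriv_at_inv _ (fun t => 1 + E t)) => //; have d := dE t; dauto.
  have dn : deriv_at (fun t => 9 + E t) t (0 + E t * (8 * om)) by have d := dE t; dauto.
  by apply: deriv_at_eq; [exact: (deriv_at_mul dn di)|cbv beta; rewrite /s; field].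
have s_le a t : 1 < a -> E t * (a - 1) <= 9 - a -> a <= s t.
  by move=> a1 h; rewrite /s ler_pdivlMr //; lra.
have E_mono t t' : t <= t' -> E t <= E t'.
  by move=> h; rewrite ler_expR ler_wpM2l // mulr_ge0 // ltW.
have s_anti t t' : t <= t' -> s t' <= s t.
  move=> /E_mono h; rewrite /s ler_pdivrMr // mulrAC ler_pdivlMr //.
  by have := E0 t; lra.
have E00 : E 0 = 1 by rewrite /E mulr0 expR0.
have past t : t <= 0 -> 5 <= s t by move=> /E_mono; rewrite E00 => h; apply: s_le; lra.
have cb : continuous (fun t => om * beta K (s t)).
  move=> t; have sm : smooth1 (fun x => om * (1 + - sig K (x + - 3))).
    apply: smooth1_mul; first exact: smooth1_cst.
    apply: smooth1_add; first exact: smooth1_cst.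
    rewrite (_ : (fun x => _) = (fun x => -1 * sig K (1 * x + - 3))).
      apply: smooth1_mul; first exact: smooth1_cst.
      by apply: (smooth1_comp (sigS K)); exact: smooth1_affine.
    by apply/funext => x; rewrite mul1r mulN1r.
  apply: (@continuous_comp _ _ _ s (fun x => om * beta K x) t); first exact: deriv_at_continuous (ds t).
  exact: smooth1_continuous sm (s t).
have [phi [phi0 dphi]] := primitive_exists cb.
have mono : {homo phi : x y / x <= y}.
  apply: (deriv_ge0_homo dphi) => t.
  by rewrite mulr_ge0 ?(ltW om0) //; have /andP[] := beta_itv (s t).
exists s, phi; split => //.
- by move=> t; rewrite /s ltr_pdivlMr // ltr_pdivrMr //; have e0 := E0 t; apply/andP; split; lra.
- move=> t s4; have z r t' : 4 <= s t' -> r <= t' -> deriv_at phi r 0.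
    move=> h rt; apply: deriv_at_eq; first exact: dphi.
    by rewrite /beta sigr ?subrr ?mulr0 //; have := s_anti _ _ rt; lra.
  rewrite -phi0; have [t0|/ltW t0] := leP t 0.
    by apply: (derive0_eq t0) => r /andP[_ r0]; apply: (z _ 0) => //; have := past 0 (lexx _); lra.
  by apply/esym/(derive0_eq t0) => r /andP[_ rt]; apply: (z _ t).
- exists (- om^-1) => t h; apply: s_le; first lra.
  have h2 : E t <= expR (- 8).
    rewrite ler_expR; have := ler_wpM2l (ltW om0) h; rewrite mulrN divff ?gt_eqF //; lra.
  have := expR_ge1Dx (8 : R); have := expR0 R; rewrite -(subrr (8 : R)) expRD.
  have := expR_gt0 (- 8 : R); nra.
- have h (t : R) : om^-1 <= t -> 0 <= t.
    by apply: le_trans; rewrite invr_ge0 ltW.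
  exists om^-1; split; first exact: h.
  move=> t tl; have p0 : 0 <= phi om^-1 by rewrite -phi0; apply: mono; exact: h.
  have dd r : deriv_at (fun r => phi r + - (om * r)) r (om * beta K (s r) + - om).
    have d := dphi r; apply: deriv_at_eq; [by dauto|cbv beta; ring].
  have : phi om^-1 + - (om * om^-1) <= phi t + - (om * t); last by lra.
  apply: (derive_ge tl (cvg_right_of_derive (dd _)) (fun r _ => dd r)) => r /andP[r1 r2].
  have s3 : s r <= 3.
    rewrite /s ler_pdivrMr //; have := expR_ge1Dx (8 * om * r); rewrite -/(E r).
    have := ler_wpM2l (ltW om0) (ltW r1); rewrite divff ?gt_eqF //; lra.
  by rewrite /beta sigl ?subr0 ?mulr1 ?subrr //; lra.
Qed.

End Orbit.

(** * The trajectory falling onto the planar orbit *)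

Lemma partnerK b : involutive (partner b).
Proof.
move=> k; rewrite /partner /starts; case: k => [|k] //=.
have [h|h] := eqVneq (~~ odd k) b; first by rewrite /= negbK -h; case: (odd k).
have h' : odd k = b by move: h; case: (odd k); case: b.
rewrite h' eqxx andbT; case: k h h' => [|k] h h' /=; first by move: h; rewrite /= -h'.
by move: h'; rewrite /= => ->; rewrite eqxx.
Qed.

Section Couplings.
Context {R : realType} {V : completeNormedModType R} (K : cutoffs R) (ip : V -> V -> R).
Context (e0 : V) (f : nat -> V) (l0 : R) (mu : nat -> R).
Context (E : V -> V) (D J : bool -> V -> V) (del om : R).
Hypothesis ipP : inner_product ip.
Hypothesis e0e0 : ip e0 e0 = 1.
Hypothesis e0f : forall k, ip e0 (f k) = 0.
Hypothesis fP : forall i j, ip (f i) (f j) = (i == j)%:R.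
Hypothesis EP : [/\ bounded_linear E, forall u k, ip (E u) (f k) = ecoef mu k * ip u (f k) &
  forall u, span_closed ip f (E u)].
Hypothesis DP : forall b, [/\ bounded_linear (D b),
  forall u k, ip (D b u) (f k) = dcoef mu b k * ip u (f k) & forall u, span_closed ip f (D b u)].
Hypothesis JP : forall b, [/\ bounded_linear (J b),
  forall u k, ip (J b u) (f k) = jcoef b k * ip u (f (partner b k)) &
  forall u, span_closed ip f (J b u)].
Hypothesis d0 : 0 < del.

Lemma E_f1 : E (f 1) = (gap mu 0 / 2) *: f 1.
Proof. by have [_ h1 h2] := EP; rewrite (operator_basis ipP fP (@inj_id _) h1 h2 (i := 1%N)). Qed.

Lemma D_f b k : D b (f k) = dcoef mu b k *: f k.
Proof. by have [_ h1 h2] := DP b; rewrite (operator_basis ipP fP (@inj_id _) h1 h2 (i := k)). Qed.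

Lemma J_f b k : J b (f k) = jcoef b (partner b k) *: f (partner b k).
Proof.
have [_ h1 h2] := JP b.
by rewrite (operator_basis ipP fP (inv_inj (partnerK b)) h1 h2 (i := partner b k)) // partnerK.
Qed.

Lemma couplings_start k : (0 < k)%N -> let b := odd k in
  [/\ D b (f k) = - (gap mu k / 2) *: f k, D b (f k.+1) = (gap mu k / 2) *: f k.+1,
      J b (f k) = f k.+1 & J b (f k.+1) = - f k].
Proof.
move=> k0 b; have s1 : starts b k by rewrite /starts k0 eqxx.
have s2 : starts b k.+1 = false by rewrite /starts /b /=; case: (odd k).
have p1 : partner b k = k.+1 by rewrite /partner s1.
have p2 : partner b k.+1 = k by rewrite /partner s2 /= s1.
by rewrite !D_f !J_f p1 p2 /dcoef /jcoef s1 s2 /= ?s1 scale1r scaleN1r.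
Qed.

Lemma couplings_false1 : D false (f 1) = 0 /\ J false (f 1) = 0.
Proof. by rewrite D_f J_f /dcoef /jcoef /= scale0r. Qed.

Local Notation F := (nonlinearity K ip e0 f l0 mu E D J del om).

Let collect (x y g W Z : V) (a1 a2 b1 b2 c : R) :
  (a1 *: x + b1 *: y + W) + om *: (a2 *: x + b2 *: y + c *: g + Z) =
  (a1 + om * a2) *: x + (b1 + om * b2) *: y + ((om * c) *: g + (W + om *: Z)).
Proof.
rewrite -[a2 *: x + _ + _ + _]addrA 2!scalerDr addrACA; congr (_ + _).
  by rewrite !scalerA addrACA -!scalerDl.
by rewrite scalerDr scalerA addrCA.
Qed.

(** In this range every truncation is the identity except the one at height [del]: [b] contains the
    coordinate of the orbit and need not be small. *)
Lemma nonlinearity_eval a b z : `|a| <= 3 -> `|b| <= 3 -> ip z e0 = 0 -> ip z (f 0) = 0 -> `|z| <= del ->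
  F (a *: e0 + b *: f 0 + z) =
  (l0 * a + om * fieldx K a b) *: e0 +
  (mu 0 * b + - ((mu 0 + mu 1) / 2 * (box K a * trunc K del b)) +
   om * (fieldy K a b + - (boxspin K a * ip z (f 1)))) *: f 0 +
  ((om * (boxspin K a * trunc K del b)) *: f 1 +
  (box K a *: E z + window K true a b *: D true z + window K false a b *: D false z +
   om *: ((beta K (sq a b) * spin K true a b) *: J true z +
          (beta K (sq a b) * spin K false a b) *: J false z))).
Proof.
move=> a3 b3 z0 z1 zd; set u := a *: e0 + b *: f 0 + z.
have ue : ip u e0 = a.
  by rewrite /u !(ipDl ipP) !(ipZl ipP) e0e0 (ipC ipP (f 0)) e0f z0; ring.
have uf : ip u (f 0) = b.
  by rewrite /u !(ipDl ipP) !(ipZl ipP) e0f fP eqxx z1 mulr0 mulr1 add0r addr0.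
have pxE : px K ip e0 u = a by rewrite /px ue trunc_id.
have pyE : py K ip f u = b by rewrite /py uf trunc_id.
have rE : rest ip e0 f u = z.
  by rewrite /rest ue uf /u !scaleNr -[LHS]addrA -opprD addrC addKr.
have wE : cutrest K ip e0 f del u = z.
  rewrite /cutrest rE /radial chi1 ?scale1r //.
  by rewrite mulrC ler_pdivrMr ?exprn_gt0 // mul1r ler_sqr ?nnegrE // ltW.
by rewrite /nonlinearity /main_part /small_part /pyc uf pxE pyE wE collect.
Qed.

End Couplings.

Section Rotation.
Context {R : realType}.

(* [p] and [q] need only agree while the angle [Th] moves, as [cos Th * sin Th] vanishes otherwise. *)
Lemma rotation (p q Th th : R -> R) : continuous p -> continuous q ->
  (forall t, deriv_at Th t (th t)) ->
  exists M : R -> R, (forall t, deriv_at M t (cos (Th t) ^+ 2 * p t + sin (Th t) ^+ 2 * q t)) /\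
  forall a t, cos (Th t) * sin (Th t) * (p t - q t) = 0 ->
    let r t := a * expR (- M t) in
    deriv_at (fun t => r t * cos (Th t)) t
      (- (p t * (r t * cos (Th t))) - th t * (r t * sin (Th t))) /\
    deriv_at (fun t => r t * sin (Th t)) t
      (- (q t * (r t * sin (Th t))) + th t * (r t * cos (Th t))).
Proof.
move=> cp cq dTh.
have cT : continuous Th by move=> t; exact: deriv_at_continuous (dTh t).
have cc : continuous (fun t => cos (Th t)).
  by move=> t; apply: (@continuous_comp _ _ _ Th cos t); [exact: cT|exact: continuous_cos].
have cs : continuous (fun t => sin (Th t)).
  by move=> t; apply: (@continuous_comp _ _ _ Th sin t); [exact: cT|exact: continuous_sin].
have cm : continuous (fun t => cos (Th t) ^+ 2 * p t + sin (Th t) ^+ 2 * q t).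
  move=> t; apply: cvgD; apply: cvgM; [|exact: cp| |exact: cq].
    exact: (cvgM (cc t) (cc t)).
  exact: (cvgM (cs t) (cs t)).
have [M [_ dM]] := primitive_exists cm.
exists M; split => // a t h /=.
have ct : cos (Th t) ^+ 2 = 1 - sin (Th t) ^+ 2 by have := cos2Dsin2 (Th t); lra.
have dT := dTh t; have dMt := dM t.
split; (apply: deriv_at_eq; [by dauto|cbv beta]).
  transitivity (- (p t * (a * expR (- M t) * cos (Th t))) - th t * (a * expR (- M t) * sin (Th t)) +
     a * expR (- M t) * sin (Th t) * (cos (Th t) * sin (Th t) * (p t - q t))); last by rewrite h; ring.
  by rewrite ct; ring.
transitivity (- (q t * (a * expR (- M t) * sin (Th t))) + th t * (a * expR (- M t) * cos (Th t)) -
   a * expR (- M t) * cos (Th t) * (cos (Th t) * sin (Th t) * (p t - q t))); last by rewrite h; ring.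
rewrite (_ : a * expR (- M t) * cos (Th t) * (cos (Th t) * sin (Th t) * (p t - q t)) =
  a * expR (- M t) * cos (Th t) ^+ 2 * sin (Th t) * (p t - q t)); last by ring.
by rewrite ct; ring.
Qed.

Lemma cos_natpi (x : R) k : cos (x + k%:R * pi) = sgn (odd k) * cos x.
Proof.
elim: k => [|k IH]; first by rewrite mul0r addr0 mul1r.
rewrite -addn1 natrD mulrDl mul1r addrA cosDpi IH addn1 /=.
by case: (odd k); rewrite /sgn /= ?mulN1r ?mul1r ?opprK.
Qed.

Lemma sin_natpi (x : R) k : sin (x + k%:R * pi) = sgn (odd k) * sin x.
Proof.
elim: k => [|k IH]; first by rewrite mul0r addr0 mul1r.
rewrite -addn1 natrD mulrDl mul1r addrA sinDpi IH addn1 /=.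
by case: (odd k); rewrite /sgn /= ?mulN1r ?mul1r ?opprK.
Qed.

End Rotation.

Section OrbitPoint.
Context {R : realType} (K : cutoffs R) (om : R) (s phi : R -> R).
Hypothesis O : planar_orbit K om s phi.

Definition orbit_x t := Num.sqrt (s t) * cos (phi t).
Definition orbit_y t := Num.sqrt (s t) * sin (phi t).
Local Notation X := orbit_x.
Local Notation Y := orbit_y.

Let s0 t : 0 < s t. Proof. by have := orbit_itv O t; lra. Qed.
Let rr t : Num.sqrt (s t) * Num.sqrt (s t) = s t.
Proof. by rewrite -expr2 sqr_sqrtr // ltW. Qed.

Lemma orbit_sq t : sq (X t) (Y t) = s t.
Proof.
rewrite /sq /orbit_x /orbit_y; transitivity (Num.sqrt (s t) * Num.sqrt (s t) * (cos (phi t) ^+ 2 + sin (phi t) ^+ 2)); first by ring.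
by rewrite cos2Dsin2 mulr1 rr.
Qed.

Lemma orbit_le3 t : `|X t| <= 3 /\ `|Y t| <= 3.
Proof.
have h := orbit_sq t; have := orbit_itv O t; rewrite -h /sq => /andP[_ h9].
have hx := sqr_ge0 (X t); have hy := sqr_ge0 (Y t); rewrite !expr2 in hx hy.
by rewrite !ler_norml; split; apply/andP; split; nra.
Qed.

Lemma orbit_recip t : recip K (s t) = (s t)^-1.
Proof. by apply: recipE; have := orbit_itv O t; lra. Qed.

Lemma orbit_cos2 t : cos2 K (X t) (Y t) = cos (2 * phi t).
Proof.
rewrite /cos2 orbit_sq orbit_recip /orbit_x /orbit_y (_ : 2 * phi t = phi t + phi t); last by ring.
rewrite cosD; transitivity (Num.sqrt (s t) * Num.sqrt (s t) * (s t)^-1 *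
  (cos (phi t) * cos (phi t) - sin (phi t) * sin (phi t))); first by ring.
by rewrite rr divff ?mul1r // gt_eqF.
Qed.

Lemma orbit_sin2 t : sin2 K (X t) (Y t) = sin (2 * phi t).
Proof.
rewrite /sin2 orbit_sq orbit_recip /orbit_x /orbit_y (_ : 2 * phi t = phi t + phi t); last by ring.
rewrite sinD; transitivity (Num.sqrt (s t) * Num.sqrt (s t) * (s t)^-1 *
  (2 * cos (phi t) * sin (phi t))); first by ring.
by rewrite rr divff ?mul1r ?gt_eqF //; ring.
Qed.

Lemma orbit_y0 t : 4 <= s t -> Y t = 0.
Proof. by move=> /(orbit_early O) h; rewrite /orbit_y h sin0 mulr0. Qed.

Lemma orbit_x2 t : 4 <= s t -> X t * X t = s t.
Proof. by move=> h; rewrite -[RHS](orbit_sq t) /sq (orbit_y0 h); ring. Qed.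

Lemma orbit_box0 t : s t <= 4 -> box K (X t) = 0 /\ boxspin K (X t) = 0.
Proof.
move=> h; have : X t * X t <= 4.
  by have := orbit_sq t; rewrite /sq; have := sqr_ge0 (Y t); rewrite expr2; lra.
by move=> x4; rewrite /box /boxspin sigl ?dsigl ?mul0r ?mulr0 ?mul0r //; lra.
Qed.

(** The cut-off [rho] is invisible on the orbit: either [s t >= 4] and [Y] vanishes, or [s t <= 4]
    and [rho] is 1. *)
Lemma orbit_field t :
  fieldx K (X t) (Y t) = - (beta K (s t) * Y t) - drift K (s t) * X t /\
  fieldy K (X t) (Y t) = beta K (s t) * X t - drift K (s t) * Y t.
Proof.
rewrite /fieldx /fieldy /xi orbit_sq.
have [h|/ltW h] := leP 4 (s t).
  by rewrite (orbit_y0 h) !mulr0 !addr0 (orbit_x2 h).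
rewrite [rho K _]/rho sigl ?subr0 ?mul1r; last by lra.
by rewrite -/(sq (X t) (Y t)) orbit_sq.
Qed.

Lemma orbit_dx t : deriv_at X t (om * fieldx K (X t) (Y t)) /\ deriv_at Y t (om * fieldy K (X t) (Y t)).
Proof.
have ds := orbit_ds O t; have dp := orbit_dphi O t; have [-> ->] := orbit_field t.
have q0 : Num.sqrt (s t) != 0 by rewrite gt_eqF // sqrtr_gt0.
have dr : deriv_at (fun t => Num.sqrt (s t)) t (- (om * drift K (s t)) * Num.sqrt (s t)).
  apply: deriv_at_eq; first exact: (deriv_at_comp ds (is_derive1_sqrt (s0 t))).
  cbv beta; rewrite /drift orbit_recip; move: q0 (rr t).
  by move: (Num.sqrt (s t)) => q q0 <-; field.
by split; (apply: deriv_at_eq; [by dauto|cbv beta; rewrite /orbit_x /orbit_y; ring]).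
Qed.

End OrbitPoint.

(** * The stages of the perturbed trajectory *)

Section Stages.
Context {R : realType} {V : completeNormedModType R} (K : cutoffs R) (ip : V -> V -> R).
Context (e0 : V) (f : nat -> V) (l0 : R) (mu : nat -> R).
Context (E : V -> V) (D J : bool -> V -> V) (del om : R).
Context (A : V -> V) (DA : set V) (s phi : R -> R).
Hypothesis ipP : inner_product ip.
Hypothesis e0e0 : ip e0 e0 = 1.
Hypothesis e0f : forall k, ip e0 (f k) = 0.
Hypothesis fP : forall i j, ip (f i) (f j) = (i == j)%:R.
Hypothesis EP : [/\ bounded_linear E, forall u k, ip (E u) (f k) = ecoef mu k * ip u (f k) &
  forall u, span_closed ip f (E u)].
Hypothesis DP : forall b, [/\ bounded_linear (D b),
  forall u k, ip (D b u) (f k) = dcoef mu b k * ip u (f k) & forall u, span_closed ip f (D b u)].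
Hypothesis JP : forall b, [/\ bounded_linear (J b),
  forall u k, ip (J b u) (f k) = jcoef b k * ip u (f (partner b k)) &
  forall u, span_closed ip f (J b u)].
Hypothesis om0 : 0 < om.
Hypothesis del01 : 0 < del <= 1.
Hypothesis Alin : linear_on A DA.
Hypothesis Ae0 : DA e0 /\ A e0 = l0 *: e0.
Hypothesis Af : forall k, DA (f k) /\ A (f k) = mu k *: f k.
Hypothesis mu0 : 0 <= mu 0.
Hypothesis gap_ge0 : forall k, 0 <= gap mu k.
Hypothesis O : planar_orbit K om s phi.

Let d0 : 0 < del. Proof. by case/andP: del01. Qed.
Local Notation F := (nonlinearity K ip e0 f l0 mu E D J del om).
Local Notation X := (orbit_x s phi).
Local Notation Y := (orbit_y s phi).

Definition orbit_pt (t : R) : V := X t *: e0 + Y t *: f 0.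

Let AD u v : DA u -> DA v -> DA (u + v) /\ A (u + v) = A u + A v.
Proof. by move=> hu hv; have [_ [h1 h2]] := Alin; have := h1 1 u v hu hv; have := h2 1 u v hu hv; rewrite !scale1r. Qed.

Let AZ a u : DA u -> DA (a *: u) /\ A (a *: u) = a *: A u.
Proof.
move=> hu; have [h0 [h1 h2]] := Alin.
have A0 : A 0 = 0 by have := AD h0 h0 => -[_]; rewrite !addr0 => /eqP; rewrite -subr_eq0 opprD addNKr oppr_eq0 => /eqP.
by have := h1 a u 0 hu h0; have := h2 a u 0 hu h0; rewrite A0 !addr0.
Qed.

(** The equation is split along [e0], [f 0] and the remainder, so that checking a stage amounts to
    evaluating [F] on an explicit curve. *)
Lemma curve_solution (a b : R -> R) (z : R -> V) (a' b' : R) (z' : V) t :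
  deriv_at a t a' -> deriv_at b t b' -> deriv_at z t z' -> DA (z t) ->
  F (a t *: e0 + b t *: f 0 + z t) =
    (l0 * a t + a') *: e0 + (mu 0 * b t + b') *: f 0 + (A (z t) + z') ->
  solution_at A DA F (fun t => a t *: e0 + b t *: f 0 + z t) t.
Proof.
move=> da db dz Dz FE.
have du : deriv_at (fun t => a t *: e0 + b t *: f 0 + z t) t (a' *: e0 + b' *: f 0 + z').
  by apply: deriv_at_add => //; apply: deriv_at_add; apply: deriv_at_scale.
have [De Ee] := Ae0; have [Df Ef] := Af 0.
have [D1 E1] := AZ (a t) De; have [D2 E2] := AZ (b t) Df.
have [D3 E3] := AD D1 D2; have [D4 E4] := AD D3 Dz.
case: du => du1 du2; split; first exact: du1.
split; first exact: D4.
rewrite FE du2 E4 E3 E1 E2 Ee Ef !scalerA addrACA; congr (_ + _); last exact: addrC.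
by rewrite addrACA -!scalerDl; congr (_ *: _ + _ *: _); ring.
Qed.

Lemma orbit_pt_solution t : solution_at A DA F orbit_pt t.
Proof.
rewrite (_ : orbit_pt = fun t => X t *: e0 + Y t *: f 0 + 0); last first.
  by apply/funext => r; rewrite addr0.
have [dx dy] := orbit_dx O t; have [h1 h2] := orbit_le3 O t; have [DA0 _] := Alin.
have [_ A0] := AZ 0 DA0; rewrite !scale0r in A0.
apply: (curve_solution dx dy (deriv_at_cst _ t) DA0).
rewrite (nonlinearity_eval K l0 mu E D J om ipP e0e0 e0f fP d0) ?(ip0l ipP) ?normr0 ?(ltW d0) //.
have T0 T : bounded_linear T -> T (0 : V) = 0.
  by move=> h; have := bounded_linearZ 0 0 h; rewrite !scale0r.
(* On the orbit the coupling of [f 0] with [f 1] is inactive: [Y] vanishes as long as [s t >= 4],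
   the box terms afterwards. *)
have bxy : box K (X t) * trunc K del (Y t) = 0 /\ boxspin K (X t) * trunc K del (Y t) = 0.
  have [h|/ltW h] := leP 4 (s t).
    by rewrite (orbit_y0 O h) trunc_id ?normr0 ?(ltW d0) // !mulr0.
  by have [-> ->] := orbit_box0 O h; rewrite !mul0r.
have [-> ->] := bxy; have [Eb _ _] := EP.
have Db b : bounded_linear (D b) by case: (DP b).
have Jb b : bounded_linear (J b) by case: (JP b).
rewrite (T0 E) // !(T0 (D _)) // !(T0 (J _)) // !scaler0 A0 !mulr0.
by rewrite scale0r !addr0 scaler0 !addr0 oppr0 !addr0.
Qed.

Lemma rot_norm r x i j : i != j -> `|(r * cos x) *: f i + (r * sin x) *: f j| = `|r|.
Proof.
move=> ij; apply/eqP; rewrite -(@eqrXn2 _ 2) //; apply/eqP.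
have -> : `|(r * cos x) *: f i + (r * sin x) *: f j| ^+ 2 = r ^+ 2 * (cos x ^+ 2 + sin x ^+ 2).
  rewrite (pythagoras ipP); last by rewrite (ipZl ipP) (ipZr ipP) fP (negbTE ij) !mulr0.
  by rewrite -!(ipE ipP) !(ipZl ipP) !(ipZr ipP) !fP !eqxx /=; ring.
by rewrite cos2Dsin2 mulr1 real_normK ?num_real.
Qed.

Let continuous_box : continuous (fun t => box K (X t)).
Proof.
have sb : smooth1 (box K).
  have sx c : smooth1 (fun x => sig K (x * x + c)).
    apply: (smooth1_comp (sigS K)); apply: smooth1_add; last exact: smooth1_cst.
    by apply: smooth1_mul; exact: smooth1_id.
  rewrite (_ : box K = fun x => sig K (x * x + - 5) * (1 + -1 * sig K (x * x + - 7))).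
    apply: smooth1_mul; first exact: sx.
    by apply: smooth1_add; [exact: smooth1_cst|apply: smooth1_mul; [exact: smooth1_cst|exact: sx]].
  by apply/funext => x; rewrite /box mulN1r.
move=> t; apply: (@continuous_comp _ _ _ X (box K) t); last exact: smooth1_continuous.
by have [dx _] := orbit_dx O t; exact: deriv_at_continuous dx.
Qed.

(** The rotation from [f 0] to [f 1] happens while [s] falls from 7 to 6, where [box] is 1. Up to
    the angle [pi / 4] the window of parity [true], which concerns the pair [f 1], [f 2], is closed,
    and the operators of parity [false] vanish on [f 1]. The difference has norm exactly the
    amplitude [r], which never vanishes, so the trajectories are distinct. *)
Lemma stage_first : exists U : R -> V,
  [/\ forall t, phi t <= pi / 4 -> solution_at A DA F U t,
      forall t, 0 < `|U t - orbit_pt t| <= del &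
      forall t, s t <= 6 -> exists2 d, 0 <= d <= del & U t = orbit_pt t + d *: f 1].
Proof.
pose m0 := (mu 0 + mu 1) / 2; have g0 := gap_ge0 0; have mu00 := mu0.
(* Decay rates along [f 0] and [f 1]: 0 and [mu 1] outside the box, both equal to [m0] where the box
   is 1. *)
pose p t := m0 * box K (X t); pose q t := mu 1 + - (gap mu 0 / 2 * box K (X t)).
(* The angle of [w] in the plane of [f 0] and [f 1]. The polynomial factor in [boxspin] is the speed
   of [s] up to [- om], so that [om * boxspin] is the derivative of this angle. *)
pose Th t := pi / 2 * (1 - sig K (s t - 6)).
pose th t := om * (pi / 2 * dsig K (s t - 6) * ((9 - s t) * (s t - 1))).
have cp : continuous p by move=> t; apply: cvgM; [exact: cvg_cst|exact: continuous_box].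
have cq : continuous q.
  move=> t; apply: cvgD; first exact: cvg_cst.
  by apply: cvgN; apply: cvgM; [exact: cvg_cst|exact: continuous_box].
have dTh t : deriv_at Th t (th t).
  have ds := orbit_ds O t; have d6 : deriv_at (fun t => s t - 6) t (- (om * ((9 - s t) * (s t - 1))) + 0).
    exact: (deriv_at_add ds (deriv_at_cst _ _)).
  have dd := deriv_at_comp d6 (dsigP K _).
  by apply: deriv_at_eq; [dauto|rewrite /th; ring].
have Th6 t : s t <= 6 -> cos (Th t) = 0 /\ sin (Th t) = 1.
  by move=> h; rewrite /Th sigl ?subr0 ?mulr1 ?cos_pihalf ?sin_pihalf //; lra.
have Th7 t : 7 <= s t -> cos (Th t) = 1 /\ sin (Th t) = 0.
  by move=> h; rewrite /Th sigr ?subrr ?mulr0 ?cos0 ?sin0 //; lra.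
have [M [dM rot]] := rotation cp cq dTh.
have pq t : cos (Th t) * sin (Th t) * (p t - q t) = 0.
  have [h|h] := leP (s t) 6; first by have [-> _] := Th6 t h; rewrite !mul0r.
  have [h'|h'] := leP 7 (s t); first by have [_ ->] := Th7 t h'; rewrite mulr0 mul0r.
  have x2 : X t * X t = s t by apply: (orbit_x2 O); lra.
  rewrite (_ : p t - q t = 0) ?mulr0 // /p /q /box x2 sigr ?sigl; [|lra|lra].
  by rewrite /m0 /gap; field.
have [T TP] := orbit_remote O.
have m_ge0 t : 0 <= cos (Th t) ^+ 2 * p t + sin (Th t) ^+ 2 * q t.
  have /andP[b0 b1] := box_itv K (X t).
  have gE : mu 1 = mu 0 + gap mu 0 by rewrite /gap addrC subrK.
  have q0 : 0 <= q t.
    have : gap mu 0 / 2 * box K (X t) <= gap mu 0 / 2 by apply: ler_piMr => //; lra.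
    by rewrite /q gE; lra.
  by rewrite addr_ge0 // mulr_ge0 ?sqr_ge0 // /p mulr_ge0 //; rewrite /m0 gE; lra.
(* Before [T] neither the box nor the rotation is active, so [M] is constant there. This keeps the
   amplitude below bounded as time tends to minus infinity. *)
have MT t : M T <= M t.
  have [h|/ltW h] := leP T t; first exact: (derive_ge h (cvg_right_of_derive (dM _)) (fun r _ => dM r)).
  have -> // : M T = M t.
  apply/esym/(derive0_eq h) => r /andP[_ rT]; apply: deriv_at_eq; first exact: dM.
  have s8 := TP r rT; have [-> ->] := Th7 r (ltac:(lra) : 7 <= s r).
  have x2 : X r * X r = s r by apply: (orbit_x2 O); lra.
  have b0 : box K (X r) = 0 by rewrite /box x2 (sigr K (x := s r - 7)) ?subrr ?mulr0 //; lra.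
  by rewrite /p b0; ring.
pose r t := del * expR (M T) * expR (- M t).
have r0 t : 0 < r t by rewrite !mulr_gt0 ?expR_gt0.
have rd t : r t <= del.
  rewrite /r -mulrA -expRD; apply: ler_piMr; first exact: ltW.
  by rewrite -expR0 ler_expR; have := MT t; lra.
pose c t := r t * cos (Th t); pose d t := r t * sin (Th t).
have cle t : `|c t| <= del.
  rewrite normrM gtr0_norm //; apply: le_trans (rd t); apply: ler_piMr; first exact: ltW.
  by rewrite ler_norml cos_geN1 cos_le1.
have dle t : `|d t| <= del.
  rewrite normrM gtr0_norm //; apply: le_trans (rd t); apply: ler_piMr; first exact: ltW.
  by rewrite ler_norml sin_geN1 sin_le1.
exists (fun t => X t *: e0 + (Y t + c t) *: f 0 + d t *: f 1); split.
- move=> t ht; have [dc dd] := rot (del * expR (M T)) t (pq t).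
  have [dx dy] := orbit_dx O t; have [x3 y3] := orbit_le3 O t.
  have [Df Ef] := Af 1; have [Dz Ez] := AZ (d t) Df.
  have dz := deriv_at_scale (f 1) dd; have db := deriv_at_add dy dc.
  apply: (curve_solution dx db dz Dz).
  have zf k : ip (d t *: f 1) (f k) = d t * (1%N == k)%:R by rewrite (ipZl ipP) fP.
  have bt3 : `|Y t + c t| <= 3.
    have [h|h] := leP (s t) 6.
      by rewrite /c (proj1 (Th6 t h)) mulr0 addr0.
    rewrite (orbit_y0 O) ?add0r; last by lra.
    by have := cle t; have [_ d1] := andP del01; lra.
  have ze : ip (d t *: f 1) e0 = 0 by rewrite (ipZl ipP) (ipC ipP) e0f mulr0.
  have z0 : ip (d t *: f 1) (f 0) = 0 by rewrite zf mulr0.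
  have f1 : `|f 1| = 1 by have := sqrtr_sqr `|f 1|; rewrite -(ipE ipP) fP eqxx sqrtr1 normr_id => <-.
  have zd : `|d t *: f 1| <= del by rewrite normrZ f1 mulr1.
  rewrite (nonlinearity_eval K l0 mu E D J om ipP e0e0 e0f fP d0) //.
  have [Db0 Jb0] := couplings_false1 ipP fP DP JP.
  have lin G : bounded_linear G -> G (d t *: f 1) = d t *: G (f 1) by move=> h; rewrite (@bounded_linearZ _ _ G).
  have [Eb _ _] := EP; have [Df0 _ _] := DP false; have [Jf0 _ _] := JP false.
  rewrite (lin E Eb) (lin _ Df0) (lin _ Jf0) Db0 Jb0 (E_f1 ipP fP EP) Ez Ef zf /= mulr1.
  have thE : th t = om * boxspin K (X t).
    have [h|/ltW h] := leP 4 (s t); first by rewrite /th /boxspin (orbit_x2 O h).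
    by have [_ ->] := orbit_box0 O h; rewrite /th dsigl ?mulr0 ?mul0r ?mulr0 //; lra.
  have w0 : window K true (X t) (Y t + c t) = 0.
    rewrite /window sigl // /sgn mulrN1 mulNr oppr_le0 mulr_ge0 //.
    have [h|h] := leP (s t) 6.
      rewrite /c (proj1 (Th6 t h)) mulr0 addr0 (orbit_cos2 O).
      have p0 : 0 <= phi t by exact: (orbit_ge0 t om0 O).
      by apply: cos_ge0_pihalf; have := pi_ge0 R; lra.
    have s4 : 4 <= s t by lra.
    rewrite (orbit_y0 O s4) add0r /cos2 mulr_ge0 //.
      have := orbit_x2 O s4; have := cle t; have [_ d1] := andP del01.
      rewrite ler_norml => /andP[c1 c2] ->; nra.
    have := orbit_x2 O s4; rewrite /sq => ->.
    have cc := sqr_ge0 (c t); rewrite expr2 in cc.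
    by rewrite recipE ?invr_ge0; lra.
  (* The displacement [c t] changes the planar coordinate, but it can be nonzero only where
     [s t > 6], and there the field ignores the second coordinate. *)
  have [kx ky kb ks] : [/\ fieldx K (X t) (Y t + c t) = fieldx K (X t) (Y t),
     fieldy K (X t) (Y t + c t) = fieldy K (X t) (Y t),
     box K (X t) * trunc K del (Y t + c t) = box K (X t) * c t &
     boxspin K (X t) * trunc K del (Y t + c t) = boxspin K (X t) * c t].
    have [h|h] := leP (s t) 6.
      rewrite (_ : c t = 0) ?addr0; last by rewrite /c (proj1 (Th6 t h)) mulr0.
      have [s4|/ltW s4] := leP 4 (s t).
        by rewrite (orbit_y0 O s4) trunc_id ?normr0 ?(ltW d0).
      by have [-> ->] := orbit_box0 O s4; rewrite !mul0r.
    have s4 : 4 <= s t by lra.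
    have [-> ->] := orbit_field O t; rewrite (orbit_y0 O s4) add0r trunc_id //.
    have x2 := orbit_x2 O s4; have cc := sqr_ge0 (c t); rewrite expr2 in cc.
    have b0 : beta K (sq (X t) (c t)) = 0 by rewrite /beta sigr ?subrr // /sq x2; lra.
    have b0' : beta K (s t) = 0 by rewrite /beta sigr ?subrr //; lra.
    have r00 : rho K (sq (X t) (c t)) = 0 by rewrite /rho sigr ?subrr // /sq x2; lra.
    by rewrite /fieldx /fieldy /xi b0 b0' r00 x2 !mul0r !addr0 !mulr0.
  rewrite kx ky kb ks /spin w0 !mulr0 !scale0r !scaler0 !addr0 scaler0 !addr0.
  rewrite !scalerA -!scalerDl; congr (_ + _ *: _ + _ *: _); rewrite thE /p /q /m0 /c /d /r; ring.
- move=> t; have -> : X t *: e0 + (Y t + c t) *: f 0 + d t *: f 1 - orbit_pt t = c t *: f 0 + d t *: f 1.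
    by rewrite /orbit_pt scalerDl (addrA (X t *: e0)) -(addrA (X t *: e0 + _)) [LHS]addrC addKr.
  by rewrite rot_norm // gtr0_norm // r0 rd.
- move=> t /Th6[c0 s1]; exists (r t); first by rewrite ltW //= rd.
  by rewrite /orbit_pt /c /d c0 s1 mulr0 mulr1 addr0.
Qed.

(** On this quarter turn the window of the parity of [k] opens and closes while the other one stays
    shut. The rotation takes place where the sine of the doubled relative angle is between -1/2 and
    1/2; its cosine then exceeds 1/2, so the window equals 1 and the two rates coincide. At both
    ends [w] sits on a single mode, and its rate is at least [mu k] throughout. *)
Lemma stage_next k d tau : (0 < k)%N -> 0 <= d <= del -> phi tau = k%:R * (pi / 2) - pi / 4 ->
  exists U : R -> V,
  [/\ forall t, tau <= t -> phi t <= k%:R * (pi / 2) + pi / 4 -> solution_at A DA F U t,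
      U tau = orbit_pt tau + d *: f k,
      forall t, tau <= t -> `|U t - orbit_pt t| <= d * expR (- (mu k * (t - tau))) &
      forall t, tau <= t -> phi t = k%:R * (pi / 2) + pi / 4 ->
        exists2 d', 0 <= d' <= d * expR (- (mu k * (t - tau))) & U t = orbit_pt t + d' *: f k.+1].
Proof.
move=> k0 /andP[dd0 ddel] ptau; have gk0 := gap_ge0 k.
have gkE : mu k.+1 = mu k + gap mu k by rewrite /gap addrC subrK.
have pi0 := pi_gt0 R.
pose psi t := phi t - k%:R * (pi / 2).
pose w t := sig K (2 * cos (2 * psi t)).
pose p t := mu k + w t * (gap mu k / 2); pose q t := mu k.+1 + - (w t * (gap mu k / 2)).
(* The factor [spin] is the derivative of this angle with respect to the polar angle; the 1/2
   centres the rotation at the middle of the stage. *)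
pose Th t := pi / 2 * sig K (sin (2 * psi t) + 1 / 2).
pose th t := om * beta K (s t) * (pi * dsig K (sin (2 * psi t) + 1 / 2) * cos (2 * psi t)).
have d2psi t : deriv_at (fun t => 2 * psi t) t (2 * (om * beta K (s t))).
  by have dp := orbit_dphi O t; apply: deriv_at_eq; [rewrite /psi; dauto|cbv beta; ring].
have cw : continuous w.
  move=> t; have dp := d2psi t.
  have dc : deriv_at (fun t => 2 * cos (2 * psi t)) t (2 * (- sin (2 * psi t) * (2 * (om * beta K (s t))))).
    by apply: deriv_at_eq; [dauto|cbv beta; ring].
  exact: deriv_at_continuous (deriv_at_comp dc (dsigP K _)).
have cp : continuous p.
  by move=> t; apply: cvgD; [exact: cvg_cst|apply: cvgM; [exact: cw|exact: cvg_cst]].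
have cq : continuous q.
  by move=> t; apply: cvgD; [exact: cvg_cst|apply: cvgN; apply: cvgM; [exact: cw|exact: cvg_cst]].
have dTh t : deriv_at Th t (th t).
  have dp := d2psi t.
  have ds : deriv_at (fun t => sin (2 * psi t) + 1 / 2) t (cos (2 * psi t) * (2 * (om * beta K (s t)))).
    by apply: deriv_at_eq; [dauto|cbv beta; ring].
  have dd := deriv_at_comp ds (dsigP K _).
  by apply: deriv_at_eq; [dauto|rewrite /th; field].
have [M [dM rot]] := rotation cp cq dTh.
have w01 t : 0 <= w t <= 1 by exact: sig_itv.
have mle t : mu k <= cos (Th t) ^+ 2 * p t + sin (Th t) ^+ 2 * q t.
  have /andP[w0 w1] := w01 t.
  have wg0 : 0 <= w t * (gap mu k / 2) by rewrite mulr_ge0 // divr_ge0.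
  have wg1 : w t * (gap mu k / 2) <= gap mu k / 2 by apply: ler_piMl => //; lra.
  have pm : mu k <= p t by rewrite /p; lra.
  have qm : mu k <= q t by rewrite /q gkE; lra.
  have := ler_wpM2l (sqr_ge0 (cos (Th t))) pm; have := ler_wpM2l (sqr_ge0 (sin (Th t))) qm.
  have : cos (Th t) ^+ 2 * mu k + sin (Th t) ^+ 2 * mu k = mu k by rewrite -mulrDl cos2Dsin2 mul1r.
  lra.
have Mle t : tau <= t -> mu k * (t - tau) <= M t - M tau.
  move=> tt; have dd r : deriv_at (fun r => M r + - (mu k * r)) r
      (cos (Th r) ^+ 2 * p r + sin (Th r) ^+ 2 * q r + - mu k).
    by have dm := dM r; apply: deriv_at_eq; [dauto|cbv beta; ring].
  have := derive_ge tt (cvg_right_of_derive (dd _)) (fun r _ => dd r).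
  move=> h; suff : M tau + - (mu k * tau) <= M t + - (mu k * t) by lra.
  by apply: h => r _; rewrite subr_ge0.
pose r t := d * expR (M tau) * expR (- M t).
have r_ge0 t : 0 <= r t by rewrite !mulr_ge0 ?expR_ge0.
have rd t : tau <= t -> r t <= d * expR (- (mu k * (t - tau))).
  move=> tt; rewrite /r -mulrA -expRD ler_wpM2l // ler_expR.
  by have := Mle t tt; lra.
have rtau : r tau = d by rewrite /r -mulrA -expRD subrr expR0 mulr1.
have mk0 : 0 <= mu k.
  by elim: (k) => // j IH; apply: le_trans IH _; have := gap_ge0 j; rewrite /gap subr_ge0.
have rdel t : tau <= t -> r t <= del.
  move=> tt; apply: le_trans (rd t tt) _; apply: le_trans ddel; apply: ler_piMr => //.
  by rewrite -expR0 ler_expR oppr_le0 mulr_ge0 // subr_ge0.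
have Thlow t : sin (2 * psi t) <= - (1 / 2) -> cos (Th t) = 1 /\ sin (Th t) = 0.
  by move=> h; rewrite /Th sigl ?mulr0 ?cos0 ?sin0 //; lra.
have Thhigh t : 1 / 2 <= sin (2 * psi t) -> cos (Th t) = 0 /\ sin (Th t) = 1.
  by move=> h; rewrite /Th sigr ?mulr1 ?cos_pihalf ?sin_pihalf //; lra.
have kk : (pi : R) / 4 <= k%:R * (pi / 2) - pi / 4.
  have : 1 * (pi / 2) <= k%:R * (pi / 2) :> R by rewrite ler_wpM2r ?ler1n //; lra.
  lra.
pose z t := (r t * cos (Th t)) *: f k + (r t * sin (Th t)) *: f k.+1.
have kk1 : k != k.+1 by rewrite neq_ltn ltnSn.
have zn t : `|z t| = r t by rewrite /z rot_norm // ger0_norm.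
exists (fun t => X t *: e0 + Y t *: f 0 + z t); split.
- move=> t tt ph; have pt : phi tau <= phi t by exact: (orbit_homo om0 O).
  have c0 : 0 <= cos (2 * psi t).
    by apply: cos_ge0_pihalf; rewrite /psi; lra.
  have s4 : s t <= 4.
    by rewrite leNgt; apply/negP => /ltW /(orbit_early O) h; lra.
  have w1 : - (1 / 2) < sin (2 * psi t) < 1 / 2 -> w t = 1.
    move=> /andP[h1 h2]; apply: sigr; have := cos2Dsin2 (2 * psi t).
    rewrite !expr2; nra.
  have pq : cos (Th t) * sin (Th t) * (p t - q t) = 0.
    have [h|h1] := leP (sin (2 * psi t)) (- (1 / 2)).
      by have [_ ->] := Thlow t h; rewrite mulr0 mul0r.
    have [h|h2] := leP (1 / 2) (sin (2 * psi t)).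
      by have [-> _] := Thhigh t h; rewrite !mul0r.
    by rewrite /p /q w1 ?h1 // gkE (_ : _ - _ = 0) ?mulr0 //; field.
  have [dc ds] := rot (d * expR (M tau)) t pq.
  have [dx dy] := orbit_dx O t; have [x3 y3] := orbit_le3 O t.
  have [D1 E1] := Af k; have [D2 E2] := Af k.+1.
  have [D3 E3] := AZ (r t * cos (Th t)) D1; have [D4 E4] := AZ (r t * sin (Th t)) D2.
  have [Dz Ez] := AD D3 D4.
  have dz := deriv_at_add (deriv_at_scale (f k) dc) (deriv_at_scale (f k.+1) ds).
  apply: (curve_solution dx dy dz Dz).
  have ze : ip (z t) e0 = 0.
    by rewrite (ipDl ipP) !(ipZl ipP) !(ipC ipP _ e0) !e0f !mulr0 addr0.
  have z0 : ip (z t) (f 0) = 0.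
    by rewrite (ipDl ipP) !(ipZl ipP) !fP /= (gtn_eqF k0) !mulr0 addr0.
  rewrite (nonlinearity_eval K l0 mu E D J om ipP e0e0 e0f fP d0) ?zn ?rdel //.
  have [-> ->] := orbit_box0 O s4.
  (* A quarter turn adds [pi] to the doubled angle, hence changes the sign of its cosine and sine:
     this is how the planar position encodes the parity of the stage. *)
  have p2 : 2 * phi t = 2 * psi t + k%:R * pi by rewrite /psi; field.
  have sg : sgn (odd k) * sgn (odd k) = 1 :> R by rewrite /sgn; case: (odd k); ring.
  have Wk : window K (odd k) (X t) (Y t) = w t.
    rewrite /window (orbit_cos2 O) p2 cos_natpi; congr (sig K _).
    by transitivity (2 * (sgn (odd k) * sgn (odd k)) * cos (2 * psi t)); [ring|rewrite sg mulr1].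
  have Wk' : window K (~~ odd k) (X t) (Y t) = 0.
    rewrite /window (orbit_cos2 O) p2 cos_natpi; apply: sigl.
    by case: (odd k); rewrite /sgn /=; lra.
  have Sk' : spin K (~~ odd k) (X t) (Y t) = 0 by rewrite /spin Wk' mulr0.
  have Sk : spin K (odd k) (X t) (Y t) = pi * dsig K (sin (2 * psi t) + 1 / 2) * cos (2 * psi t).
    rewrite /spin Wk (orbit_cos2 O) (orbit_sin2 O) p2 cos_natpi sin_natpi !mulrA sg !mul1r.
    have [h|h1] := leP (sin (2 * psi t)) (- (1 / 2)); first by rewrite dsigl ?mulr0 ?mul0r //; lra.
    have [h|h2] := leP (1 / 2) (sin (2 * psi t)); first by rewrite dsigr ?mulr0 ?mul0r //; lra.
    by rewrite w1 ?h1 // -!mulrA (mulrA (sgn _)) sg mul1r mulr1.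
  have [Dk Dk1 Jk Jk1] := couplings_start ipP fP DP JP k0.
  have sums (T : bool -> V -> V) (a : bool -> R) : a (~~ odd k) = 0 ->
      a true *: T true (z t) + a false *: T false (z t) = a (odd k) *: T (odd k) (z t).
    by case: (odd k) => /= ->; rewrite scale0r ?addr0 ?add0r.
  rewrite scale0r add0r (sums D (fun b => window K b (X t) (Y t)) Wk').
  rewrite (sums J (fun b => beta K (sq (X t) (Y t)) * spin K b (X t) (Y t))) ?Sk' ?mulr0 //.
  rewrite Wk Sk (orbit_sq O) /z.
  have lin (G : V -> V) (a b : R) (u v : V) : bounded_linear G -> G (a *: u + b *: v) = a *: G u + b *: G v.
    by move=> h; case: (h) => h1 _; rewrite h1 (@bounded_linearZ _ _ G).
  have [Db _ _] := DP (odd k); have [Jb _ _] := JP (odd k).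
  rewrite (lin _ _ _ _ _ Db) (lin _ _ _ _ _ Jb) Dk Dk1 Jk Jk1 Ez E3 E4 E1 E2.
  rewrite !mul0r !mulr0 oppr0 !addr0 scale0r add0r scalerN -scaleNr !scalerDr !scalerA.
  rewrite [_ *: f k.+1 + (_ *: f k)]addrC !(addrACA _ (_ *: f k.+1)) -!scalerDl.
  by congr (_ + (_ *: _ + _ *: _)); rewrite /th /p /q /r; ring.
- rewrite /z rtau.
  have h : sin (2 * psi tau) <= - (1 / 2).
    rewrite /psi ptau (_ : 2 * _ = - (pi / 2)); last by field.
    by rewrite sinN sin_pihalf; lra.
  by have [-> ->] := Thlow tau h; rewrite mulr1 mulr0 scale0r addr0.
- by move=> t tt; rewrite [X in `|X|](_ : _ = z t) ?zn ?rd // /orbit_pt addrC addKr.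
- move=> t tt pt; exists (r t); first by rewrite r_ge0 rd.
  have h : 1 / 2 <= sin (2 * psi t).
    rewrite /psi pt (_ : 2 * _ = pi / 2); last by field.
    by rewrite sin_pihalf; lra.
  by have [c0 s1] := Thhigh t h; rewrite /z c0 s1 mulr0 mulr1 scale0r add0r.
Qed.

End Stages.

(** * Gluing the stages and the Gaussian decay *)

Section Gluing.
Context {R : realType} {V : completeNormedModType R} (ip : V -> V -> R).
Context (A : V -> V) (DA : set V) (F : V -> V) (L : R) (S : R -> V -> V).
Context (f : nat -> V) (mu : nat -> R) (eps del om : R) (phi : R -> R) (v U0 : R -> V).
Hypothesis ipP : inner_product ip.
Hypothesis Asa : self_adjoint ip A DA.
Hypothesis Apos : positive_op ip A DA.
Hypothesis FL : forall u v, `|F u - F v| <= L * `|u - v|.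
Hypothesis SP : generates_semigroup A DA F S.
Hypothesis eps0 : 0 < eps.
Hypothesis del0 : 0 < del.
Hypothesis om0 : 0 < om.
Hypothesis mu_ge : forall k, eps * k%:R <= mu k.
Hypothesis phi_cont : continuous phi.
Hypothesis phi_homo : {homo phi : x y / x <= y}.
Hypothesis phi0 : phi 0 = 0.
Hypothesis phi_late : exists t1, 0 <= t1 /\ forall t, t1 <= t -> om * (t - t1) <= phi t.
Hypothesis U0_sol : forall t, phi t <= pi / 4 -> solution_at A DA F U0 t.
Hypothesis U0_near : forall t, 0 < `|U0 t - v t| <= del.
Hypothesis U0_end : forall t, phi t = pi / 4 -> exists2 d, 0 <= d <= del & U0 t = v t + d *: f 1.
Hypothesis stage : forall k d tau, (0 < k)%N -> 0 <= d <= del -> phi tau = k%:R * (pi / 2) - pi / 4 ->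
  exists U : R -> V,
  [/\ forall t, tau <= t -> phi t <= k%:R * (pi / 2) + pi / 4 -> solution_at A DA F U t,
      U tau = v tau + d *: f k,
      forall t, tau <= t -> `|U t - v t| <= d * expR (- (mu k * (t - tau))) &
      forall t, tau <= t -> phi t = k%:R * (pi / 2) + pi / 4 ->
        exists2 d', 0 <= d' <= d * expR (- (mu k * (t - tau))) & U t = v t + d' *: f k.+1].

Lemma solution_at_near (w w' : R -> V) t : (\near t, w t = w' t) ->
  solution_at A DA F w t -> solution_at A DA F w' t.
Proof.
move=> ww [dw [Dw Ew]]; have wt : w t = w' t by exact: nbhs_singleton ww.
have [d1 d2] : deriv_at w' t ('D_1 w t) by apply: (deriv_at_near ww); exact: deriv_atP.
by split => //; rewrite -wt d2.
Qed.

Let level y : 0 <= y -> exists2 t, 0 <= t & phi t = y.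
Proof.
move=> y0; have [t1 [t10 late]] := phi_late.
have yo : 0 <= y / om by rewrite divr_ge0 // ltW.
have T0 : 0 <= t1 + y / om by exact: addr_ge0.
have pT : y <= phi (t1 + y / om).
  by apply: le_trans (late _ _); rewrite ?lerDl // addrC addKr mulrC divfK // gt_eqF.
have [|c c0 cE] := @IVT R phi 0 (t1 + y / om) y T0 (continuous_subspaceT phi_cont).
  by rewrite phi0 (min_idPl (le_trans y0 pT)) (max_idPr (le_trans y0 pT)) y0.
by exists c => //; move: c0; rewrite in_itv /= => /andP[].
Qed.

(** For nonnegative times the trajectory is the semigroup orbit of [U0 0], and uniqueness identifies
    it with the successive stage curves. No matching of derivatives at the junction times is
    needed. *)
Theorem glued_trajectory : exists u : R -> V,
  [/\ forall t, solution_at A DA F u t, u 0 <> v 0,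
   exists B, forall t, `|u t - v t| <= B &
   exists C kappa, [/\ 0 < C, 0 < kappa &
     forall t, 0 <= t -> `|u t - v t| <= C * expR (- (kappa * t ^+ 2))]].
Proof.
have pi2 := pi_ge2 R.
(* [T k] starts the stage of the pair [f k.+1], [f k.+2]; [T 0], at angle [pi / 4], ends the first
   step. *)
have /choice[T TP] : forall k, exists t, 0 <= t /\ phi t = k.+1%:R * (pi / 2) - pi / 4.
  move=> k; have : 1 * (pi / 2) <= k.+1%:R * (pi / 2) :> R by rewrite ler_wpM2r ?ler1n //; lra.
  by move=> h; have [|t t0 tE] := @level (k.+1%:R * (pi / 2) - pi / 4); [lra|exists t].
have T0 k : 0 <= T k by case: (TP k).
have pT k : phi (T k) = k.+1%:R * (pi / 2) - pi / 4 by case: (TP k).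
have S1 k : (k.+1%:R : R) = k%:R + 1 by rewrite -addn1 natrD.
have before k t : phi t < phi (T k) -> t <= T k.
  by move=> h; rewrite leNgt; apply/negP => /ltW /phi_homo; rewrite leNgt h.
have Tinc k : T k <= T k.+1 by apply: before; rewrite !pT S1; lra.
have pT0 : phi (T 0) = pi / 4 by rewrite pT; field.
have Tgt k : 0 < T k.
  rewrite lt_neqAle T0 andbT; apply/eqP => h; have := pT k; rewrite -h phi0.
  have : 1 * (pi / 2) <= k.+1%:R * (pi / 2) :> R by rewrite ler_wpM2r ?ler1n //; lra.
  by lra.
have [t1 [t10 late]] := phi_late.
(* The waiting time [t1] plus the duration of half a turn, enough for the start of stage [k] to grow
   at most linearly with slope [Q]. *)
pose Q := t1 + pi / om; have Q0 : 0 < Q by rewrite ltr_wpDl // divr_gt0 // pi_gt0.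
have Tle k : T k.+1 <= k.+1%:R * Q.
  have h1 : t1 <= k.+1%:R * t1 by rewrite ler_peMl // ler1n.
  have h2 : 0 <= k.+1%:R * (pi / om) by rewrite mulr_ge0 // divr_ge0 // ltW // pi_gt0.
  have [h|/ltW h] := leP (T k.+1) t1; first by rewrite /Q mulrDr; lra.
  have : om * (T k.+1 - t1) <= k.+1%:R * pi.
    apply: le_trans (late _ h) _; rewrite pT (S1 k.+1).
    have : 1 * pi <= k.+1%:R * pi :> R by rewrite ler_wpM2r ?ler1n //; lra.
    by lra.
  rewrite mulrC -ler_pdivlMr // -mulrA /Q mulrDr; lra.
(* Chosen so that [kap * (t + T k)] is at most [mu k.+1] up to time [T k.+1], both times being at
   most [k.+1%:R * Q]. *)
pose kap := eps / (2 * Q); have kap0 : 0 < kap by rewrite divr_gt0 // mulr_gt0.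
(* On [[0, T 0]] the difference is only known to be at most [del]; this constant makes the Gaussian
   bound hold there. *)
pose C := del * expR (kap * T 0 ^+ 2); have C0 : 0 < C by rewrite mulr_gt0 ?expR_gt0.
pose W t := S t (U0 0).
have [W0 [Wr [Wsol _]]] := SP (U0 0).
have WU t : 0 <= t <= T 0 -> W t = U0 t.
  move=> /andP[t0 tT]; apply: (solution_unique ipP Asa Apos FL t0) => //.
  - by rewrite /W W0.
  - by apply: solution_right_cvg; apply: U0_sol; rewrite phi0; lra.
  - by move=> r /andP[r0 _]; exact: Wsol.
  - by move=> r /andP[r0 rt]; apply: U0_sol; rewrite -pT0; apply: phi_homo; exact: le_trans tT.
have delC t : 0 <= t <= T 0 -> del <= C * expR (- (kap * t ^+ 2)).
  move=> /andP[t0 tT]; rewrite /C -mulrA -expRD ler_peMr ?(ltW del0) //.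
  rewrite -expR0 ler_expR subr_ge0 ler_wpM2l ?(ltW kap0) //.
  by rewrite ler_sqr ?nnegrE // T0.
have P k : (exists d, [/\ 0 <= d <= del, d <= C * expR (- (kap * T k ^+ 2)) & W (T k) = v (T k) + d *: f k.+1]) /\
    forall t, 0 <= t <= T k -> `|W t - v t| <= C * expR (- (kap * t ^+ 2)).
  elim: k => [|k [[d [dd dC WE]] IH]].
    split.
      have [d dd UE] := U0_end pT0; exists d; split => //.
        by have /andP[_ h] := dd; apply: le_trans h _; apply: delC; rewrite T0 lexx.
      by rewrite WU ?T0 ?lexx.
    by move=> t tT; rewrite WU //; have /andP[_ h] := U0_near t; apply: le_trans h (delC _ tT).
  have [U [U1 U2 U3 U4]] := stage (ltn0Sn k) dd (pT k).
  have [dd0 ddel] := andP dd.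
  have pS : phi (T k.+1) = k.+1%:R * (pi / 2) + pi / 4 by rewrite pT (S1 k.+1); field.
  have WU' t : T k <= t <= T k.+1 -> W t = U t.
    move=> /andP[t0 tT]; apply: (solution_unique ipP Asa Apos FL t0).
    - by rewrite WE U2.
    - by apply: solution_right_cvg; exact: Wsol.
    - by apply: solution_right_cvg; apply: U1 => //; rewrite pT; lra.
    - by move=> r /andP[r0 _]; apply: Wsol; exact: lt_trans r0.
    - move=> r /andP[r0 rt]; apply: U1; first exact: ltW.
      by rewrite -pS; apply: phi_homo; exact: le_trans tT.
  have decay t : T k <= t <= T k.+1 -> d * expR (- (mu k.+1 * (t - T k))) <= C * expR (- (kap * t ^+ 2)).
    move=> /andP[t0 tT]; apply: le_trans (ler_wpM2r (expR_ge0 _) dC) _.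
    rewrite -mulrA -expRD ler_wpM2l ?(ltW C0) // ler_expR.
    (* Multiplied by [t - T k], this makes the decay within the stage at least that of the Gaussian
       between [T k] and [t]. *)
    have h1 : kap * (t + T k) <= mu k.+1.
      apply: le_trans (mu_ge k.+1); apply: (@le_trans _ _ (kap * (2 * (k.+1%:R * Q)))).
        by rewrite ler_wpM2l ?(ltW kap0) //; have := Tle k; have := Tinc k; lra.
      by rewrite le_eqVlt; apply/orP; left; apply/eqP; rewrite /kap; field; rewrite gt_eqF.
    have := ler_wpM2r (_ : 0 <= t - T k) h1; rewrite subr_ge0 => /(_ t0).
    by rewrite !expr2; lra.
  split.
    have [d' /andP[d0 dle] UE] := U4 _ (Tinc k) pS; exists d'; split.
    - rewrite d0 /=; apply: le_trans dle (le_trans _ ddel); rewrite ler_piMr //.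
      rewrite -expR0 ler_expR oppr_le0 mulr_ge0 ?subr_ge0 //.
      by apply: le_trans (mu_ge k.+1); rewrite mulr_ge0 // ltW.
    - by apply: le_trans dle (decay _ _); rewrite Tinc lexx.
    - by rewrite WU' ?Tinc ?lexx.
  move=> t /andP[t0 tT]; have [h|/ltW h] := leP t (T k); first by apply: IH; rewrite t0.
  by rewrite WU' ?h //; apply: le_trans (U3 t h) (decay _ _); rewrite h.
have Wdecay t : 0 <= t -> `|W t - v t| <= C * expR (- (kap * t ^+ 2)).
  move=> t0; pose k := Num.Def.archi_bound (phi t).
  have pt0 : 0 <= phi t by rewrite -phi0; exact: phi_homo.
  have kE : phi t < k%:R by exact: archi_boundP.
  have [_ h] := P k; apply: h; rewrite t0; apply: before; rewrite pT S1.
  have : k%:R * 1 <= k%:R * (pi / 2) :> R by rewrite ler_wpM2l //; lra.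
  by lra.
(* [W] and [U0] agree on [[0, T 0]] and [T 0] is positive, so the equation also holds at time 0. *)
pose u t := if 0 <= t then W t else U0 t.
have uU t : t <= T 0 -> u t = U0 t.
  by move=> tT; rewrite /u; case: ifP => // t0; rewrite WU // t0.
exists u; split.
- move=> t; have [tT|tT] := ltP t (T 0).
    apply: (@solution_at_near U0); last first.
      by apply: U0_sol; rewrite -pT0; apply: phi_homo; exact: ltW.
    by apply: filterS (lt_nbhsl tT) => r rT; rewrite uU // ltW.
  have t0 : 0 < t by exact: lt_le_trans tT.
  apply: (@solution_at_near W); last exact: Wsol.
  by apply: filterS (lt_nbhsr t0) => r r0; rewrite /u ltW.
- rewrite uU // => h; have := U0_near 0; by rewrite h subrr normr0 ltxx.
- exists (del + C) => t; rewrite /u; case: ifP => [t0|_].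
    apply: le_trans (Wdecay t t0) _; apply: (@le_trans _ _ (C * 1)).
      rewrite ler_wpM2l ?(ltW C0) // -expR0 ler_expR oppr_le0.
      by apply: mulr_ge0; [exact: ltW|exact: sqr_ge0].
    by rewrite mulr1 lerDr ltW.
  by have /andP[_ h] := U0_near t; apply: le_trans h _; rewrite lerDl ltW.
- by exists C, kap; split => // t t0; rewrite /u t0; exact: Wdecay.
Qed.

End Gluing.

(** The next index is the least one whose eigenvalue exceeds the current one by [eps]. By minimality
    its predecessor falls short of that, so the overshoot is at most one gap. The chain starts at
    index 1, index 0 being the axis of the planar motion. *)
Lemma eigenvalue_chain (R : realType) (lam : nat -> R) (L0 eps : R) :
  (forall n, lam n <= lam n.+1) -> (forall n, lam n.+1 - lam n <= L0) ->
  (forall M, exists n, M < lam n) -> 0 < eps ->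
  exists nn : nat -> nat, [/\ nn 0%N = 1%N, injective nn, forall k, (0 < nn k)%N &
    forall k, lam (nn k) + eps <= lam (nn k.+1) <= lam (nn k) + eps + L0].
Proof.
move=> mono gapL unb eps0.
have lamle i j : (i <= j)%N -> lam i <= lam j.
  by elim: j => [|j IH]; [rewrite leqn0 => /eqP ->|rewrite leq_eqVlt => /orP[/eqP ->//|/IH h]; apply: le_trans h _].
have /choice[next nextP] : forall n, exists m, (n < m)%N /\ lam n + eps <= lam m <= lam n + eps + L0.
  move=> n; have ex : exists m, lam n + eps <= lam m by have [m /ltW h] := unb (lam n + eps); exists m.
  case: (ex_minnP ex) => m mP mmin; exists m.
  have nm : (n < m)%N.
    by rewrite ltnNge; apply/negP => /lamle h; move: (le_trans mP h); rewrite gerDl leNgt eps0.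
  split; rewrite // mP /=; case: m nm mP mmin => // m nm mP mmin.
  have : lam m < lam n + eps by rewrite ltNge; apply/negP => /mmin; rewrite ltnn.
  by have := gapL m; lra.
pose nn k := iter k next 1%N.
have incr : {homo nn : i j / (i < j)%N}.
  by apply: homo_ltn => [? ? ?|k]; [exact: ltn_trans|case: (nextP (nn k))].
exists nn; split => //.
- by move=> i j ij; case: (ltngtP i j) => // /incr; rewrite ij ltnn.
- by elim=> // k IH; case: (nextP (nn k)) => h _; exact: leq_ltn_trans h.
- by move=> k; case: (nextP (nn k)).
Qed.

(** * Assembly of the nonlinearity, the attractor and the two trajectories *)

Unset Implicit Arguments.
Theorem theorem2p1 (R : realType) (V : completeNormedModType R)
  (ip : V -> V -> R) (A : V -> V) (DA : set V) (lam : nat -> R) (e : nat -> V) :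
  inner_product ip ->
  self_adjoint ip A DA -> positive_op ip A DA -> compact_inverse A DA ->
  0 < lam 0 -> (forall n, lam n <= lam n.+1) ->
  orthonormal_basis ip e ->
  (forall n, DA (e n) /\ A (e n) = lam n *: e n) ->
  has_ubound (range (fun n => lam n.+1 - lam n)) ->
  forall L : R, sup (range (fun n => lam n.+1 - lam n)) / 2 < L -> lam 1 < L ->
  exists F : V -> V,
    smooth F /\ (forall u v, `|F u - F v| <= L * `|u - v|) /\
    exists S : R -> V -> V, generates_semigroup A DA F S /\
    exists Att : set V, global_attractor S Att /\
    exists u v : R -> V,
      trajectory_on A DA F Att u /\ trajectory_on A DA F Att v /\ u <> v /\
      exists C kappa : R, 0 < C /\ 0 < kappa /\
        forall t : R, 0 <= t -> `|u t - v t| <= C * expR (- (kappa * t ^+ 2)).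
Proof.
move=> ipP Asa Apos Acpt lam0 mono eP Ae gap_bnd L L0L lam1L.
set L0 := sup _ in L0L.
have gapL n : lam n.+1 - lam n <= L0.
  by apply: ub_le_sup => //; exists n.
(* Half of the available slack: with [G = L0 + eps], [G / 2] is the midpoint of [L0 / 2] and [L]. *)
pose eps := (2 * L - L0) / 2; have eps0 : 0 < eps by rewrite /eps; lra.
have [nn [nn0 nn_inj nn_gt0 chain]] :=
  eigenvalue_chain mono gapL (lam_unbounded ipP Asa Acpt lam0 mono eP Ae) eps0.
pose mu k := lam (nn k); pose f k := e (nn k); pose G := L0 + eps.
have [ort _] := eP.
have e0e0 : ip (e 0%N) (e 0%N) = 1 by rewrite ort eqxx.
have e0f k : ip (e 0%N) (f k) = 0 by rewrite ort eq_sym (gtn_eqF (nn_gt0 k)).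
have fP i j : ip (f i) (f j) = (i == j)%:R by rewrite ort (inj_eq nn_inj).
have mu0E : mu 0%N = lam 1%N by rewrite /mu nn0.
have l0_itv : 0 <= lam 0%N <= mu 0%N by rewrite mu0E (ltW lam0) mono.
have gap_itv k : 0 <= gap mu k <= G.
  by have := chain k; rewrite /gap /G /mu; lra.
have gap_ge0 k : 0 <= gap mu k by have /andP[] := gap_itv k.
have mu_ge k : eps * k%:R <= mu k.
  elim: k => [|k IH]; first by rewrite mulr0 mu0E (le_trans (ltW lam0)) // mono.
  by have := chain k; rewrite -/(mu k) -/(mu k.+1) -addn1 natrD; lra.
have [K _] := cutoffs_exist R.
have [E [E1 _ E2 E3]] := operator_exists ipP fP (ecoef_le gap_itv) (@inj_id _).
have /choice[D DP] : forall b, exists T : V -> V, [/\ bounded_linear T,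
    forall u k, ip (T u) (f k) = dcoef mu b k * ip u (f k) & forall u, span_closed ip f (T u)].
  by move=> b; have [T [T1 _ T2 T3]] := operator_exists ipP fP (dcoef_le gap_itv b) (@inj_id _); exists T.
have jle b k : `|jcoef b k : R| <= 1.
  by rewrite /jcoef; case: ifP => _; [|case: ifP => _]; rewrite ?normrN ?normr1 ?normr0.
have /choice[J JP] : forall b, exists T : V -> V, [/\ bounded_linear T,
    forall u k, ip (T u) (f k) = jcoef b k * ip u (f (partner b k)) & forall u, span_closed ip f (T u)].
  move=> b; have [T [T1 _ T2 T3]] := operator_exists ipP fP (jle b) (inv_inj (partnerK b)).
  by exists T.
have EP := And3 E1 E2 E3.
have muL : mu 0%N < L by rewrite mu0E.
have GL : G / 2 < L by rewrite /G /eps; lra.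
have [del [om [del01 om01 FL]]] :=
  nonlinearity_lipschitz K ipP e0e0 e0f fP l0_itv gap_itv EP DP JP muL GL.
have [del0 _] := andP del01; have [om0 _] := andP om01.
set F := nonlinearity _ _ _ _ _ _ _ _ _ _ _ in FL.
have [Fs [BF [_ [_ _ FB _]]]] : nicev ip F by exact: nicev_nonlinearity.
exists F; split; first exact: (smooth_of_vector ipP Fs).
split => //.
have Lpos : 0 < L by apply: lt_trans lam1L; apply: lt_le_trans (mono 0%N).
have [S [Att [SP AttP traj]]] := semigroup_attractor ipP Asa Apos Acpt lam0 mono eP Ae Lpos FL FB.
exists S; split => //; exists Att; split => //.
have [s [phi O]] := orbit_exists K om0.
have Alin : linear_on A DA by case: Asa.
have Af k : DA (f k) /\ A (f k) = mu k *: f k by exact: Ae.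
have mu00 : 0 <= mu 0%N by rewrite mu0E (le_trans (ltW lam0)).
pose v := orbit_pt (e 0%N) f s phi.
have vsol : forall t, solution_at A DA F v t.
  exact: (orbit_pt_solution ipP e0e0 e0f fP EP DP JP del01 Alin (Ae 0%N) Af O).
have [U0 [U1 U2 U3]] := stage_first ipP e0e0 e0f fP EP DP JP om0 del01 Alin (Ae 0%N) Af mu00 gap_ge0 O.
have phi0 : phi 0 = 0 by apply: (orbit_early O); have := orbit_past O (lexx 0); lra.
have cphi : continuous phi by move=> t; exact: deriv_at_continuous (orbit_dphi O t).
(* The angle vanishes as long as [s t >= 4], so at angle [pi / 4] the first rotation, finished at
   [s t = 6], is over. *)
have U3' t : phi t = pi / 4 -> exists2 d, 0 <= d <= del & U0 t = v t + d *: f 1%N.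
  move=> pt; apply: U3; rewrite leNgt; apply/negP => h.
  have : phi t = 0 by apply: (orbit_early O); lra.
  by rewrite pt; have := pi_gt0 R; lra.
have [u [usol uv [B uB] [C [kap [C0 kap0 dec]]]]] :=
  glued_trajectory ipP Asa Apos FL SP eps0 del0 om0 mu_ge cphi (orbit_homo om0 O) phi0 (orbit_late O) U1 U2 U3'
   (fun k d tau => @stage_next _ _ _ _ _ _ _ _ E _ _ _ _ _ _ _ _ ipP e0e0 e0f fP DP JP om0 del01 Alin (Ae 0%N) Af mu00 gap_ge0 O k d tau).
have vB t : `|v t| <= 3 + 3.
  have [x3 y3] := orbit_le3 O t; have nE k : `|e k| = 1.
    by have := sqrtr_sqr `|e k|; rewrite -(ipE ipP) ort eqxx sqrtr1 normr_id => <-.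
  rewrite /v /orbit_pt; apply: le_trans (ler_normD _ _) _.
  by rewrite (normrZ (orbit_x s phi t)) (normrZ (orbit_y s phi t)) (nE 0%N) (nE (nn 0%N)) !mulr1 (lerD x3 y3).
exists u, v; split.
  split => //; apply: traj => //; exists (B + (3 + 3)) => _ [t _ <-].
  by rewrite -[u t](subrK (v t)); apply: le_trans (ler_normD _ _) _; exact: lerD.
split; first by split => //; apply: traj => //; exists (3 + 3) => _ [t _ <-].
split; first by move=> h; apply: uv; rewrite h.
by exists C, kap.
Qed.
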